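(* Let $k$ be an algebraically closed field of characteristic $p>0$, let $e\ge 1$ with $p^e>2$, let $c\in k\setminus\{0\}$, and for $i=1,2$ let $L_i(T)=\alpha_{i,e}T^{p^e}+\alpha_{i,e-1}T^{p^{e-1}}+\cdots+\alpha_{i,0}T\in k[T]$ with $\alpha_{i,e}\alpha_{i,0}\neq 0$. Let $X$ be the smooth model of the plane curve over $k$ defined by $L_1(x)\cdot L_2(y)+c=0$, and let $\varphi: X\to\mathbb{P}^3$ be the morphism given by $(x:y:1:xy)$, where $\mathbb{P}^3$ has homogeneous coordinates $(X:Y:Z:W)$. Let $r\ge 1$ be the integer defined by $$\mathbb{F}_{p^{r}}=\bigcap_{i>0,\ \alpha_{1,i}\neq 0}\mathbb{F}_{p^i}\ \cap\bigcap_{j>0,\ \alpha_{2,j}\neq 0}\mathbb{F}_{p^j}$$ (intersection of subfields of $k$). Assume that $L_1=L_2$ and $r<e$. Let $\ell\subset\mathbb{P}^3$ be a line. Then $\ell$ is a Galois line for $\varphi(X)$ if and only if $\ell$ is one of the following: (a) an $\mathbb{F}_{p^{r}}$-line contained in the plane $\{Z=0\}$ and passing through the point $(0:0:0:1)$; or (b) the line defined by $W-aX=Y-aZ=0$ or by $W-aY=X-aZ=0$ for some $a\in k$.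
   Context: A line $\ell\subset\mathbb{P}^3$ is a Galois line for a space curve $\Gamma\subset\mathbb{P}^3$ if the function field extension $k(\Gamma)/\pi_\ell^*k(\mathbb{P}^1)$ induced by the projection $\pi_\ell:\Gamma\dashrightarrow\mathbb{P}^1$ from $\ell$ is Galois. (The line $\ell$ may meet $\Gamma$.) The morphism $\varphi$ is the unique extension to the smooth projective curve $X$ of the rational map given by the functions $x,y,1,xy\in k(X)$. An $\mathbb{F}_{p^r}$-line is a line of $\mathbb{P}^3$ that can be defined by linear equations with coefficients in $\mathbb{F}_{p^r}$. $\mathbb{F}_{p^i}$ denotes the subfield of $k$ with $p^i$ elements. The letter $X$ denotes both the curve and the first coordinate of $\mathbb{P}^3$. *)

(* Defs.v *)
From mathcomp Require Import all_boot all_order all_algebra all_field.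
From mathcomp Require Export mpoly.

Set Implicit Arguments.
Unset Strict Implicit.
Unset Printing Implicit Defensive.

Import GRing.Theory.
Local Open Scope ring_scope.

Definition additive_poly (k : fieldType) (p e : nat) (alpha : 'I_e.+1 -> k) :
    {poly k} :=
  \sum_(i < e.+1) alpha i *: 'X^(p ^ i).

(* [z] lies in the subfield of [k] with [q] elements; [s] enumerates that
   subfield.  False for every [z] if [k] has no such subfield. *)
Definition in_subfield_of_order (k : fieldType) (q : nat) (z : k) : Prop :=
  exists s : seq k,
    [/\ uniq s, size s = q, divring_closed (mem s) & z \in s].

Definition curve_poly (k : fieldType) (L1 L2 : {poly k}) (c : k) : {mpoly k[2]} :=
  horner_alg ('X_0 : {mpoly k[2]}) L1 * horner_alg ('X_1 : {mpoly k[2]}) L2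
  + c%:MP.

(* [K], with structure map [iota], is the field of fractions of
   k[x,y]/(f), the classes of the two variables being [x] and [y].
   This determines (K, iota, x, y) up to a unique isomorphism, and a model
   exists if and only if (f) is a prime ideal. *)
Definition is_plane_curve_function_field (k K : fieldType)
    (iota : {rmorphism k -> K}) (f : {mpoly k[2]}) (x y : K) : Prop :=
  let ev := mmap iota (fun i : 'I_2 => [:: x; y]`_i) in
  (forall g : {mpoly k[2]}, ev g = 0 <-> exists q : {mpoly k[2]}, g = q * f) /\
  (forall z : K, exists g h : {mpoly k[2]}, ev h != 0 /\ z = ev g / ev h).

(* For (v_0 : ... : v_{n-1}) a rational map from a variety with function field
   [K] to the projective space of dimension n - 1, this is the subfield of [K]
   formed by the pullbacks of the rational functions of the (closure of the)
   image: quotients of two forms of equal degree, the denominator not vanishing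
   identically on the image. *)
Definition image_function_field (k K : fieldType) (iota : {rmorphism k -> K})
    (n : nat) (v : 'cV[K]_n) (z : K) : Prop :=
  let ev := mmap iota (fun i : 'I_n => v i 0) in
  exists (d : nat) (P Q : {mpoly k[n]}),
    [/\ P \is d.-homog, Q \is d.-homog, ev Q != 0 & z = ev P / ev Q].

(* The extension L/E of subfields of [K] is finite and Galois: it is isomorphic,
   via [g], to an extension M/F that is Galois in the sense of [galois]. *)
Definition galois_extension (K : fieldType) (E L : K -> Prop) : Prop :=
  exists (F : fieldType) (M : splittingFieldType F) (g : {rmorphism M -> K}),
    [/\ forall z, E z <-> exists a : F, z = g a%:A,
        forall z, L z <-> exists m : M, z = g m &
        galois 1%AS {:M}%AS].

(* Homogeneous coordinates (X : Y : Z : W) on P^3. *)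
Definition iX : 'I_4 := @Ordinal 4 0 isT.
Definition iY : 'I_4 := @Ordinal 4 1 isT.
Definition iZ : 'I_4 := @Ordinal 4 2 isT.
Definition iW : 'I_4 := @Ordinal 4 3 isT.

(* A line of P^3 is the projectivization of a 2-dimensional subspace of k^4. *)
Definition is_line (k : fieldType) (l : {vspace 'cV[k]_4}) : Prop :=
  \dim l = 2%N.

(* The rows of [H] are linear forms whose common zero locus is [l]. *)
Definition defined_by (k : fieldType) (m : nat) (H : 'M[k]_(m, 4))
    (l : {vspace 'cV[k]_4}) : Prop :=
  forall v : 'cV[k]_4, v \in l <-> H *m v = 0.

Definition rational_over_subfield_of_order (k : fieldType) (q : nat)
    (l : {vspace 'cV[k]_4}) : Prop :=
  exists (m : nat) (H : 'M[k]_(m, 4)),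
    (forall i j, in_subfield_of_order q (H i j)) /\ defined_by H l.

(* [l] is a Galois line for the image of (phi_0 : ... : phi_3).  If the two rows
   h_0, h_1 of [H] define [l], then the projection from [l] is (h_0 : h_1); the
   subfields below do not depend on the choice of [H]. *)
Definition galois_line (k K : fieldType) (iota : {rmorphism k -> K})
    (phi : 'cV[K]_4) (l : {vspace 'cV[k]_4}) : Prop :=
  exists H : 'M[k]_(2, 4),
    defined_by H l /\
    galois_extension (image_function_field iota (map_mx iota H *m phi))
                     (image_function_field iota phi).

Definition phi_xy (K : fieldType) (x y : K) : 'cV[K]_4 :=
  \col_(i < 4) [:: x; y; 1; x * y]`_i.

(* Main.v *)
Require Import Defs.
From HB Require Import structures.
From mathcomp Require Import all_boot all_order all_algebra all_field.
From mathcomp Require Import ring zify.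
From Stdlib Require Import Classical_Prop ClassicalEpsilon.

(* Let q = p^e and let delta be the derivation of K = k(x, y) with
   delta x = L(x), delta y = - L(y).  Call h regular if h omega is a regular
   differential, where omega is dual to delta; x^i y^j is regular for
   i, j <= q - 2.  The trace of a regular function for the translations
   y -> y + lam (L(lam) = 0) vanishes.  For an automorphism sigma, the conjugates
   by sigma of the translations therefore move (x, y) to q points over K whose
   evaluations, suitably weighted, annihilate all polynomials of bidegree at most
   (q - 2, q - 2); this is only possible if all abscissas, or all ordinates,
   coincide.  So sigma preserves the pair of subfields k(x), k(y), and it follows
   that sigma is (x, y) -> (a x + b, y / a + b'), up to exchanging the
   coordinates, with L(b) = L(b') = 0 and L(a X) = a L(X), i.e. a in F_{p^r}.

   The projection from a line is a ratio t = h1 / h0 of forms in 1, x, y, xy,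
   where h0 may be chosen without xy.  If the line is Galois, t is fixed by
   [K : k(t)] such automorphisms.  A nontrivial translation fixing t leads to
   lines of type (b), or to k(t) = k(x + gamma y).  Otherwise, a fixed
   automorphism (a x + b, y / a + b') with a <> 1 leads to k(t) = k(xy) or
   k(x / y), and without one there are at most two automorphisms; both
   contradict lower bounds on [K : k(t)], found by specializing relations over
   k[t] to t = s.  For k(t) = k(x + gamma y) the degree is 2q, so some
   automorphism exchanges the coordinates and gamma lies in F_{p^r}.

   Conversely, the conjugates of y over k(x) are the y + lam, and those of x over
   k(x + gamma y) are the x + lam and the gamma y + lam. *)

Import GRing.Theory.
Local Open Scope ring_scope.
Set Implicit Arguments.
Unset Strict Implicit.
Unset Printing Implicit Defensive.

(** * Additive polynomials *)

(** The bound q - 2 has one source and three uses. At a pole of x, delta (1/x) = - L(x) / x^2 is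
    x^(q-2) times a unit, so poles of order q - 2 are still regular; sums of polynomials of degree
    at most q - 2 over the roots of L vanish, which kills the traces; and bidegree (q - 2, q - 2)
    still isolates one of q points, unless all share an abscissa or all share an ordinate. The
    weights are conjugates of 1/u, where sigma delta = u delta sigma; at that stage only u <> 0 is
    known. Once sigma is known to respect the pair k(x), k(y), the function 1/u turns out to be
    regular and to lie in both fields, hence to be constant. An image w of a coordinate then
    satisfies delta w = kappa L(w), up to exchanging x and y, and this differential equation has
    only affine solutions. The hypothesis r < e enters as 2 p^r <= q, which also yields q >= 4:
    k(xy) is fixed by at most 2 p^r automorphisms (a x, y/a) and (a y, x/a), too few for a degree at
    least 2q - 2. *)

Section AdditivePoly.
Variables (k : fieldType) (p e : nat) (alpha : 'I_e.+1 -> k).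
Hypothesis hp : p \in [pchar k].
Let q := (p ^ e)%N.
Let L := additive_poly p alpha.

Lemma pexp_gt0 i : (0 < p ^ i)%N.
Proof. by rewrite expn_gt0 prime_gt0 ?(pcharf_prime hp). Qed.

Lemma pcharf_pexp i : [pchar k].-nat (p ^ i)%N.
Proof.
rewrite pnatX; apply/orP; left.
by rewrite pnatE ?(pcharf_prime hp).
Qed.

Lemma additive_hornerE z : L.[z] = \sum_(i < e.+1) alpha i * z ^+ (p ^ i).
Proof.
rewrite /L /additive_poly horner_sum; apply: eq_bigr => i _.
by rewrite hornerZ hornerXn.
Qed.

Lemma additive_hornerD u v : L.[u + v] = L.[u] + L.[v].
Proof.
rewrite !additive_hornerE -big_split; apply: eq_bigr => i _ /=.
by rewrite exprDn_pchar ?pcharf_pexp // mulrDr.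
Qed.

Lemma additive_horner0 : L.[0] = 0.
Proof. by apply: (addrI L.[0]); rewrite -additive_hornerD !addr0. Qed.

Lemma additive_hornerN u : L.[- u] = - L.[u].
Proof.
by apply/eqP; rewrite -addr_eq0 -additive_hornerD addNr additive_horner0.
Qed.

Lemma additive_hornerB u v : L.[u - v] = L.[u] - L.[v].
Proof. by rewrite additive_hornerD additive_hornerN. Qed.

Lemma additive_hornerZ a u :
  (forall i, alpha i != 0 -> a ^+ (p ^ i) = a) -> L.[a * u] = a * L.[u].
Proof.
move=> ha; rewrite !additive_hornerE mulr_sumr; apply: eq_bigr => i _.
have [->|/ha {2}<-] := eqVneq (alpha i) 0; first by rewrite !mul0r mulr0.
by rewrite exprMn mulrCA.
Qed.

Lemma coef_additive n :
  L`_n = \sum_(i < e.+1) alpha i * (n == p ^ i)%N%:R.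
Proof.
by rewrite /L /additive_poly coef_sum; apply: eq_bigr => i _; rewrite coefZ coefXn.
Qed.

Lemma pexp_inj i j : (p ^ i == p ^ j)%N = (i == j).
Proof. by rewrite eqn_exp2l // prime_gt1 ?(pcharf_prime hp). Qed.

Lemma coef_additive_pexp (i : 'I_e.+1) : L`_(p ^ i) = alpha i.
Proof.
rewrite coef_additive (bigD1 i) //= eqxx mulr1 big1 ?addr0 // => j ji.
by rewrite pexp_inj eq_sym (negPf (ji : nat_of_ord j != i)) mulr0.
Qed.

Lemma deriv_additive : L^`() = (alpha ord0)%:P.
Proof.
rewrite /L /additive_poly linear_sum big_ord_recl /= linearZ /= expn0 expr1.
rewrite derivX alg_polyC big1 ?addr0 // => i _.
rewrite linearZ /= derivXn -mulr_natr.
by rewrite natrX (pcharf0 (rmorph_pchar polyC hp)) expr0n mulr0 scaler0.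
Qed.

Hypothesis alphae : alpha ord_max != 0.

Lemma size_additive : size L = q.+1.
Proof.
rewrite /L /additive_poly big_ord_recr /=.
have sz i : size (alpha i *: 'X^(p ^ i)) = if alpha i == 0 then 0%N else (p ^ i).+1.
  have [->|ai] := eqVneq (alpha i) 0; first by rewrite scale0r size_poly0.
  by rewrite size_scale // size_polyXn.
rewrite addrC size_polyDl sz (negPf alphae) //.
apply: leq_ltn_trans (size_sum _ _ _) _; rewrite ltnS.
apply/bigmax_leqP => i _; rewrite sz; case: ifP => // _.
by rewrite ltn_exp2l ?prime_gt1 ?(pcharf_prime hp) //=.
Qed.

Lemma lead_coef_additive : lead_coef L = alpha ord_max.
Proof. by rewrite lead_coefE size_additive /q (coef_additive_pexp ord_max). Qed.

(* [additive_num f g] is [g ^+ q * L (f / g)]. *)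
Definition additive_num (f g : {poly k}) : {poly k} :=
  \sum_(i < e.+1) alpha i *: (f ^+ (p ^ i) * g ^+ (q - p ^ i)).

Lemma leq_pexp (i : 'I_e.+1) : (p ^ i <= q)%N.
Proof. by rewrite leq_exp2l ?prime_gt1 ?(pcharf_prime hp) //= -ltnS. Qed.

(** Every term but the leading one, a multiple of f^q, is divisible by g. *)
Lemma coprimep_additive_num f g :
  coprimep g f -> coprimep g (additive_num f g).
Proof.
move=> gf.
have [d Hd] : exists d, additive_num f g = alpha ord_max *: f ^+ q + d * g.
  exists (\sum_(i < e) alpha (widen_ord (leqnSn e) i)
     *: (f ^+ (p ^ i) * g ^+ (q - p ^ i).-1)).
  rewrite /additive_num big_ord_recr /= subnn expr0 mulr1 addrC; congr (_ + _).
  rewrite mulr_suml; apply: eq_bigr => i _ /=.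
  rewrite -scalerAl -mulrA -exprSr prednK // subn_gt0.
  by rewrite ltn_exp2l ?prime_gt1 ?(pcharf_prime hp) //=.
rewrite Hd addrC coprimep_addl_mul coprimepZr //.
by rewrite coprimep_expr.
Qed.

(** In characteristic p only the term in f g^(q-1) has a nonzero derivative; since q - 1 = - 1 in k,
    it is g^(q-2) times the Wronskian of f and g. *)
Lemma deriv_additive_num f g : (1 < q)%N ->
  (additive_num f g)^`()
  = alpha ord0 *: (g ^+ (q - 2) * (f^`() * g - f * g^`())).
Proof.
move=> q1; have p0 : p%:R = 0 :> {poly k} by rewrite (pcharf0 (rmorph_pchar polyC hp)).
have e0 : (0 < e)%N by move: q1; rewrite /q; case: (e).
have q0 : q%:R = 0 :> {poly k} by rewrite natrX p0 expr0n gtn_eqF.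
rewrite /additive_num linear_sum big_ord_recl big1 => [|i _]; last first.
  have pi0 : (p ^ lift ord0 i)%:R = 0 :> {poly k} by rewrite natrX p0 expr0n.
  have mz (h : {poly k}) n : n%:R = 0 :> {poly k} -> h *+ n = 0.
    by move=> n0; rewrite -(mulr_natr h n) n0 mulr0.
  have qi0 : (q - p ^ lift ord0 i)%:R = 0 :> {poly k}.
    by rewrite natrB ?leq_pexp // q0 pi0 subr0.
  rewrite linearZ /= derivM !deriv_exp (mz _ _ pi0) (mz _ _ qi0).
  by rewrite mul0r mulr0 addr0 scaler0.
rewrite addr0 linearZ /= expn0 expr1 derivM deriv_exp; congr (_ *: _).
rewrite -mulr_natr natrB ?pexp_gt0 // q0 sub0r.
have -> : (q - 1 = (q - 2).+1)%N by rewrite -subSn.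
rewrite /= exprS; ring.
Qed.

End AdditivePoly.

Lemma map_additive_poly (k K : fieldType) (f : {rmorphism k -> K}) p e
    (alpha : 'I_e.+1 -> k) :
  map_poly f (additive_poly p alpha) = additive_poly p (fun i => f (alpha i)).
Proof.
rewrite /additive_poly rmorph_sum /=; apply: eq_bigr => i _.
by rewrite linearZ_LR /= map_polyXn.
Qed.

Section AdditiveRoots.
Variables (k : closedFieldType) (p e : nat) (alpha : 'I_e.+1 -> k).
Hypothesis hp : p \in [pchar k].
Hypothesis alpha0 : alpha ord0 != 0.
Hypothesis alphae : alpha ord_max != 0.
Let q := (p ^ e)%N.
Let L := additive_poly p alpha.

(** L' is the nonzero constant [alpha ord0], so L is separable and its q roots in the algebraically
    closed field are distinct. *)
Lemma additive_roots : exists lam : 'I_q -> k,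
  injective lam /\ L = alpha ord_max *: \prod_i ('X - (lam i)%:P).
Proof.
have [r Lr] := closed_field_poly_normal L.
rewrite (lead_coef_additive hp alphae) in Lr.
have szr : size r = q.
  have := size_additive hp alphae; rewrite -/L Lr size_scale //.
  by rewrite size_prod_XsubC => -[].
have ur : uniq r.
  rewrite -separable_prod_XsubC separable_poly.unlock.
  rewrite -(coprimepZl _ _ alphae) -(coprimepZr _ _ alphae) -linearZ /= -Lr deriv_additive //.
  by rewrite coprimep_sym -[_%:P]mulr1 -alg_polyC -scalerAl mul1r coprimepZl // coprime1p.
exists (fun i => r`_i); split.
  by move=> i j /eqP; rewrite nth_uniq ?szr // => /eqP/val_inj.
by rewrite Lr (big_nth 0) szr big_mkord.
Qed.

End AdditiveRoots.

(** * Sums of polynomials over the roots of L *)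

Section PowerSums.
Variables (k K : fieldType) (iota : {rmorphism k -> K}) (p e : nat).
Variables (alpha : 'I_e.+1 -> k) (lam : 'I_(p ^ e) -> k).
Hypothesis hp : p \in [pchar k].
Hypothesis alpha0 : alpha ord0 != 0.
Hypothesis alphae : alpha ord_max != 0.
Hypothesis lam_inj : injective lam.
Let L := additive_poly p alpha.
Hypothesis Llam : L = alpha ord_max *: \prod_i ('X - (lam i)%:P).

Lemma additive_rootP a : reflect (exists i, a = lam i) (root L a).
Proof.
rewrite Llam rootZ // -(big_map _ predT (fun z => 'X - z%:P)) root_prod_XsubC.
by apply: (iffP mapP) => [[i _ ->]|[i ->]]; exists i; rewrite // mem_index_enum.
Qed.

Lemma additive_root_lam i : L.[lam i] = 0.
Proof. by apply/rootP/additive_rootP; exists i. Qed.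

(* The Lagrange basis denominators are all equal to
   [L'(lam i) / alpha ord_max = alpha ord0 / alpha ord_max]. *)
Lemma additive_power_sum (P : {poly K}) :
  (size P < p ^ e)%N -> \sum_i P.[iota (lam i)] = 0.
Proof.
move=> szP.
pose w i : {poly K} := \prod_(j | j != i) ('X - (iota (lam j))%:P).
pose a := iota (alpha ord0 / alpha ord_max).
have a0 : a != 0 by rewrite fmorph_eq0 mulf_neq0 ?invr_eq0.
have wi i : (w i).[iota (lam i)] = a.
  have := deriv_additive alpha hp; rewrite -/L Llam linearZ /=.
  rewrite (bigD1 i) //= derivM derivXsubC mul1r.
  move/(congr1 (fun f => (map_poly iota f).[iota (lam i)])).
  rewrite linearZ_LR rmorphD rmorphM /= !map_polyC /=.
  rewrite rmorph_prod rmorphB /= map_polyX map_polyC hornerZ !hornerE /=.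
  rewrite subrr mul0r addr0 /a fmorph_div => <-; rewrite mulrC mulKf ?fmorph_eq0 //.
  by congr (_.[_]); apply: eq_bigr => j _; rewrite rmorphB /= map_polyX map_polyC.
have wij i j : j != i -> (w i).[iota (lam j)] = 0.
  by move=> ji; rewrite /w (bigD1 j) //= hornerM hornerXsubC subrr mul0r.
have szw i : size (w i) = (p ^ e)%N.
  rewrite /w size_prod; last by move=> j _; rewrite polyXsubC_eq0.
  under eq_bigr do rewrite size_XsubC.
  rewrite sum_nat_const cardC1 card_ord; have := ltn_ord i; lia.
have lw i : (w i)`_(p ^ e).-1 = 1.
  by rewrite -[X in _`_X.-1](szw i) -lead_coefE lead_coef_prod_XsubC.
(* By Lagrange interpolation, Q has q roots and size at most q, so it is zero. The w i are monic of
   degree q - 1 while P has degree at most q - 2: the coefficient of degree q - 1 is the sum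
   sought. *)
pose Q := a *: P - \sum_i P.[iota (lam i)] *: w i.
have Q0 : Q = 0.
  apply: (@roots_geq_poly_eq0 _ _ [seq iota (lam i) | i : 'I_(p ^ e)]).
  - apply/allP => _ /mapP[i _ ->]; apply/rootP.
    rewrite /Q !hornerE horner_sum (bigD1 i) //= hornerZ wi big1 ?addr0.
      by rewrite mulrC subrr.
    by move=> j ji; rewrite hornerZ wij ?mulr0 // eq_sym.
  - rewrite map_inj_uniq ?enum_uniq // => i j /fmorph_inj /lam_inj //.
  rewrite size_map -cardE card_ord.
  rewrite (leq_trans (size_polyD _ _)) // geq_max size_polyN size_scale // ltnW //=.
  apply: leq_trans (size_sum _ _ _) _; apply/bigmax_leqP => i _.
  by rewrite (leq_trans (size_scale_leq _ _)) // szw.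
have /(congr1 (fun f : {poly K} => f`_(p ^ e).-1)) := Q0.
rewrite coefB coefZ coef0 nth_default; last by rewrite -ltnS prednK ?(pexp_gt0 hp).
rewrite mulr0 sub0r coef_sum => /eqP; rewrite oppr_eq0 => /eqP s0.
by rewrite -[RHS]s0; apply: eq_bigr => i _; rewrite coefZ lw mulr1.
Qed.

End PowerSums.

(** * Function fields of the curves L(x) L(y) = - c *)

HB.lock Definition ev1 (k K : fieldType) (iota : {rmorphism k -> K}) (x : K)
    (f : {poly k}) : K :=
  (map_poly iota f).[x].

Section EvaluationMorphism.
Variables (k K : fieldType) (iota : {rmorphism k -> K}).

Fact ev1_is_zmod_morphism x : zmod_morphism (ev1 iota x).
Proof. by move=> f g; rewrite ev1.unlock rmorphB hornerD hornerN. Qed.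
Fact ev1_is_monoid_morphism x : monoid_morphism (ev1 iota x).
Proof.
by rewrite ev1.unlock; split=> [|f g]; rewrite ?rmorph1 ?hornerC // rmorphM hornerM.
Qed.
HB.instance Definition _ x :=
  GRing.isZmodMorphism.Build {poly k} K (ev1 iota x) (ev1_is_zmod_morphism x).
HB.instance Definition _ x :=
  GRing.isMonoidMorphism.Build {poly k} K (ev1 iota x) (ev1_is_monoid_morphism x).

End EvaluationMorphism.

(* The inner variable is evaluated at [x], the outer one at [y]. *)
HB.lock Definition ev2 (k K : fieldType) (iota : {rmorphism k -> K}) (x y : K)
    (P : {poly {poly k}}) : K :=
  (map_poly (ev1 iota x) P).[y].

Section EvaluationMorphism2.
Variables (k K : fieldType) (iota : {rmorphism k -> K}).

Fact ev2_is_zmod_morphism x y : zmod_morphism (ev2 iota x y).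
Proof. by move=> f g; rewrite ev2.unlock rmorphB hornerD hornerN. Qed.
Fact ev2_is_monoid_morphism x y : monoid_morphism (ev2 iota x y).
Proof.
by rewrite ev2.unlock; split=> [|f g]; rewrite ?rmorph1 ?hornerC // rmorphM hornerM.
Qed.

End EvaluationMorphism2.

Section Evaluation.
Variables (k K : fieldType) (iota : {rmorphism k -> K}).
Local Notation ev1 := (ev1 iota).
Local Notation ev2 := (ev2 iota).

Lemma ev1E x f : ev1 x f = (map_poly iota f).[x].
Proof. by rewrite ev1.unlock. Qed.
Lemma ev2H x y P : ev2 x y P = (map_poly (ev1 x) P).[y].
Proof. by rewrite ev2.unlock. Qed.
Lemma ev1D x (f g : {poly k}) : ev1 x (f + g) = ev1 x f + ev1 x g.
Proof. exact: rmorphD. Qed.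
Lemma ev1N x (f : {poly k}) : ev1 x (- f) = - ev1 x f.
Proof. exact: rmorphN. Qed.
Lemma ev1B x (f g : {poly k}) : ev1 x (f - g) = ev1 x f - ev1 x g.
Proof. exact: rmorphB. Qed.
Lemma ev1M x (f g : {poly k}) : ev1 x (f * g) = ev1 x f * ev1 x g.
Proof. exact: rmorphM. Qed.
Lemma ev1_0 x : ev1 x 0 = 0. Proof. exact: rmorph0. Qed.
Lemma ev1_1 x : ev1 x 1 = 1. Proof. exact: rmorph1. Qed.
Lemma ev1Xn x (f : {poly k}) n : ev1 x (f ^+ n) = ev1 x f ^+ n.
Proof. exact: rmorphXn. Qed.
Lemma ev1_sum x (I : finType) (F : I -> {poly k}) :
  ev1 x (\sum_i F i) = \sum_i ev1 x (F i).
Proof. exact: rmorph_sum. Qed.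
Lemma ev2B x y (P Q : {poly {poly k}}) : ev2 x y (P - Q) = ev2 x y P - ev2 x y Q.
Proof. exact: ev2_is_zmod_morphism. Qed.
Lemma ev2_0 x y : ev2 x y 0 = 0.
Proof. by rewrite -[X in ev2 x y X](subrr 0) ev2B subrr. Qed.
Lemma ev2N x y (P : {poly {poly k}}) : ev2 x y (- P) = - ev2 x y P.
Proof. by rewrite -[X in ev2 x y X]sub0r ev2B ev2_0 sub0r. Qed.
Lemma ev2D x y (P Q : {poly {poly k}}) : ev2 x y (P + Q) = ev2 x y P + ev2 x y Q.
Proof. by rewrite -[in LHS](opprK Q) ev2B ev2N opprK. Qed.
Lemma ev2M x y (P Q : {poly {poly k}}) : ev2 x y (P * Q) = ev2 x y P * ev2 x y Q.
Proof. exact: (ev2_is_monoid_morphism iota x y).2. Qed.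
Lemma ev2_1 x y : ev2 x y 1 = 1.
Proof. exact: (ev2_is_monoid_morphism iota x y).1. Qed.
Lemma ev2Xn x y (P : {poly {poly k}}) n : ev2 x y (P ^+ n) = ev2 x y P ^+ n.
Proof. by elim: n => [|n IH]; rewrite ?expr0 ?ev2_1 // !exprS ev2M IH. Qed.
Lemma ev2_prod x y (I : finType) (A : pred I) (F : I -> {poly {poly k}}) :
  ev2 x y (\prod_(i | A i) F i) = \prod_(i | A i) ev2 x y (F i).
Proof. exact: (big_morph (ev2 x y) (ev2M x y) (ev2_1 x y)). Qed.
Lemma ev1C x a : ev1 x a%:P = iota a.
Proof. by rewrite ev1E map_polyC hornerC. Qed.
Lemma ev1X x : ev1 x 'X = x.
Proof. by rewrite ev1E map_polyX hornerX. Qed.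
Lemma ev1Z x a f : ev1 x (a *: f) = iota a * ev1 x f.
Proof. by rewrite -mul_polyC ev1M ev1C. Qed.
Lemma ev1_iota a f : ev1 (iota a) f = iota f.[a].
Proof. by rewrite ev1E horner_map. Qed.
Lemma ev1_comp x f g : ev1 x (f \Po g) = ev1 (ev1 x g) f.
Proof. by rewrite !ev1E map_comp_poly horner_comp. Qed.

Lemma ev2E x y P : ev2 x y P = \sum_(i < size P) ev1 x P`_i * y ^+ i.
Proof.
rewrite ev2H (@horner_coef_wide _ (size P)); last exact: size_poly.
by apply: eq_bigr => i _; rewrite coef_map.
Qed.
Lemma ev2C x y (f : {poly k}) : ev2 x y f%:P = ev1 x f.
Proof. by rewrite ev2H map_polyC hornerC. Qed.
Lemma ev2X x y : ev2 x y 'X = y.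
Proof. by rewrite ev2H map_polyX hornerX. Qed.
Lemma ev2Z x y f P : ev2 x y (f *: P) = ev1 x f * ev2 x y P.
Proof. by rewrite -mul_polyC ev2M ev2C. Qed.
Lemma ev2_map x y f : ev2 x y (map_poly polyC f) = ev1 y f.
Proof.
rewrite ev2H -map_poly_comp ev1E; congr (_.[_]).
by apply: eq_map_poly => a /=; rewrite ev1C.
Qed.
Lemma ev2_comp x y P Q : ev2 x y (P \Po Q) = ev2 x (ev2 x y Q) P.
Proof. by rewrite !ev2H map_comp_poly horner_comp. Qed.

Lemma ev1_ind (S : K -> Prop) x : (forall a, S (iota a)) -> S x ->
  (forall a b, S a -> S b -> S (a + b)) -> (forall a b, S a -> S b -> S (a * b)) ->
  forall f, S (ev1 x f).
Proof.
move=> Sc Sx SD SM; elim/poly_ind => [|f a IH].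
  by rewrite ev1_0 -(rmorph0 iota).
by rewrite ev1D ev1M ev1X ev1C; auto.
Qed.

Lemma ev2_ind (S : K -> Prop) x y : (forall a, S (iota a)) -> S x -> S y ->
  (forall a b, S a -> S b -> S (a + b)) -> (forall a b, S a -> S b -> S (a * b)) ->
  forall P, S (ev2 x y P).
Proof.
move=> Sc Sx Sy SD SM; elim/poly_ind => [|P f IH].
  by rewrite ev2_0 -(rmorph0 iota).
rewrite ev2D ev2M ev2X ev2C.
exact: SD (SM _ _ IH Sy) (ev1_ind Sc Sx SD SM f).
Qed.

Lemma ev2_swap x y P : ev2 x y (swapXY P) = ev2 y x P.
Proof.
elim/poly_ind: P => [|P f IH]; first by rewrite rmorph0 !ev2_0.
rewrite rmorphD rmorphM /= !ev2D !ev2M IH swapXY_X swapXY_polyC ev2C ev2X ev2_map.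
by rewrite ev2C ev1X.
Qed.

End Evaluation.

(** * Coordinate pairs of the curve and the maps between them *)

Section CurveDef.
Variables (k K : fieldType) (iota : {rmorphism k -> K}) (L : {poly k}).
Local Notation ev1 := (ev1 iota).
Local Notation ev2 := (ev2 iota).

Definition curve_rel (c : k) : {poly {poly k}} := L%:P * map_poly polyC L + c%:P%:P.

(** The notion [is_plane_curve_function_field] for two equal additive polynomials, with
    [{poly {poly k}}] in place of [{mpoly k[2]}]: degrees in y and pseudo-division by the relation
    become available. *)
Definition is_curve (c : k) (x y : K) : Prop :=
  (forall P, ev2 x y P = 0 <-> exists Q : {poly {poly k}}, P = Q * curve_rel c) /\
  (forall z, exists P Q, ev2 x y Q != 0 /\ z = ev2 x y P / ev2 x y Q).

Lemma ev2_curve_rel c x y : ev2 x y (curve_rel c) = ev1 x L * ev1 y L + iota c.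
Proof. by rewrite ev2D ev2M ev2_map !ev2C ev1C. Qed.

Lemma swapXY_curve_rel c : swapXY (curve_rel c) = curve_rel c.
Proof.
rewrite /curve_rel rmorphD rmorphM /= swapXY_map_polyC !swapXY_polyC map_polyC /=.
by rewrite mulrC.
Qed.

(** The relation is symmetric because both factors use the same L; statements about k(x) are reused
    for k(y) through this symmetry. *)
Lemma is_curve_swap c x y : is_curve c x y -> is_curve c y x.
Proof.
move=> [ker gen]; split => [P|z].
  rewrite -ev2_swap ker; split => -[Q e]; exists (swapXY Q).
    by rewrite -[P]swapXYK e rmorphM /= swapXY_curve_rel.
  by rewrite e rmorphM /= swapXY_curve_rel.
have [P [Q [Q0 zE]]] := gen z; exists (swapXY P), (swapXY Q).
by rewrite !ev2_swap.
Qed.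

Lemma is_curve_eq c x y : is_curve c x y -> ev1 x L * ev1 y L = - iota c.
Proof.
move=> [ker _]; apply/eqP; rewrite -addr_eq0 -ev2_curve_rel; apply/eqP/ker.
by exists 1; rewrite mul1r.
Qed.

Lemma is_curve_ind c x y (S : K -> Prop) : is_curve c x y ->
  (forall a, S (iota a)) -> S x -> S y ->
  (forall a b, S a -> S b -> S (a + b)) -> (forall a b, S a -> S b -> S (a * b)) ->
  (forall a, S a -> S a^-1) -> forall z, S z.
Proof.
move=> [_ gen] Sc Sx Sy SD SM SV z; have [P [Q [_ ->]]] := gen z.
exact: SM (ev2_ind Sc Sx Sy SD SM P) (SV _ (ev2_ind Sc Sx Sy SD SM Q)).
Qed.

Lemma is_curve_rmorph_eq c x y (K' : fieldType) (f g : {rmorphism K -> K'}) :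
  is_curve c x y -> (forall a, f (iota a) = g (iota a)) -> f x = g x -> f y = g y ->
  f =1 g.
Proof.
move=> hC fc fx fy z; apply: (is_curve_ind hC (S := fun z => f z = g z)) => //.
- by move=> a b fa fb; rewrite !rmorphD fa fb.
- by move=> a b fa fb; rewrite !rmorphM fa fb.
by move=> a fa; rewrite !fmorphV fa.
Qed.

Lemma rmorph_ev1 (f : {rmorphism K -> K}) x P :
  (forall a, f (iota a) = iota a) -> f (ev1 x P) = ev1 (f x) P.
Proof.
move=> fc; elim/poly_ind: P => [|P a IH]; first by rewrite !ev1_0 rmorph0.
by rewrite !ev1D !ev1M rmorphD rmorphM IH !ev1X !ev1C fc.
Qed.

Lemma rmorph_ev2 (f : {rmorphism K -> K}) x y P :
  (forall a, f (iota a) = iota a) -> f (ev2 x y P) = ev2 (f x) (f y) P.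
Proof.
move=> fc; elim/poly_ind: P => [|P a IH]; first by rewrite !ev2_0 rmorph0.
by rewrite !ev2D !ev2M rmorphD rmorphM IH !ev2X !ev2C rmorph_ev1.
Qed.

Section Lift.
Variables (c : k) (x y x' y' : K).
Hypotheses (hC : is_curve c x y) (hC' : is_curve c x' y').

Lemma ker_eq P : ev2 x y P = 0 <-> ev2 x' y' P = 0.
Proof. by rewrite (proj1 hC) (proj1 hC'). Qed.

Let frac z : exists w : {poly {poly k}} * {poly {poly k}},
  (ev2 x y w.2 != 0) && (z == ev2 x y w.1 / ev2 x y w.2).
Proof.
by have [P [Q [Q0 ->]]] := proj2 hC z; exists (P, Q); rewrite Q0 eqxx.
Qed.

(** A fraction representing z is chosen and evaluated at (x', y'); the value depends on z only,
    since both pairs satisfy the same polynomial relations. *)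
Let lift z := let w := xchoose (frac z) in ev2 x' y' w.1 / ev2 x' y' w.2.

Let ev2_nz S : ev2 x y S != 0 -> ev2 x' y' S != 0.
Proof. by apply: contra => /eqP/ker_eq ->. Qed.

Let frac_eq (P Q P1 Q1 : {poly {poly k}}) : ev2 x y Q != 0 -> ev2 x y Q1 != 0 ->
  ev2 x y P / ev2 x y Q = ev2 x y P1 / ev2 x y Q1 ->
  ev2 x' y' P1 / ev2 x' y' Q1 = ev2 x' y' P / ev2 x' y' Q.
Proof.
move=> Q0 Q10 /eqP; rewrite eqr_div // => /eqP e; apply/eqP.
rewrite eqr_div ?ev2_nz // -!ev2M -subr_eq0 -ev2B; apply/eqP/ker_eq.
by rewrite ev2B !ev2M e subrr.
Qed.

Let liftE P Q : ev2 x y Q != 0 ->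
  lift (ev2 x y P / ev2 x y Q) = ev2 x' y' P / ev2 x' y' Q.
Proof.
move=> Q0; rewrite /lift; case/andP: (xchooseP (frac (ev2 x y P / ev2 x y Q))).
by move=> Q10 /eqP /frac_eq ->.
Qed.

Lemma is_curve_lift : exists f : {rmorphism K -> K},
  [/\ forall a, f (iota a) = iota a, f x = x' & f y = y'].
Proof.
have liftP P : lift (ev2 x y P) = ev2 x' y' P.
  by have := @liftE P 1; rewrite !ev2_1 !divr1; apply; rewrite oner_eq0.
have lB : zmod_morphism lift.
  move=> a b; have [P [Q [Q0 ->]]] := proj2 hC a; have [P1 [Q1 [Q10 ->]]] := proj2 hC b.
  rewrite -mulNr addf_div // -ev2N -!ev2M -ev2D !liftE //; last by rewrite ev2M mulf_neq0.
  by rewrite !ev2D !ev2M ev2N -mulNr addf_div ?ev2_nz.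
have lM : monoid_morphism lift.
  split; first by rewrite -(ev2_1 iota x y) liftP !ev2_1.
  move=> a b; have [P [Q [Q0 ->]]] := proj2 hC a; have [P1 [Q1 [Q10 ->]]] := proj2 hC b.
  by rewrite mulf_div -!ev2M !liftE ?ev2M ?mulf_neq0 // mulf_div.
pose fA := GRing.isZmodMorphism.Build K K lift lB.
pose fM := GRing.isMonoidMorphism.Build K K lift lM.
pose f : {rmorphism K -> K} := HB.pack lift fA fM.
exists f; split => [a| |]; rewrite /f /=.
- by have := liftP a%:P%:P; rewrite !ev2C !ev1C.
- by have := liftP 'X%:P; rewrite !ev2C !ev1X.
by have := liftP 'X; rewrite !ev2X.
Qed.

End Lift.

Lemma is_curve_iso c x y x' y' : is_curve c x y -> is_curve c x' y' ->
  exists f g : {rmorphism K -> K},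
  [/\ forall a, f (iota a) = iota a, forall a, g (iota a) = iota a,
      cancel f g, cancel g f & f x = x' /\ f y = y'].
Proof.
move=> hC hC'.
have [f [fc fx fy]] := is_curve_lift hC hC'.
have [g [gc gx gy]] := is_curve_lift hC' hC.
exists f, g; split => // z.
  have := is_curve_rmorph_eq (f := g \o f) (g := idfun) hC; apply => //=.
  - by move=> a; rewrite fc gc.
  - by rewrite fx gx.
  by rewrite fy gy.
have := is_curve_rmorph_eq (f := f \o g) (g := idfun) hC'; apply => //=.
- by move=> a; rewrite gc fc.
- by rewrite gx fx.
by rewrite gy fy.
Qed.

End CurveDef.

Lemma size_curve_rel (k : fieldType) (L : {poly k}) c :
  (1 < size L)%N -> size (curve_rel L c) = size L.
Proof.
move=> sL; have L0 : L != 0 by rewrite -size_poly_gt0 ltnW.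
rewrite /curve_rel size_polyDl mul_polyC size_scale ?size_map_polyC //.
exact: leq_ltn_trans (size_polyC_leq1 _) _.
Qed.

Lemma lead_coef_curve_rel (k : fieldType) (L : {poly k}) c :
  (1 < size L)%N -> lead_coef (curve_rel L c) = L * (lead_coef L)%:P.
Proof.
move=> sL; have L0 : L != 0 by rewrite -size_poly_gt0 ltnW.
rewrite /curve_rel lead_coefDl mul_polyC.
  by rewrite lead_coefZ lead_coef_map_inj //; apply: polyC_inj.
by rewrite size_scale ?size_map_polyC // (leq_ltn_trans (size_polyC_leq1 _)).
Qed.

Section Transcendence.
Variables (k K : fieldType) (iota : {rmorphism k -> K}) (L : {poly k}).
Hypothesis sL : (1 < size L)%N.
Variables (c : k) (x y : K).
Hypothesis hC : is_curve iota L c x y.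
Local Notation ev1 := (ev1 iota).
Local Notation ev2 := (ev2 iota).

(** The relation has the degree of L in y, and its nonzero multiples have at least that degree. All
    comparisons of coefficients in K rest on this. *)
Lemma ev2_small_eq0 (P : {poly {poly k}}) : (size P < size L)%N -> ev2 x y P = 0 -> P = 0.
Proof.
move=> sP /(proj1 hC)[Q e]; apply: contraTeq sP => P0.
have Q0 : Q != 0 by apply: contra P0 => /eqP Q0; rewrite e Q0 mul0r.
have D0 : curve_rel L c != 0 by rewrite -size_poly_gt0 size_curve_rel // ltnW.
rewrite -leqNgt e size_mul // size_curve_rel //.
by move: Q0; rewrite -size_poly_gt0; case: (size Q) => // n _; rewrite addSn leq_addl.
Qed.

Lemma ev1_eq0 f : (ev1 x f == 0) = (f == 0).
Proof.
apply/eqP/eqP => [f0|->]; last by rewrite ev1_0.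
apply: polyC_inj; rewrite polyC0.
apply: ev2_small_eq0; last by rewrite ev2C.
exact: leq_ltn_trans (size_polyC_leq1 _) sL.
Qed.

Lemma ev1_inj : injective (ev1 x).
Proof.
by move=> f g e; apply/eqP; rewrite -subr_eq0 -ev1_eq0 ev1B e subrr.
Qed.

End Transcendence.

Lemma ratio_coprime (k K : fieldType) (iota : {rmorphism k -> K}) x z f g :
  ev1 iota x g != 0 -> z = ev1 iota x f / ev1 iota x g ->
  exists f1 g1, [/\ coprimep f1 g1, ev1 iota x g1 != 0 &
                    z = ev1 iota x f1 / ev1 iota x g1].
Proof.
move=> g0 ze; have g0' : g != 0 by apply: contra g0 => /eqP ->; rewrite ev1_0.
have d0 : gcdp f g != 0 by rewrite gcdp_eq0 negb_and g0' orbT.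
exists (f %/ gcdp f g), (g %/ gcdp f g).
have fE : f = f %/ gcdp f g * gcdp f g by rewrite divpK ?dvdp_gcdl.
have gE : g = g %/ gcdp f g * gcdp f g by rewrite divpK ?dvdp_gcdr.
have gg : ev1 iota x (g %/ gcdp f g) * ev1 iota x (gcdp f g) != 0.
  by rewrite -ev1M -gE.
split; first by rewrite coprimep_div_gcd // g0' orbT.
  by move: gg; rewrite mulf_eq0 negb_or => /andP[].
move: gg; rewrite mulf_eq0 negb_or => /andP[g1 d1].
have ef := congr1 (ev1 iota x) fE; have eg := congr1 (ev1 iota x) gE.
rewrite !ev1M in ef eg.
by rewrite ze ef eg -mulf_div divff ?mulr1.
Qed.

(** The standing hypotheses on L, with an enumeration [lam] of its q roots, which index the
    translations. *)
Record additive_setup (k : fieldType) (p e : nat) (alpha : 'I_e.+1 -> k)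
    (lam : 'I_(p ^ e) -> k) : Prop := AdditiveSetup {
  as_pchar : p \in [pchar k];
  as_gt2 : (2 < p ^ e)%N;
  as_low : alpha ord0 != 0;
  as_lead : alpha ord_max != 0;
  as_inj : injective lam;
  as_prod : additive_poly p alpha = alpha ord_max *: \prod_i ('X - (lam i)%:P)
}.

Lemma additive_comp_affine (k : fieldType) p e (alpha : 'I_e.+1 -> k) a b :
  p \in [pchar k] ->
  additive_poly p alpha \Po (a *: 'X + b%:P)
  = additive_poly p (fun i => alpha i * a ^+ (p ^ i)) + (additive_poly p alpha).[b]%:P.
Proof.
move=> hp; rewrite additive_hornerE {1}/additive_poly linear_sum /=.
rewrite rmorph_sum /additive_poly -big_split; apply: eq_bigr => i _ /=.
rewrite comp_polyZ comp_Xn_poly exprDn_pchar; last first.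
  apply: sub_in_pnat (pcharf_pexp hp i) => ? _.
  by apply: (rmorph_pchar polyC).
rewrite scalerDr exprZn scalerA; congr (_ + _).
by rewrite -polyC_exp -mul_polyC -polyCM.
Qed.

(** * Translations of y and their fixed field k(x) *)

Section Translations.
Variables (k K : fieldType) (iota : {rmorphism k -> K}) (p m : nat).
Variables (alpha : 'I_m.+1 -> k) (lam : 'I_(p ^ m) -> k).
Hypothesis hA : additive_setup alpha lam.
Local Notation L := (additive_poly p alpha).
Local Notation q := (p ^ m)%N.
Local Notation ev1 := (ev1 iota).
Local Notation ev2 := (ev2 iota).

Lemma size_L : size L = q.+1.
Proof. by rewrite (size_additive (as_pchar hA) (as_lead hA)). Qed.

Lemma size_L_gt1 : (1 < size L)%N.
Proof. by rewrite size_L; have := as_gt2 hA; lia. Qed.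

Lemma L_lam i : L.[lam i] = 0.
Proof. exact: additive_root_lam (as_lead hA) (as_prod hA) i. Qed.

Lemma L_root a : L.[a] = 0 -> exists i, a = lam i.
Proof.
by move=> La; apply/(additive_rootP (as_lead hA) (as_prod hA)); apply/rootP.
Qed.

Lemma iota_pchar : p \in [pchar K].
Proof. exact: rmorph_pchar (as_pchar hA). Qed.

Lemma ev1_LE z :
  ev1 z L = (additive_poly p (fun i => iota (alpha i))).[z].
Proof. by rewrite ev1E map_additive_poly. Qed.

Lemma ev1_LD u v : ev1 (u + v) L = ev1 u L + ev1 v L.
Proof. by rewrite !ev1_LE (additive_hornerD _ iota_pchar). Qed.

Lemma ev1_L_root z : ev1 z L = 0 -> exists i, z = iota (lam i).
Proof.
rewrite ev1E (as_prod hA) linearZ_LR /= rmorph_prod /= hornerZ.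
move/eqP; rewrite mulf_eq0 fmorph_eq0 (negPf (as_lead hA)) /=.
rewrite horner_prod => /prodf_eq0 [i _].
rewrite rmorphB /= map_polyX map_polyC hornerXsubC subr_eq0 => /eqP ->.
by exists i.
Qed.

(** L(aY + b) = a L(Y) for such a and b, so the substitution multiplies the relation by a once c is
    replaced by a c. The case a = 1 gives the translations; general a serves to normalize an
    automorphism that exchanges the coordinates. *)
Lemma is_curve_affine c x y (a b : k) :
  is_curve iota L c x y -> a != 0 -> L.[b] = 0 ->
  (forall i, alpha i != 0 -> a ^+ (p ^ i) = a) ->
  is_curve iota L (a * c) x (iota a * y + iota b).
Proof.
move=> hC a0 Lb ha.
pose s : {poly k} := a *: 'X + b%:P.
pose s' : {poly k} := a^-1 *: 'X - (a^-1 * b)%:P.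
pose S := map_poly polyC s; pose S' := map_poly polyC s'.
have ss' : s \Po s' = 'X.
  rewrite /s /s' comp_polyD comp_polyC comp_polyZ comp_polyX scalerBr scalerA.
  by rewrite divff // scale1r -mul_polyC -polyCM mulrA divff // mul1r subrK.
have SS' : S \Po S' = 'X.
  by rewrite /S /S' -map_comp_poly ss' map_polyX.
have s's : s' \Po s = 'X.
  rewrite /s /s' comp_polyB comp_polyC comp_polyZ comp_polyX scalerDr scalerA.
  by rewrite mulVf // scale1r -mul_polyC -polyCM addrK.
have S'S : S' \Po S = 'X.
  by rewrite /S /S' -map_comp_poly s's map_polyX.
have evS : ev2 x y S = iota a * y + iota b.
  by rewrite /S ev2_map /s ev1D ev1Z ev1X ev1C.
have Ls : L \Po s = a *: L.
  rewrite additive_comp_affine ?(as_pchar hA) // Lb addr0 /additive_poly.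
  rewrite scaler_sumr; apply: eq_bigr => i _; rewrite scalerA.
  have [->|/ha ->] := eqVneq (alpha i) 0; first by rewrite mul0r mulr0.
  by rewrite mulrC.
have DS : curve_rel L (a * c) \Po S = a%:P%:P * curve_rel L c.
  rewrite /curve_rel comp_polyD comp_polyM !comp_polyC -map_comp_poly Ls.
  rewrite map_polyZ /= -mul_polyC !polyCM; ring.
split => [P|z].
  rewrite -evS -ev2_comp (proj1 hC); split => -[Q e].
    exists ((Q \Po S') * a^-1%:P%:P).
    have /(congr1 (comp_poly S')) := DS.
    rewrite -comp_polyA SS' comp_polyXr comp_polyM comp_polyC => ->.
    rewrite -[LHS]comp_polyXr -SS' comp_polyA e comp_polyM -!mulrA; congr (_ * _).
    by rewrite mulrA -!polyCM mulVf // mul1r.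
  by exists ((Q \Po S) * a%:P%:P); rewrite e comp_polyM DS mulrA.
have [P [Q [Q0 zE]]] := proj2 hC z.
exists (P \Po S'), (Q \Po S').
have back R : ev2 x (iota a * y + iota b) (R \Po S') = ev2 x y R.
  by rewrite -evS -ev2_comp -comp_polyA S'S comp_polyXr.
by rewrite !back.
Qed.

Definition y_translations x y (tau : 'I_q -> {rmorphism K -> K}) : Prop :=
  forall i, [/\ forall a, tau i (iota a) = iota a, tau i x = x,
                tau i y = y + iota (lam i) & bijective (tau i)].

Lemma y_translations_exist c x y : is_curve iota L c x y ->
  exists tau, y_translations x y tau.
Proof.
move=> hC; apply: (@fin_all_exists _ _ (fun i (f : {rmorphism K -> K}) =>
  [/\ forall a, f (iota a) = iota a, f x = x, f y = y + iota (lam i) & bijective f])).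
move=> i; have h1 : forall i, alpha i != 0 -> 1 ^+ (p ^ i) = 1 :> k.
  by move=> *; rewrite expr1n.
have := is_curve_affine hC (oner_neq0 _) (L_lam i) h1.
rewrite mul1r rmorph1 mul1r => hC'.
have [f [g [fc gc fg gf [fx fy]]]] := is_curve_iso hC hC'.
by exists f; split => //; exists g.
Qed.

Section FixedField.
Variables (c : k) (x y : K) (tau : 'I_q -> {rmorphism K -> K}).
Hypotheses (hC : is_curve iota L c x y) (hT : y_translations x y tau).

Let tc i a : tau i (iota a) = iota a. Proof. by case: (hT i). Qed.
Let tx i : tau i x = x. Proof. by case: (hT i). Qed.
Let ty i : tau i y = y + iota (lam i). Proof. by case: (hT i). Qed.

Lemma tau_ev1 i f : tau i (ev1 x f) = ev1 x f.
Proof. by rewrite rmorph_ev1 ?tx. Qed.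

Lemma lam_add : exists s : 'I_q -> 'I_q -> 'I_q,
  forall j, injective (s j) /\ forall i, lam (s j i) = lam j + lam i.
Proof.
apply: (@fin_all_exists _ _ (fun j (s : 'I_q -> 'I_q) =>
  injective s /\ forall i, lam (s i) = lam j + lam i)) => j.
have [i|s hs] := @fin_all_exists _ _ (fun i j' => lam j' = lam j + lam i).
  have [|j' e] := @L_root (lam j + lam i); last by exists j'.
  by rewrite (additive_hornerD _ (as_pchar hA)) !L_lam addr0.
exists s; split => // i i' /(congr1 lam); rewrite !hs => /addrI; exact: as_inj hA _ _.
Qed.

Lemma lam_zero : exists i, lam i = 0.
Proof.
by have [|i ->] := @L_root 0; [rewrite (additive_horner0 _ (as_pchar hA))|exists i].
Qed.

Lemma tau_add i j l z : lam l = lam j + lam i -> tau j (tau i z) = tau l z.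
Proof.
move=> e; have := is_curve_rmorph_eq (f := tau j \o tau i) (g := tau l) hC.
apply => //=; first by move=> a; rewrite !tc.
  by rewrite !tx.
by rewrite !ty rmorphD /= ty tc e rmorphD /= -addrA.
Qed.

Lemma tau_zero i z : lam i = 0 -> tau i z = z.
Proof.
move=> e; apply: (is_curve_rmorph_eq (f := tau i) (g := idfun) hC) => /= [a||].
- by rewrite tc.
- by rewrite tx.
by rewrite ty e rmorph0 addr0.
Qed.

Lemma tau_sum_fixed j z : tau j (\sum_i tau i z) = \sum_i tau i z.
Proof.
have [s /(_ j)[si sE]] := lam_add.
rewrite rmorph_sum /= [RHS](reindex_inj si) /=.
by apply: eq_bigr => i _; rewrite (@tau_add i j (s j i)).
Qed.

Lemma tau_prod_fixed j z : tau j (\prod_i tau i z) = \prod_i tau i z.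
Proof.
have [s /(_ j)[si sE]] := lam_add.
rewrite rmorph_prod /= [RHS](reindex_inj si) /=.
by apply: eq_bigr => i _; rewrite (@tau_add i j (s j i)).
Qed.

Lemma tau_ev2 i P : exists Q, tau i (ev2 x y P) = ev2 x y Q.
Proof.
exists (P \Po ('X + (lam i)%:P%:P)).
by rewrite rmorph_ev2 // tx ty ev2_comp ev2D ev2X ev2C ev1C.
Qed.

(** After reduction modulo the relation P has y-degree below q. As a polynomial over K in the outer
    variable it takes the same value at the q conjugates y + lam i, so it equals its constant
    coefficient. The denominator is the power of the leading coefficient introduced by
    pseudo-division. *)
Lemma fixed_ev2_ratio P : (forall i, tau i (ev2 x y P) = ev2 x y P) ->
  exists f g, ev1 x g != 0 /\ ev2 x y P = ev1 x f / ev1 x g.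
Proof.
move=> fixP; pose D := curve_rel L c; pose r := P %% D.
have sD : size D = q.+1 by rewrite (size_curve_rel _ size_L_gt1) size_L.
have D0 : D != 0 by rewrite -size_poly_gt0 sD.
pose l := lead_coef D ^+ scalp P D.
have rE : ev2 x y r = ev1 x l * ev2 x y P.
  have := Pdiv.Idomain.divp_eq P D; rewrite -/r -/l => /(congr1 (ev2 x y)).
  rewrite ev2Z ev2D ev2M => ->.
  have -> : ev2 x y D = 0 by apply/(proj1 hC); exists 1; rewrite mul1r.
  by rewrite mulr0 add0r.
have l0 : ev1 x l != 0.
  by rewrite (ev1_eq0 size_L_gt1 hC) expf_neq0 // lead_coef_eq0.
have sr : (size r <= q)%N by rewrite -ltnS -sD ltn_modp.
pose Q : {poly K} := map_poly (ev1 x) r - (ev2 x y r)%:P.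
have Q0 : Q = 0.
  apply: (@roots_geq_poly_eq0 _ _ [seq y + iota (lam i) | i : 'I_q]).
  - apply/allP => _ /mapP[i _ ->]; apply/rootP; rewrite hornerD hornerN hornerC.
    rewrite -ev2H -{1}(tx i) -ty -rmorph_ev2 // rE.
    by rewrite rmorphM /= tau_ev1 fixP subrr.
  - rewrite map_inj_uniq ?enum_uniq // => i j /addrI /fmorph_inj; exact: as_inj hA _ _.
  rewrite size_map -cardE card_ord (leq_trans (size_polyD _ _)) // geq_max.
  rewrite size_polyN (leq_trans (size_poly _ _)) //=.
  by rewrite (leq_trans (size_polyC_leq1 _)) // ltnW // ltnW // (as_gt2 hA).
exists r`_0, l; split => //.
have /(congr1 (fun f : {poly K} => f`_0)) := Q0.
rewrite coefB coefC coef0 coef_map /= => /eqP; rewrite subr_eq0 => /eqP ->.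
by rewrite rE mulrC mulKf.
Qed.

(** Multiplying numerator and denominator by the other conjugates of the denominator makes both of
    them fixed, and [fixed_ev2_ratio] applies to each. So the fixed field of the translations is
    k(x). *)
Lemma fixed_ratio z : (forall i, tau i z = z) ->
  exists f g, [/\ coprimep f g, ev1 x g != 0 & z = ev1 x f / ev1 x g].
Proof.
move=> fz; have [P [Q [Q0 zE]]] := proj2 hC z.
have [i0 li0] := lam_zero.
have [W WE] := fin_all_exists (fun i => tau_ev2 i Q).
have N0 : \prod_i tau i (ev2 x y Q) != 0.
  by apply/prodf_neq0 => i _; rewrite fmorph_eq0.
have NE : \prod_i tau i (ev2 x y Q) = ev2 x y (\prod_i W i).
  by rewrite ev2_prod; apply: eq_bigr => i _.
have [f1 [g1 [g10 e1]]] : exists f g, ev1 x g != 0 /\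
    \prod_i tau i (ev2 x y Q) = ev1 x f / ev1 x g.
  by rewrite NE; apply: fixed_ev2_ratio => i; rewrite -NE tau_prod_fixed.
have wE : z * \prod_i tau i (ev2 x y Q) = ev2 x y (P * \prod_(i | i != i0) W i).
  rewrite ev2M ev2_prod (bigD1 i0) //= tau_zero // zE mulrA divfK //.
  by congr (_ * _); apply: eq_bigr => i _.
have [f2 [g2 [g20 e2]]] : exists f g, ev1 x g != 0 /\
    z * \prod_i tau i (ev2 x y Q) = ev1 x f / ev1 x g.
  by rewrite wE; apply: fixed_ev2_ratio => i; rewrite -wE rmorphM /= fz tau_prod_fixed.
apply: (@ratio_coprime _ _ _ _ _ (f2 * g1) (g2 * f1)); last first.
  rewrite !ev1M -mulf_div -e2 -[_ / ev1 x f1]invf_div -e1 mulfK //.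
rewrite ev1M mulf_neq0 //; apply: contra N0 => /eqP f10.
by rewrite e1 f10 mul0r.
Qed.

(** The product of the conjugates of P(x, y), cleared of its denominator, is a polynomial in x.
    Having a multiple in one variable is what makes orders of vanishing finite later. *)
Lemma norm_exists P : ev2 x y P != 0 ->
  exists W f, f != 0 /\ ev2 x y P * ev2 x y W = ev1 x f.
Proof.
move=> P0; have [i0 li0] := lam_zero.
have [W WE] := fin_all_exists (fun i => tau_ev2 i P).
have N0 : \prod_i tau i (ev2 x y P) != 0.
  by apply/prodf_neq0 => i _; rewrite fmorph_eq0.
have [|f [g [fg g0 e]]] := @fixed_ratio (\prod_i tau i (ev2 x y P)).
  by move=> i; rewrite tau_prod_fixed.
exists (g%:P * \prod_(i | i != i0) W i), f; split.
  by apply: contra N0 => /eqP f0; rewrite e f0 ev1_0 mul0r.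
rewrite ev2M ev2_prod ev2C mulrCA.
have -> : ev2 x y P * \prod_(i | i != i0) ev2 x y (W i) = ev1 x f / ev1 x g.
  rewrite -e [RHS](bigD1 i0) //= tau_zero //; congr (_ * _).
  by apply: eq_bigr => i _.
by rewrite mulrC divfK.
Qed.

End FixedField.
End Translations.

(** * Derivations and regular elements *)

Section Derivations.
Variables (k K : fieldType) (iota : {rmorphism k -> K}).
Local Notation ev1 := (ev1 iota).
Local Notation ev2 := (ev2 iota).

(* [sigma]-derivations over [k]; ordinary derivations are the case [sigma = id]. *)
Record derivation (sigma : K -> K) (d : K -> K) : Prop := Derivation {
  derivationD : forall a b, d (a + b) = d a + d b;
  derivationM : forall a b, d (a * b) = d a * sigma b + sigma a * d b;
  derivationC : forall a, d (iota a) = 0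
}.

Section Twisted.
Variables (sigma : {rmorphism K -> K}) (d : K -> K).
Hypothesis sigmac : forall a, sigma (iota a) = iota a.
Hypothesis hd : derivation sigma d.

Lemma derivation0 : d 0 = 0.
Proof. by rewrite -{1}(rmorph0 iota) (derivationC hd). Qed.
Lemma derivation1 : d 1 = 0.
Proof. by rewrite -(rmorph1 iota) (derivationC hd). Qed.

Lemma derivation_ev1 z (f : {poly k}) : d (ev1 z f) = ev1 (sigma z) f^`() * d z.
Proof.
elim/poly_ind: f => [|f a IH].
  by rewrite deriv0 !ev1_0 mul0r derivation0.
rewrite derivMXaddC !ev1D !ev1M ev1X ev1C (derivationD hd) (derivationM hd).
rewrite (derivationC hd) IH ev1X rmorph_ev1 //; ring.
Qed.

Lemma derivationV a : d a^-1 = - d a / sigma a ^+ 2.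
Proof.
have [->|a0] := eqVneq a 0; first by rewrite invr0 derivation0 oppr0 mul0r.
have sa : sigma a != 0 by rewrite fmorph_eq0.
have := derivationM hd a a^-1; rewrite divff // derivation1 fmorphV => e.
have -> : d a^-1 = sigma a^-1 * (sigma a * d a^-1) by rewrite mulrA -rmorphM mulVf // rmorph1 mul1r.
have -> : sigma a * d a^-1 = - (d a / sigma a) by apply/eqP; rewrite -addr_eq0 addrC -e.
by rewrite fmorphV; field.
Qed.

Lemma derivation_div a b : b != 0 ->
  d (a / b) = (d a * sigma b - sigma a * d b) / sigma b ^+ 2.
Proof.
move=> b0; rewrite (derivationM hd) derivationV fmorphV.
have sb : sigma b != 0 by rewrite fmorph_eq0.
by field.
Qed.

End Twisted.

(** The relation is differentiated, L' being constant. A derivation is therefore determined by its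
    value at x, and derivations with the same twist are proportional. *)
Lemma derivation_curve_y (sigma : {rmorphism K -> K}) d (L : {poly k}) a0 c x y :
  (forall a, sigma (iota a) = iota a) -> derivation sigma d ->
  a0 != 0 -> L^`() = a0%:P -> c != 0 -> is_curve iota L c x y ->
  d y = - (sigma (ev1 y L) / sigma (ev1 x L)) * d x.
Proof.
move=> sc hd a00 La0 c0 hC; have e := is_curve_eq hC.
have Lx : ev1 x L != 0.
  apply: contraTneq c0 => Lx; move: e; rewrite Lx mul0r => /eqP.
  by rewrite eq_sym oppr_eq0 fmorph_eq0 => /eqP ->; rewrite eqxx.
have sLx : sigma (ev1 x L) != 0 by rewrite fmorph_eq0.
have := congr1 d e; rewrite (derivationM hd) -rmorphN (derivationC hd).
rewrite !(derivation_ev1 sc hd) La0 !ev1C => e'.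
have a0' : iota a0 != 0 by rewrite fmorph_eq0.
apply: (mulfI sLx); apply: (mulfI a0').
have -> : iota a0 * (sigma (ev1 x L) * d y) = sigma (ev1 x L) * (iota a0 * d y) by ring.
have -> : sigma (ev1 x L) * (iota a0 * d y) = - (iota a0 * d x * sigma (ev1 y L)).
  by apply/eqP; rewrite -addr_eq0 addrC e'.
by field.
Qed.

Lemma derivation_unique (sigma : {rmorphism K -> K}) d d' u (L : {poly k}) c x y :
  (forall a, sigma (iota a) = iota a) -> derivation sigma d -> derivation sigma d' ->
  is_curve iota L c x y -> d x = u * d' x -> d y = u * d' y ->
  forall z, d z = u * d' z.
Proof.
move=> sc hd hd' hC ex ey.
apply: (is_curve_ind hC (S := fun z => d z = u * d' z)) => // [a|a b ea eb|a b ea eb|a ea].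
- by rewrite (derivationC hd) (derivationC hd') mulr0.
- by rewrite (derivationD hd) (derivationD hd') ea eb mulrDr.
- by rewrite (derivationM hd) (derivationM hd') ea eb; ring.
by rewrite (derivationV hd) (derivationV hd') ea; ring.
Qed.

Section Existence.
Variables (L : {poly k}) (a0 c : k) (x y : K).
Hypotheses (La0 : L^`() = a0%:P) (hC : is_curve iota L c x y).

(** The partial derivative in the inner variable. The operator [d] below is L(x) d/dx - L(y) d/dy;
    it annihilates L(x) L(y) + c because L' is constant, and therefore descends to K. *)
Let dX (P : {poly {poly k}}) : {poly {poly k}} := swapXY (swapXY P)^`().
Let d (P : {poly {poly k}}) := L%:P * dX P - map_poly polyC L * P^`().

Let swB (P Q : {poly {poly k}}) : swapXY (P - Q) = swapXY P - swapXY Q.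
Proof. exact: swapXY_is_zmod_morphism. Qed.
Let sw0 : swapXY 0 = 0 :> {poly {poly k}}.
Proof. by rewrite -[X in swapXY X](subrr 0) swB subrr. Qed.
Let swD (P Q : {poly {poly k}}) : swapXY (P + Q) = swapXY P + swapXY Q.
Proof. by rewrite -[in LHS](opprK Q) swB -[- Q]sub0r swB sw0 sub0r opprK. Qed.
Let swM (P Q : {poly {poly k}}) : swapXY (P * Q) = swapXY P * swapXY Q.
Proof. exact: (swapXY_is_monoid_morphism _).2. Qed.

Let dB P Q : d (P - Q) = d P - d Q.
Proof. by rewrite /d /dX swB !derivB swB; ring. Qed.

Let dD P Q : d (P + Q) = d P + d Q.
Proof. by rewrite /d /dX swD !derivD swD; ring. Qed.

Let dM P Q : d (P * Q) = d P * Q + P * d Q.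
Proof. by rewrite /d /dX swM !derivM swD !swM !swapXYK; ring. Qed.

Let dcurve : d (curve_rel L c) = 0.
Proof.
rewrite /d /dX swapXY_curve_rel.
have -> : (curve_rel L c)^`() = a0%:P%:P * L%:P.
  rewrite /curve_rel derivD derivM !derivC mul0r add0r addr0 deriv_map La0 map_polyC /=.
  by rewrite mulrC.
by rewrite swM !swapXY_polyC map_polyC /=; ring.
Qed.

Let ed P := ev2 x y (d P).

Let edD P Q : ed (P + Q) = ed P + ed Q. Proof. by rewrite /ed dD ev2D. Qed.

Let edM P Q : ed (P * Q) = ed P * ev2 x y Q + ev2 x y P * ed Q.
Proof. by rewrite /ed dM ev2D !ev2M. Qed.

Let D2 P Q : K := (ed P * ev2 x y Q - ev2 x y P * ed Q) / ev2 x y Q ^+ 2.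

Let D2_eq P Q P1 Q1 : ev2 x y Q != 0 -> ev2 x y Q1 != 0 ->
  ev2 x y P / ev2 x y Q = ev2 x y P1 / ev2 x y Q1 -> D2 P Q = D2 P1 Q1.
Proof.
move=> q0 q10 /eqP; rewrite eqr_div // => /eqP e.
have [R eR] : exists R, P * Q1 - P1 * Q = R * curve_rel L c.
  by apply/(proj1 hC); rewrite ev2B !ev2M e subrr.
have := congr1 (fun P => ev2 x y (d P)) eR.
rewrite dB !dM dcurve mulr0 addr0 ev2B !ev2D !ev2M ev2_curve_rel (is_curve_eq hC).
rewrite addNr mulr0 => /eqP; rewrite subr_eq0 => /eqP e'.
rewrite /D2 /ed; apply/eqP; rewrite eqr_div ?expf_neq0 //; apply/eqP.
move: e e'; move: (ev2 x y P) (ev2 x y Q) (ev2 x y P1) (ev2 x y Q1).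
move: (ev2 x y (d P)) (ev2 x y (d Q)) (ev2 x y (d P1)) (ev2 x y (d Q1)).
move=> p' q' p1' q1' p q p1 q1 e e'.
have -> : (p' * q - p * q') * q1 ^+ 2 = q * q1 * (p' * q1 + p * q1') - q * q1' * (p * q1) - q' * q1 * (p * q1).
  by ring.
by rewrite e' e; ring.
Qed.

Let frac z : exists w : {poly {poly k}} * {poly {poly k}},
  (ev2 x y w.2 != 0) && (z == ev2 x y w.1 / ev2 x y w.2).
Proof.
by have [P [Q [Q0 ->]]] := proj2 hC z; exists (P, Q); rewrite Q0 eqxx.
Qed.

Let delta z := let w := xchoose (frac z) in D2 w.1 w.2.

Let deltaE P Q : ev2 x y Q != 0 -> delta (ev2 x y P / ev2 x y Q) = D2 P Q.
Proof.
move=> Q0; rewrite /delta; case/andP: (xchooseP (frac (ev2 x y P / ev2 x y Q))).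
by move=> Q10 /eqP e; apply: D2_eq.
Qed.

Let d_polyC f : d f%:P = L%:P * f^`()%:P.
Proof.
by rewrite /d /dX swapXY_polyC deriv_map swapXY_map_polyC derivC mulr0 subr0.
Qed.

Lemma derivation_exists :
  exists delta, [/\ derivation id delta, delta x = ev1 x L & delta y = - ev1 y L].
Proof.
have deltaP P : delta (ev2 x y P) = ev2 x y (d P).
  have -> : ev2 x y P = ev2 x y P / ev2 x y 1 by rewrite ev2_1 divr1.
  rewrite deltaE ?ev2_1 ?oner_eq0 // /D2 /ed ev2_1 mulr1 expr1n divr1.
  by rewrite -[1]/(1%:P) d_polyC derivC mulr0 ev2_0 mulr0 subr0.
exists delta; split; first split.
- move=> a b; have [P [Q [Q0 ->]]] := proj2 hC a; have [P1 [Q1 [Q10 ->]]] := proj2 hC b.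
  rewrite addf_div // -!ev2M -ev2D !deltaE //; last by rewrite ev2M mulf_neq0.
  rewrite /D2 edD !edM ev2D !ev2M; field.
  by rewrite Q0 Q10.
- move=> a b; have [P [Q [Q0 ->]]] := proj2 hC a; have [P1 [Q1 [Q10 ->]]] := proj2 hC b.
  rewrite mulf_div -!ev2M !deltaE //; last by rewrite ev2M mulf_neq0.
  rewrite /D2 !edM !ev2M /=; field.
  by rewrite Q0 Q10.
- move=> a; have := deltaP a%:P%:P; rewrite ev2C ev1C => ->.
  by rewrite d_polyC derivC mulr0 ev2_0.
- have := deltaP 'X%:P; rewrite ev2C ev1X => ->.
  by rewrite d_polyC derivX mulr1 ev2C.
have := deltaP 'X; rewrite ev2X => ->.
rewrite /d /dX swapXY_X derivC derivX mulr1.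
by rewrite sw0 mulr0 sub0r ev2N ev2_map.
Qed.

End Existence.
End Derivations.

(** * Valuation rings and regular differentials *)

Section ValuationRings.
Variables (k K : fieldType) (iota : {rmorphism k -> K}).
Local Notation ev1 := (ev1 iota).
Local Notation ev2 := (ev2 iota).

(** The places of K over k, as predicates; the trivial valuation ring, all of K, is included. *)
Record valuation_ring (O : K -> Prop) : Prop := ValuationRing {
  vrC : forall a, O (iota a);
  vrD : forall a b, O a -> O b -> O (a + b);
  vrM : forall a b, O a -> O b -> O (a * b);
  vrV : forall a, O a \/ O a^-1
}.

Section Basics.
Variable O : K -> Prop.
Hypothesis hO : valuation_ring O.

Lemma vr0 : O 0. Proof. by rewrite -(rmorph0 iota); apply: vrC hO _. Qed.
Lemma vr1 : O 1. Proof. by rewrite -(rmorph1 iota); apply: vrC hO _. Qed.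
Lemma vrN a : O a -> O (- a).
Proof.
by move=> Oa; rewrite -mulN1r -(rmorph1 iota) -rmorphN; apply: (vrM hO) => //; apply: vrC hO _.
Qed.
Lemma vrX a n : O a -> O (a ^+ n).
Proof.
by move=> Oa; elim: n => [|n IH]; rewrite ?expr0 ?exprS; [exact: vr1|exact: (vrM hO)].
Qed.
Lemma vr_ev1 z f : O z -> O (ev1 z f).
Proof. by move=> Oz; apply: (ev1_ind (S := O)) => //; case: hO. Qed.

Lemma vr_sum n (F : 'I_n -> K) : (forall i, O (F i)) -> O (\sum_i F i).
Proof. by move=> OF; elim/big_ind: _ => //; [exact: vr0|exact: vrD hO]. Qed.

(** At a pole of z the leading term dominates: f(z) / z^n is the leading coefficient plus a multiple
    of 1/z, which lies in the maximal ideal. *)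
Lemma vr_pole (z : K) (f : {poly k}) n : ~ O z -> size f = n.+1 ->
  exists eps, [/\ ev1 z f = z ^+ n * eps, O eps, O eps^-1 & eps != 0].
Proof.
move=> Oz sf; have Ov : O z^-1 by case: (vrV hO z).
have z0 : z != 0 by apply/eqP => z0; apply: Oz; rewrite z0; apply: vr0.
have fn0 : f`_n != 0.
  by have := lead_coef_eq0 f; rewrite lead_coefE sf /= => ->; rewrite -size_poly_eq0 sf.
pose r := \sum_(i < n) iota f`_i * z^-1 ^+ (n - i).-1.
have Or : O r.
  by apply: vr_sum => i; apply: (vrM hO); [apply: vrC hO _|apply: vrX].
pose eps := iota f`_n + z^-1 * r.
have Oe : O eps by apply: (vrD hO); [apply: vrC hO _|apply: (vrM hO)].
have fE : ev1 z f = z ^+ n * eps.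
  rewrite ev1E (@horner_coef_wide _ n.+1) -?sf ?size_poly // sf.
  rewrite big_ord_recr /= coef_map mulrDr [LHS]addrC mulrC; congr (_ + _).
  rewrite /r !mulr_sumr; apply: eq_bigr => i _; rewrite coef_map /=.
  have -> : z ^+ i = z ^+ n * (z^-1 * z^-1 ^+ (n - i).-1).
    rewrite -exprS prednK ?subn_gt0 // exprVn.
    by rewrite -[X in z ^+ X / _](subnKC (ltnW (ltn_ord i))) exprD mulfK ?expf_neq0.
  ring.
have fnK (a b : K) : a * b = iota f`_n -> a * (b / iota f`_n) = 1.
  by move=> ab; rewrite mulrA ab divff // fmorph_eq0.
have eps0 : eps != 0.
  apply/eqP => e0; apply: Oz.
  have e1 : z^-1 * (- r) = iota f`_n.
    by apply/eqP; rewrite mulrN eq_sym -subr_eq0 opprK; apply/eqP.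
  have := fnK _ _ e1 => /(congr1 (fun t => z * t)); rewrite mulr1 mulVKf // => <-.
  by apply: (vrM hO); [apply: vrN|rewrite -fmorphV; apply: vrC hO _].
exists eps; split => //.
case: (vrV hO (eps * z)) => [Oq|Oq]; last first.
  (* here [eps] divides [z^-1] *)
  have e1 : eps * (1 - (eps * z)^-1 * r) = iota f`_n.
    have <- : eps - z^-1 * r = iota f`_n by rewrite /eps addrK.
    by field; rewrite z0 eps0.
  have := fnK _ _ e1 => /(congr1 (fun t => eps^-1 * t)); rewrite mulr1 mulKf // => <-.
  apply: (vrM hO); last by rewrite -fmorphV; apply: vrC hO _.
  by apply: (vrD hO); [exact: vr1|apply: vrN; apply: (vrM hO)].
case: Oz; have e1 : z^-1 * (eps * z - r) = iota f`_n.
  by rewrite mulrBr mulrCA mulVf // mulr1 /eps addrK.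
have := fnK _ _ e1 => /(congr1 (fun t => z * t)); rewrite mulr1 mulVKf // => <-.
apply: (vrM hO); last by rewrite -fmorphV; apply: vrC hO _.
by apply: (vrD hO) => //; apply: vrN.
Qed.

End Basics.

Lemma valuation_ring_preim (sigma : {rmorphism K -> K}) O :
  (forall a, sigma (iota a) = iota a) -> valuation_ring O ->
  valuation_ring (fun z => O (sigma z)).
Proof.
move=> sc hO; split => [a|a b Oa Ob|a b Oa Ob|a].
- by rewrite sc; apply: vrC hO _.
- by rewrite rmorphD; apply: vrD hO _ _ Oa Ob.
- by rewrite rmorphM; apply: vrM hO _ _ Oa Ob.
by rewrite fmorphV; apply: vrV hO _.
Qed.

(* If [delta] generates the derivations of [K] and [omega] is the dual
   differential, [h] is regular when [h * omega] is regular at every place. *)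
Definition regular (delta : K -> K) (h : K) : Prop :=
  forall O, valuation_ring O -> exists a b, [/\ O a, O b & h = a * delta b].

Section Regular.
Variable delta : K -> K.
Hypothesis hdelta : derivation iota id delta.

(** Two terms of the form a delta(b) combine into one because, of delta b and delta b', one is a
    multiple of the other by an element of the valuation ring. *)
Lemma regularD h h' : regular delta h -> regular delta h' -> regular delta (h + h').
Proof.
move=> rh rh' O hO; have [a [b [Oa Ob ->]]] := rh O hO.
have [a' [b' [Oa' Ob' ->]]] := rh' O hO.
have [db0|db0] := eqVneq (delta b) 0; first by exists a', b'; rewrite db0 mulr0 add0r.
have [db0'|db0'] := eqVneq (delta b') 0; first by exists a, b; rewrite db0' mulr0 addr0.
case: (vrV hO (delta b / delta b')); rewrite ?invf_div => Or.
  exists (a * (delta b / delta b') + a'), b'; split => //.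
    by apply: (vrD hO) => //; apply: (vrM hO).
  by rewrite mulrDl -mulrA divfK.
exists (a + a' * (delta b' / delta b)), b; split => //.
  by apply: (vrD hO) => //; apply: (vrM hO).
by rewrite mulrDl -[a' * _ * _]mulrA divfK.
Qed.

Lemma regular0 : regular delta 0.
Proof.
by move=> O hO; exists 0, 0; split; rewrite ?mul0r //; apply: vr0 hO.
Qed.

Lemma regular_sum n (F : 'I_n -> K) :
  (forall i, regular delta (F i)) -> regular delta (\sum_i F i).
Proof. by move=> OF; elim/big_ind: _ => //; [exact: regular0|exact: regularD]. Qed.

(** Transport of a regular differential by sigma: the valuation ring is pulled back along sigma, and
    u corrects the failure of sigma to commute with delta. *)
Lemma regular_twist (sigma : {rmorphism K -> K}) u h :
  (forall a, sigma (iota a) = iota a) -> u != 0 ->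
  (forall z, sigma (delta z) = u * delta (sigma z)) ->
  regular delta h -> regular delta (sigma h / u).
Proof.
move=> sc u0 su rh O hO.
have [a [b [Oa Ob ->]]] := rh _ (valuation_ring_preim sc hO).
exists (sigma a), (sigma b); split => //.
by rewrite rmorphM su; field.
Qed.

End Regular.

Section Monomials.
Variables (p m : nat) (alpha : 'I_m.+1 -> k) (lam : 'I_(p ^ m) -> k).
Hypothesis hA : additive_setup alpha lam.
Local Notation L := (additive_poly p alpha).
Local Notation q := (p ^ m)%N.
Variables (c : k) (x y : K) (delta : K -> K).
Hypotheses (c0 : c != 0) (hC : is_curve iota L c x y).
Hypothesis hdelta : derivation iota id delta.

Let hd : derivation iota (idfun : {rmorphism K -> K}) delta := hdelta.

(** At a pole of z the relation keeps w finite, and delta (1/z) = - s L(z) / z^2 is z^(q-2) times a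
    unit, which absorbs z^i for i <= q - 2. The constant s is 1 for z = x and - 1 for z = y. *)
Lemma regular_monomial_pole (s : k) z w i j O : valuation_ring O ->
  s != 0 -> delta z = iota s * ev1 z L -> ev1 z L * ev1 w L = - iota c ->
  (i + 2 <= q)%N -> ~ O z ->
  exists a b, [/\ O a, O b & z ^+ i * w ^+ j = a * delta b].
Proof.
move=> hO s0 dz e iq Oz; have Ov : O z^-1 by case: (vrV hO z).
have [eps [ze Oe Oe' eps0]] := vr_pole hO Oz (size_L hA).
have z0 : z != 0 by apply/eqP => z0; apply: Oz; rewrite z0; apply: vr0 hO.
have s0' : iota s != 0 by rewrite fmorph_eq0.
have Ow : O w.
  case: (classic (O w)) => // Ow.
  have Ow' : O w^-1 by case: (vrV hO w).
  have [eps1 [we Oe1 Oe1' eps10]] := vr_pole hO Ow (size_L hA).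
  case: Oz; have w0 : w != 0 by apply/eqP => w0; apply: Ow; rewrite w0; apply: vr0 hO.
  have q0 : (0 < q)%N by have := as_gt2 hA; lia.
  have -> : z = - iota c * eps^-1 * eps1^-1 * z^-1 ^+ q.-1 * w^-1 ^+ q.
    have zq : z ^+ q = z * z ^+ q.-1 by rewrite -exprS prednK.
    rewrite -e ze we zq !exprVn; field.
    by rewrite eps0 eps10 !expf_neq0.
  rewrite -rmorphN; have Oc := vrC hO (- c); have OM := vrM hO.
  exact: OM (OM _ _ (OM _ _ (OM _ _ Oc Oe') Oe1') (vrX hO _ Ov)) (vrX hO _ Ow').
exists (- (iota s)^-1 * z^-1 ^+ (q - 2 - i) * w ^+ j * eps^-1), z^-1; split => //.
  apply: (vrM hO) => //; apply: (vrM hO); last exact: vrX.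
  apply: (vrM hO); last exact: vrX.
  by rewrite -fmorphV -rmorphN; apply: vrC hO _.
rewrite (derivationV hd) dz ze /=.
have -> : z ^+ q = z ^+ (q - 2 - i) * z ^+ i * z ^+ 2.
  by rewrite -!exprD; congr (_ ^+ _); move: iq; lia.
rewrite exprVn; field.
by rewrite z0 s0' eps0 expf_neq0.
Qed.

Hypotheses (dx : delta x = ev1 x L) (dy : delta y = - ev1 y L).

(** Where x and y are both finite, L(x) L(y) = - c makes delta x = L(x) a unit, so b = x serves; all
    other places are poles of x or of y. *)
Lemma regular_monomial i j : (i + 2 <= q)%N -> (j + 2 <= q)%N ->
  regular delta (x ^+ i * y ^+ j).
Proof.
move=> iq jq O hO; have e := is_curve_eq hC.
case: (classic (O x)) => Ox; last first.
  apply: (regular_monomial_pole (s := 1) _ hO) => //; first by rewrite oner_eq0.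
  by rewrite rmorph1 mul1r.
case: (classic (O y)) => Oy; last first.
  rewrite mulrC; apply: (regular_monomial_pole (s := -1) _ hO) => //.
  - by rewrite oppr_eq0 oner_eq0.
  - by rewrite rmorphN rmorph1 mulN1r.
  by rewrite mulrC.
have Lx0 : ev1 x L != 0.
  apply: contraTneq c0 => Lx; move: e; rewrite Lx mul0r => /eqP.
  by rewrite eq_sym oppr_eq0 fmorph_eq0 => /eqP ->; rewrite eqxx.
have c0' : iota c != 0 by rewrite fmorph_eq0.
exists (x ^+ i * y ^+ j * - (ev1 y L / iota c)), x; split => //.
  apply: (vrM hO); first by apply: (vrM hO); apply: vrX.
  apply: vrN => //; apply: (vrM hO); first exact: vr_ev1.
  by rewrite -fmorphV; apply: vrC hO _.
rewrite dx -[LHS]mulr1 -[RHS]mulrA; congr (_ * _).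
by rewrite mulNr mulrAC [ev1 y L * _]mulrC e mulNr opprK divff.
Qed.

End Monomials.
End ValuationRings.

(** * Points of the curve *)

Section Places.
Variables (k K : fieldType) (iota : {rmorphism k -> K}).
Local Notation ev1 := (ev1 iota).
Local Notation ev2 := (ev2 iota).

Definition pt (a b : k) (P : {poly {poly k}}) : k := P.[b%:P].[a].

Lemma ptD a b P Q : pt a b (P + Q) = pt a b P + pt a b Q.
Proof. by rewrite /pt !hornerD. Qed.
Lemma ptN a b P : pt a b (- P) = - pt a b P.
Proof. by rewrite /pt !hornerN. Qed.
Lemma ptM a b P Q : pt a b (P * Q) = pt a b P * pt a b Q.
Proof. by rewrite /pt !hornerM. Qed.
Lemma ptC a b f : pt a b f%:P = f.[a].
Proof. by rewrite /pt hornerC. Qed.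
Lemma ptX a b : pt a b 'X = b.
Proof. by rewrite /pt hornerX hornerC. Qed.
Lemma pt_map a b f : pt a b (map_poly polyC f) = f.[b].
Proof. by rewrite /pt horner_map hornerC. Qed.

Definition local_ring (xi eta : K) (a b : k) (z : K) : Prop :=
  exists P Q, pt a b Q != 0 /\ z = ev2 xi eta P / ev2 xi eta Q.

(* [(a, b)] is a smooth point of the curve with coordinate functions
   [xi, eta], and [eta - b] is a local parameter there. *)
Record smooth_point (xi eta : K) (a b : k) : Prop := SmoothPoint {
  sp_gen : forall z, exists P Q, ev2 xi eta Q != 0 /\ z = ev2 xi eta P / ev2 xi eta Q;
  sp_ker : forall P, ev2 xi eta P = 0 -> pt a b P = 0;
  sp_tan : exists P Q, pt a b Q != 0 /\
    (xi - iota a) * ev2 xi eta Q = (eta - iota b) * ev2 xi eta P;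
  sp_norm : forall P, ev2 xi eta P != 0 ->
    exists W f, f != 0 /\ ev2 xi eta P * ev2 xi eta W = ev1 eta f;
  sp_ne : eta != iota b
}.

Section AtPoint.
Variables (xi eta : K) (a b : k).
Hypothesis hp : smooth_point xi eta a b.
Local Notation R := (local_ring xi eta a b).
Local Notation pi := (eta - iota b).

Let pi0 : pi != 0. Proof. by rewrite subr_eq0 (sp_ne hp). Qed.

Lemma pt_ev_neq0 P : pt a b P != 0 -> ev2 xi eta P != 0.
Proof. by apply: contra => /eqP/(sp_ker hp) ->. Qed.

Lemma local_ev P : R (ev2 xi eta P).
Proof.
by exists P, 1; rewrite ev2_1 divr1; split => //; rewrite -[1]/(1%:P) ptC hornerE oner_neq0.
Qed.

Lemma localC u : R (iota u).
Proof. by have := local_ev u%:P%:P; rewrite ev2C ev1C. Qed.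

Lemma local_ev1 f : R (ev1 xi f).
Proof. by rewrite -(ev2C iota xi eta); apply: local_ev. Qed.

Lemma local_ev1' f : R (ev1 eta f).
Proof. by rewrite -(ev2_map iota xi eta); apply: local_ev. Qed.

Lemma local_inv P : pt a b P != 0 -> R (ev2 xi eta P)^-1.
Proof. by move=> P0; exists 1, P; rewrite ev2_1 mul1r. Qed.

Lemma localM u v : R u -> R v -> R (u * v).
Proof.
move=> [P [Q [Q0 ->]]] [P1 [Q1 [Q10 ->]]]; exists (P * P1), (Q * Q1).
by rewrite ptM mulf_neq0 // mulf_div !ev2M.
Qed.

Lemma localD u v : R u -> R v -> R (u + v).
Proof.
move=> [P [Q [Q0 ->]]] [P1 [Q1 [Q10 ->]]]; exists (P * Q1 + P1 * Q), (Q * Q1).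
by rewrite ptM mulf_neq0 // addf_div ?pt_ev_neq0 // ev2D !ev2M.
Qed.

Lemma localN u : R u -> R (- u).
Proof.
move=> Ru; rewrite -mulN1r -(rmorph1 iota) -rmorphN.
by apply: localM => //; apply: localC.
Qed.

(** P(xi, eta) is a combination of eta - b and xi - a, and by [sp_tan] the latter is a multiple of
    the former in the local ring. *)
Lemma local_vanish P : pt a b P = 0 -> exists r, R r /\ ev2 xi eta P = pi * r.
Proof.
move=> P0; have [P1 [Q1 [Q10 tan]]] := sp_tan hp.
have [S eS] : exists S, P = S * ('X - b%:P%:P) + P.[b%:P]%:P.
  have /factor_theorem[S eS] : root (P - P.[b%:P]%:P) b%:P.
    by rewrite /root hornerD hornerN hornerC subrr.
  by exists S; rewrite -eS subrK.
have [f ef] : exists f, P.[b%:P] = f * ('X - a%:P).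
  by apply/factor_theorem; rewrite /root; apply/eqP.
exists (ev2 xi eta S + ev1 xi f * (ev2 xi eta P1 / ev2 xi eta Q1)); split.
  apply: localD; first exact: local_ev.
  apply: localM; first exact: local_ev1.
  by exists P1, Q1.
have Q0 := pt_ev_neq0 Q10.
have tan' : xi - iota a = pi * ev2 xi eta P1 / ev2 xi eta Q1 by rewrite -tan mulfK.
rewrite {1}eS ef ev2D ev2M ev2B ev2X !ev2C ev1M ev1B ev1X !ev1C tan'.
by field.
Qed.

Lemma local_residue z : R z -> exists u r, R r /\ z = iota u + pi * r.
Proof.
move=> [P [Q [Q0 ->]]]; pose u := pt a b P / pt a b Q.
have [|r [Rr e]] := @local_vanish (P - u%:P%:P * Q).
  by rewrite ptD ptN ptM ptC hornerC /u divfK // subrr.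
exists u, (r / ev2 xi eta Q); split; first by apply: localM => //; apply: local_inv.
have Q0' := pt_ev_neq0 Q0.
rewrite mulrA -e ev2B ev2M ev2C ev1C; field.
exact: Q0'.
Qed.

Lemma local_ev1_residue f : exists r, R r /\ ev1 xi f = iota f.[a] + pi * r.
Proof.
have [|r [Rr e]] := @local_vanish (f - (f.[a])%:P)%:P.
  by rewrite ptC hornerD hornerN hornerC subrr.
by exists r; split => //; rewrite -e ev2C ev1B ev1C addrC subrK.
Qed.

Lemma local_unit u r : u != 0 -> R r -> R (iota u + pi * r)^-1.
Proof.
move=> u0 [P [Q [Q0 ->]]].
exists Q, (u%:P%:P * Q + ('X - b%:P%:P) * P); split.
  rewrite ptD !ptM ptD ptN ptX !ptC !hornerC subrr mul0r addr0.
  exact: mulf_neq0.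
rewrite ev2D !ev2M ev2B ev2X !ev2C !ev1C mulrA.
have Q0' := pt_ev_neq0 Q0.
rewrite -{1}(mulfK Q0' (iota u)) -mulrDl invf_div //.
Qed.

Lemma local_param_inv : ~ R pi^-1.
Proof.
move=> [P [Q [Q0 e]]].
have Q0' := pt_ev_neq0 Q0.
have : pt a b (Q - ('X - b%:P%:P) * P) = 0.
  apply: (sp_ker hp); rewrite ev2B ev2M ev2B ev2X ev2C ev1C.
  have -> : ev2 xi eta P = pi^-1 * ev2 xi eta Q by rewrite e divfK.
  by rewrite mulVKf // subrr.
rewrite ptD ptN ptM ptD ptN ptX ptC hornerC subrr mul0r oppr0 addr0 => e0.
by rewrite e0 eqxx in Q0.
Qed.

Lemma local_residue0 u r : R r -> iota u = pi * r -> u = 0.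
Proof.
move=> Rr e; apply/eqP/negPn/negP => u0; apply: local_param_inv.
have -> : pi^-1 = r / iota u.
  by rewrite e invfM mulrCA mulfV ?mulr1 //; apply: contra u0 => /eqP r0; rewrite -(fmorph_eq0 iota) e r0 mulr0.
by rewrite -fmorphV; apply: localM => //; apply: localC.
Qed.

(** The multiplicity of b as a root of the polynomial f from [sp_norm] bounds the number of
    divisions by the parameter: each division removes one factor from f. *)
Lemma local_order P : ev2 xi eta P != 0 -> exists n P1 Q1,
  [/\ pt a b P1 != 0, pt a b Q1 != 0 &
      ev2 xi eta P = pi ^+ n * ev2 xi eta P1 / ev2 xi eta Q1].
Proof.
move=> P0; have [W [f [f0 e]]] := sp_norm hp P0.
have [n [g gb fE]] := multiplicity_XsubC f b; rewrite f0 /= in gb.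
have {}e : ev2 xi eta P * ev2 xi eta W = pi ^+ n * ev2 xi eta (map_poly polyC g).
  by rewrite e fE ev1M ev1Xn ev1B ev1X ev1C ev2_map mulrC.
have: pt a b (map_poly polyC g) != 0 by rewrite pt_map; apply: gb.
move: (map_poly polyC g) e P0 {fE} => N; elim: n P N => [|n IH] P N e P0 N0.
  have [Pz|Pz] := eqVneq (pt a b P) 0; last first.
    exists 0%N, P, 1; rewrite ev2_1 divr1 mul1r; split => //.
    by rewrite -[1]/(1%:P) ptC hornerE oner_neq0.
  have : pt a b (P * W - N) = 0.
    by apply: (sp_ker hp); rewrite ev2B ev2M e expr0 mul1r subrr.
  by rewrite ptD ptN ptM Pz mul0r sub0r => /eqP; rewrite oppr_eq0 (negPf N0).
have [Pz|Pz] := eqVneq (pt a b P) 0; last first.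
  exists 0%N, P, 1; rewrite ev2_1 divr1 mul1r; split => //.
  by rewrite -[1]/(1%:P) ptC hornerE oner_neq0.
have [r [[P1 [Q1 [Q10 rE]]] PE]] := local_vanish Pz.
have Q1' := pt_ev_neq0 Q10.
have P10 : ev2 xi eta P1 != 0.
  by apply: contra P0 => /eqP P10; rewrite PE rE P10 mul0r mulr0.
have e1 : ev2 xi eta P1 * ev2 xi eta W = pi ^+ n * ev2 xi eta (N * Q1).
  apply: (mulfI pi0); rewrite mulrA [RHS]mulrA -exprS ev2M [RHS]mulrA -e PE rE.
  by field.
have NQ0 : pt a b (N * Q1) != 0 by rewrite ptM mulf_neq0.
have [n' [P2 [Q2 [P20 Q20 e2]]]] := IH P1 (N * Q1) e1 P10 NQ0.
exists n'.+1, P2, (Q2 * Q1); split => //; first by rewrite ptM mulf_neq0.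
have Q2' := pt_ev_neq0 Q20.
rewrite PE rE e2 ev2M exprS; field.
by rewrite Q2' Q1'.
Qed.

Lemma local_valuation_ring : valuation_ring iota R.
Proof.
split; [exact: localC|exact: localD|exact: localM|] => z.
have [->|z0] := eqVneq z 0.
  by left; rewrite -(rmorph0 iota); apply: localC.
have [P [Q [Q0 zE]]] := sp_gen hp z.
have P0 : ev2 xi eta P != 0 by apply: contra z0 => /eqP P0; rewrite zE P0 mul0r.
have [n [P1 [Q1 [P10 Q10 e]]]] := local_order P0.
have [n' [P2 [Q2 [P20 Q20 e']]]] := local_order Q0.
have Rpi i : R (pi ^+ i).
  have -> : pi ^+ i = ev1 eta (('X - b%:P) ^+ i) by rewrite ev1Xn ev1B ev1X ev1C.
  exact: local_ev1'.
have [n0 n0'] := (pt_ev_neq0 P10, pt_ev_neq0 Q10).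
have [n1 n1'] := (pt_ev_neq0 P20, pt_ev_neq0 Q20).
case: (leqP n' n) => nn.
  left; have -> : z = pi ^+ (n - n') * (ev2 xi eta (P1 * Q2) / ev2 xi eta (Q1 * P2)).
    rewrite zE e e' -{1}(subnKC nn) exprD !ev2M; field.
    by rewrite n0' n1 n1' !expf_neq0.
  apply: localM => //; exists (P1 * Q2), (Q1 * P2); split => //.
  by rewrite ptM mulf_neq0.
right; have -> : z^-1 = pi ^+ (n' - n) * (ev2 xi eta (P2 * Q1) / ev2 xi eta (Q2 * P1)).
  rewrite zE e e' -{1}(subnKC (ltnW nn)) exprD !ev2M; field.
  by rewrite n0' n0 n1 n1' !expf_neq0.
apply: localM => //; exists (P2 * Q1), (Q2 * P1); split => //.
by rewrite ptM mulf_neq0.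
Qed.

(** By the Leibniz rule a factor rho common to the derivatives of both coordinates is common to the
    derivatives of all local functions. For regular functions rho then bounds the pole. *)
Lemma local_derivation delta rho r1 r2 : derivation iota id delta ->
  R r1 -> R r2 -> delta xi = rho * r1 -> delta eta = rho * r2 ->
  forall z, R z -> exists r, R r /\ delta z = rho * r.
Proof.
move=> hd R1 R2 e1 e2.
pose hd' : derivation iota (idfun : {rmorphism K -> K}) delta := hd.
have pol P : R (ev2 xi eta P) /\ exists r, R r /\ delta (ev2 xi eta P) = rho * r.
  apply: (ev2_ind (S := fun z => R z /\ exists r, R r /\ delta z = rho * r)).
  - move=> u; split; first exact: localC.
    exists 0; rewrite (derivationC hd) mulr0; split => //.
    by rewrite -(rmorph0 iota); apply: localC.
  - by split; [have := local_ev1 'X; rewrite ev1X|exists r1].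
  - by split; [have := local_ev1' 'X; rewrite ev1X|exists r2].
  - move=> u v [Ru [r [Rr er]]] [Rv [s [Rs es]]]; split; first exact: localD.
    by exists (r + s); rewrite (derivationD hd) er es mulrDr; split => //; apply: localD.
  move=> u v [Ru [r [Rr er]]] [Rv [s [Rs es]]]; split; first exact: localM.
  exists (r * v + u * s); split; first by apply: localD; apply: localM.
  by rewrite (derivationM hd) er es /=; ring.
move=> z [P [Q [Q0 ->]]]; have [RP [r [Rr er]]] := pol P; have [RQ [s [Rs es]]] := pol Q.
have Q0' := pt_ev_neq0 Q0; have RV := local_inv Q0.
exists ((r * ev2 xi eta Q - ev2 xi eta P * s) * (ev2 xi eta Q)^-1 * (ev2 xi eta Q)^-1); split.
  apply: localM => //; apply: localM => //; apply: localD; first exact: localM.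
  by apply: localN; apply: localM.
rewrite (derivation_div hd') // er es /=; field.
exact: Q0'.
Qed.

Lemma local_regular delta rho r1 r2 h : derivation iota id delta ->
  R r1 -> R r2 -> delta xi = rho * r1 -> delta eta = rho * r2 ->
  regular iota delta h -> exists r, R r /\ h = rho * r.
Proof.
move=> hd R1 R2 e1 e2 /(_ _ local_valuation_ring)[u [v [Ru Rv ->]]].
have [r [Rr ->]] := local_derivation hd R1 R2 e1 e2 Rv.
by exists (u * r); split; [exact: localM|rewrite mulrCA].
Qed.

End AtPoint.
End Places.

(** The reciprocal polynomial X^n P(1/X), used for the chart 1/y at infinity. *)
Definition rev_poly (R : nzRingType) (n : nat) (P : {poly R}) : {poly R} :=
  \poly_(i < n.+1) P`_(n - i).

Lemma rev_poly_horner (F : fieldType) n (P : {poly F}) z :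
  z != 0 -> (size P <= n.+1)%N -> (rev_poly n P).[z] = z ^+ n * P.[z^-1].
Proof.
move=> z0 sP; rewrite (horner_coef_wide _ sP) /rev_poly.
rewrite (@horner_coef_wide _ n.+1) ?size_poly // mulr_sumr.
rewrite (reindex_inj rev_ord_inj) /=; apply: eq_bigr => i _.
have iN : (i <= n)%N by rewrite -ltnS.
rewrite coef_poly subSS ltnS leq_subr subKn // mulrCA; congr (_ * _).
by rewrite exprVn -[X in z ^+ X / _](subnK iN) exprD mulfK ?expf_neq0.
Qed.

Lemma map_rev_poly (R S : nzRingType) (f : {additive R -> S}) n (P : {poly R}) :
  map_poly f (rev_poly n P) = rev_poly n (map_poly f P).
Proof.
apply/polyP => i; rewrite coef_map /rev_poly [X in f X]coef_poly [RHS]coef_poly.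
by case: ifP => _; rewrite ?raddf0 // coef_map.
Qed.

(** * Affine points and points at infinity of the curve *)

Section PointsOfTheCurve.
Variables (k : closedFieldType) (K : fieldType) (iota : {rmorphism k -> K}).
Variables (p m : nat) (alpha : 'I_m.+1 -> k) (lam : 'I_(p ^ m) -> k).
Hypothesis hA : additive_setup alpha lam.
Local Notation L := (additive_poly p alpha).
Local Notation q := (p ^ m)%N.
Local Notation ev1 := (ev1 iota).
Local Notation ev2 := (ev2 iota).

Lemma ev1_rev n (f : {poly k}) z : z != 0 -> (size f <= n.+1)%N ->
  ev1 z (rev_poly n f) = z ^+ n * ev1 z^-1 f.
Proof.
move=> z0 sf; rewrite !ev1E map_rev_poly rev_poly_horner //.
exact: leq_trans (size_poly _ _) _.
Qed.

Lemma ev2_rev n (P : {poly {poly k}}) x z : z != 0 -> (size P <= n.+1)%N ->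
  ev2 x z (rev_poly n P) = z ^+ n * ev2 x z^-1 P.
Proof.
move=> z0 sP; rewrite !ev2H map_rev_poly rev_poly_horner //.
exact: leq_trans (size_poly _ _) _.
Qed.

(** M is the difference quotient of L at a, whose value at a is the derivative L'(a). *)
Lemma L_difference a : exists M, M.[a] = alpha ord0 /\ L = M * ('X - a%:P) + L.[a]%:P.
Proof.
have /factor_theorem[M e] : root (L - L.[a]%:P) a.
  by rewrite /root hornerD hornerN hornerC subrr.
exists M; split; last by rewrite -e subrK.
have := congr1 (fun f => f^`().[a]) e.
rewrite derivB derivC subr0 (deriv_additive _ (as_pchar hA)) hornerC => ->.
by rewrite derivM derivXsubC mulr1 hornerD hornerM hornerXsubC subrr mulr0 add0r.
Qed.

Lemma L_onto (u : k) : exists b, L.[b] = u.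
Proof.
have sz : size (L - u%:P) = q.+1.
  rewrite size_polyDl ?(size_L hA) // size_polyN.
  by rewrite (leq_ltn_trans (size_polyC_leq1 _)) // ltnS ltnW // ltnW // (as_gt2 hA).
have /closed_rootP[b /rootP] : size (L - u%:P) != 1%N.
  by rewrite sz eqSS -lt0n ltnW // ltnW // (as_gt2 hA).
by rewrite hornerD hornerN hornerC => /eqP; rewrite subr_eq0 => /eqP e; exists b.
Qed.

Section Curve.
Variables (c : k) (x y : K).
Hypotheses (c0 : c != 0) (hC : is_curve iota L c x y).

Let hC' : is_curve iota L c y x := is_curve_swap hC.

Lemma curve_y_ne b : y != iota b.
Proof.
by rewrite -subr_eq0 -{1}(ev1X iota y) -(ev1C iota y) -ev1B (ev1_eq0 (size_L_gt1 hA) hC') polyXsubC_eq0.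
Qed.

Lemma curve_y_neq0 : y != 0.
Proof. by rewrite -(rmorph0 iota) curve_y_ne. Qed.

Lemma curve_x_neq0 : x != 0.
Proof.
by rewrite -(ev1X iota x) (ev1_eq0 (size_L_gt1 hA) hC) polyX_eq0.
Qed.

Lemma ev1_Lx_neq0 : ev1 x L != 0.
Proof.
by rewrite (ev1_eq0 (size_L_gt1 hA) hC) -size_poly_gt0 (size_L hA).
Qed.

Lemma norm_y P : ev2 x y P != 0 ->
  exists W f, f != 0 /\ ev2 x y P * ev2 x y W = ev1 y f.
Proof.
have [tau hT] := y_translations_exist hA hC'.
rewrite -ev2_swap => /(norm_exists hA hC' hT)[W [f [f0 e]]].
by exists (swapXY W), f; split => //; rewrite -e !ev2_swap.
Qed.

(** With difference quotients M and N of L at a and b, the relation minus its value at the point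
    reads (x - a) M(x) L(y) = - L(a) N(y) (y - b), and M(x) L(y) does not vanish at (a, b). *)
Lemma affine_smooth_point a b : L.[a] * L.[b] = - c -> smooth_point iota x y a b.
Proof.
move=> ab; have Lb : L.[b] != 0.
  apply: contraTneq c0 => Lb; move: ab; rewrite Lb mulr0 => /eqP.
  by rewrite eq_sym oppr_eq0 => /eqP ->; rewrite eqxx.
split; [exact: proj2 hC| | |exact: norm_y|exact: curve_y_ne].
  move=> P /(proj1 hC)[Q ->]; rewrite ptM /curve_rel ptD ptM pt_map !ptC hornerC ab.
  by rewrite addNr mulr0.
have [M [Ma eM]] := L_difference a; have [N [Nb eN]] := L_difference b.
exists (- L.[a]%:P%:P * map_poly polyC N), (M%:P * map_poly polyC L); split.
  by rewrite ptM pt_map ptC Ma mulf_neq0 // (as_low hA).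
have := is_curve_eq hC; rewrite !ev2M ev2N !ev2_map !ev2C ev1C.
have ex := congr1 (ev1 x) eM; have ey := congr1 (ev1 y) eN.
move: ex ey; rewrite ev1D ev1M ev1B ev1X !ev1C => ex; rewrite ev1D ev1M ev1B ev1X !ev1C => ey.
have -> : iota c = - (iota L.[a] * iota L.[b]) by rewrite -rmorphM ab rmorphN opprK.
move: ex ey; move: (ev1 x L) (ev1 y L) (ev1 x M) (ev1 y N) (iota L.[a]) (iota L.[b]).
move=> lx ly mx ny la lb ex ey e.
have -> : (x - iota a) * (mx * ly) = lx * ly - la * ly by rewrite ex; ring.
by rewrite e ey; ring.
Qed.

(** At the poles of y, L(x) = - c / L(y) vanishes, so x = lam i. In w = 1/y the relation becomes (x
    - lam i) M(x) R(w) = - c w^q, where R is the reciprocal polynomial of L and M(lam i) R(0) is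
    nonzero. *)
Lemma infinity_smooth_point i : smooth_point iota x y^-1 (lam i) 0.
Proof.
have y0 := curve_y_neq0; have w0 : y^-1 != 0 by rewrite invr_eq0.
pose S z := exists P Q, ev2 x y^-1 Q != 0 /\ z = ev2 x y^-1 P / ev2 x y^-1 Q.
have SP P : S (ev2 x y^-1 P).
  by exists P, 1; rewrite ev2_1 divr1 oner_eq0.
have sz (P : {poly {poly k}}) : exists n, (size P <= n.+1)%N by exists (size P).
split.
- apply: (is_curve_ind hC (S := S)).
  + by move=> a; have := SP a%:P%:P; rewrite ev2C ev1C.
  + by have := SP 'X%:P; rewrite ev2C ev1X.
  + by exists 1, 'X; rewrite ev2_1 ev2X w0 invrK mul1r.
  + move=> a b [P [Q [Q0 ->]]] [P1 [Q1 [Q10 ->]]]; exists (P * Q1 + P1 * Q), (Q * Q1).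
    by rewrite addf_div // ev2D !ev2M mulf_neq0.
  + move=> a b [P [Q [Q0 ->]]] [P1 [Q1 [Q10 ->]]]; exists (P * P1), (Q * Q1).
    by rewrite mulf_div !ev2M mulf_neq0.
  move=> a [P [Q [Q0 ->]]]; rewrite invf_div.
  have [P0|P0] := eqVneq (ev2 x y^-1 P) 0.
    by rewrite P0 invr0 mulr0; have := SP 0; rewrite ev2_0.
  by exists Q, P.
- move=> P eP; have [n sP] := sz P.
  have := ev2_rev x y0 sP; rewrite eP mulr0 => /(proj1 hC)[Q eQ].
  (* P(x, 0) is the coefficient of y^n in the reversed polynomial, a multiple of the relation. It is
     zero or the leading coefficient, and the latter is divisible by L(x), which vanishes at lam
     i. *)
  have P0 : P`_0 = (Q * curve_rel L c)`_n.
    by rewrite -eQ /rev_poly coef_poly ltnSn subnn.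
  rewrite /pt polyC0 horner_coef0 P0.
  have sR : (size (Q * curve_rel L c)%R <= n.+1)%N by rewrite -eQ size_poly.
  case: (ltngtP (size (Q * curve_rel L c)%R) n.+1) sR => // sR _.
    by rewrite nth_default ?horner0.
  rewrite -[n]/(n.+1.-1) -sR -lead_coefE lead_coefM.
  rewrite (lead_coef_curve_rel _ (size_L_gt1 hA)) !hornerM (L_lam hA).
  by rewrite mul0r mulr0.
- have [M [Ma eM]] := L_difference (lam i).
  rewrite (L_lam hA) addr0 in eM.
  have sL : (size L <= q.+1)%N by rewrite (size_L hA).
  exists (- (c%:P%:P * 'X^(q.-1))), (M%:P * map_poly polyC (rev_poly q L)); split.
    rewrite ptM pt_map ptC Ma mulf_neq0 ?(as_low hA) //.
    rewrite horner_coef0 /rev_poly coef_poly /= subn0.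
    by rewrite (coef_additive_pexp alpha (as_pchar hA) ord_max) (as_lead hA).
  have q0 : (0 < q)%N by have := as_gt2 hA; lia.
  rewrite ev2N !ev2M ev2_map !ev2C ev1C ev2Xn ev2X (ev1_rev w0 sL) invrK.
  have wq : y^-1 ^+ q = y^-1 * y^-1 ^+ q.-1 by rewrite -exprS prednK.
  have := is_curve_eq hC; have := congr1 (ev1 x) eM; rewrite ev1M ev1B ev1X ev1C => -> e.
  have -> : iota c = - (ev1 x M * (x - iota (lam i)) * ev1 y L) by rewrite e opprK.
  by rewrite rmorph0 subr0 wq; ring.
- move=> P P0; have [n sP] := sz P.
  have [|W [f [f0 e]]] := @norm_y (rev_poly n P).
    by rewrite ev2_rev // mulf_neq0 ?expf_neq0.
  have [n' sW] := sz W.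
  have sf : (size f <= (size f).+1)%N by [].
  exists ('X^(size f) * rev_poly n' W), ('X^(n + n') * rev_poly (size f) f).
  have eW : ev2 x y^-1 (rev_poly n' W) = y^-1 ^+ n' * ev2 x y W by rewrite ev2_rev // invrK.
  have ef : ev1 y^-1 (rev_poly (size f) f) = y^-1 ^+ (size f) * ev1 y f by rewrite ev1_rev // invrK.
  have E : ev2 x y^-1 P * ev2 x y^-1 ('X^(size f) * rev_poly n' W) =
      ev1 y^-1 ('X^(n + n') * rev_poly (size f) f).
    rewrite ev1M ev1Xn ev1X ef ev2M ev2Xn ev2X eW -e ev2_rev // exprD !exprVn.
    by field; rewrite !expf_neq0.
  split => //; apply/eqP => z0.
  have : ev1 y^-1 ('X^(n + n') * rev_poly (size f) f) != 0.
    by rewrite ev1M ev1Xn ev1X ef !mulf_neq0 ?expf_neq0 // (ev1_eq0 (size_L_gt1 hA) hC').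
  by rewrite z0 ev1_0 eqxx.
by rewrite rmorph0.
Qed.

Section RegularFunctions.
Variables (delta : K -> K) (s : k).
Hypothesis hd : derivation iota id delta.
Hypotheses (dx : delta x = iota s * ev1 x L) (dy : delta y = - iota s * ev1 y L).

Let q2 : (2 < q)%N := as_gt2 hA.

Lemma regular_affine a b h : L.[a] * L.[b] = - c ->
  regular iota delta h -> local_ring iota x y a b h.
Proof.
move=> ab rh; have sp := affine_smooth_point ab.
have R1 := local_ev1 iota x y a b (s *: L); have R2 := local_ev1' iota x y a b (- s *: L).
rewrite ev1Z in R1; rewrite ev1Z rmorphN in R2.
have e1 : delta x = 1 * (iota s * ev1 x L) by rewrite mul1r.
have e2 : delta y = 1 * (- iota s * ev1 y L) by rewrite mul1r.
by have [r [Rr ->]] := local_regular sp hd R1 R2 e1 e2 rh; rewrite mul1r.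
Qed.

(** In the coordinates x and 1/y both derivatives are multiples of rho = y^(q-2), since delta (1/y)
    = s L(y) / y^2. So a regular function has a pole of order at most q - 2. *)
Lemma regular_infinity i h : regular iota delta h ->
  exists r, local_ring iota x y^-1 (lam i) 0 r /\ h = y ^+ (q - 2) * r.
Proof.
move=> rh; have sp := infinity_smooth_point i.
have y0 := curve_y_neq0; have w0 : y^-1 != 0 by rewrite invr_eq0.
have sL : (size L <= q.+1)%N by rewrite (size_L hA).
apply: (@local_regular _ _ _ _ _ _ _ sp delta _
   (y^-1 ^+ (q - 2) * (iota s * ev1 x L)) (iota s * ev1 y^-1 (rev_poly q L))) => //.
- apply: localM => //.
    by have := local_ev1' iota x y^-1 (lam i) 0 ('X ^+ (q - 2)); rewrite ev1Xn ev1X.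
  by have := local_ev1 iota x y^-1 (lam i) 0 (s *: L); rewrite ev1Z.
- by have := local_ev1' iota x y^-1 (lam i) 0 (s *: rev_poly q L); rewrite ev1Z.
- by rewrite dx mulrA -exprMn mulfV // expr1n mul1r.
have hd' : derivation iota (idfun : {rmorphism K -> K}) delta := hd.
rewrite (derivationV hd') dy (ev1_rev w0 sL) invrK /=.
have -> : y^-1 ^+ q = y^-1 ^+ (q - 2) * y^-1 ^+ 2 by rewrite -exprD subnK // ltnW.
by rewrite !exprVn; field; rewrite y0 expf_neq0.
Qed.

End RegularFunctions.
End Curve.
End PointsOfTheCurve.

(** * Weighted points annihilating polynomials of small bidegree *)

Section Separation.
Variables (K : fieldType) (n : nat) (X Y w : 'I_n -> K).
Hypothesis n3 : (2 < n)%N.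
Hypothesis w0 : forall l, w l != 0.
Hypothesis XY : forall l l', X l = X l' -> Y l = Y l' -> l = l'.
Hypothesis orth : forall i j, (i + 2 <= n)%N -> (j + 2 <= n)%N ->
  \sum_l w l * (X l ^+ i * Y l ^+ j) = 0.

Let orth_poly (f g : {poly K}) : (size f < n)%N -> (size g < n)%N ->
  \sum_l w l * (f.[X l] * g.[Y l]) = 0.
Proof.
move=> sf sg.
rewrite (eq_bigr (fun l => \sum_(i < size f) \sum_(j < size g)
    f`_i * g`_j * (w l * (X l ^+ i * Y l ^+ j)))); last first.
  move=> l _; rewrite !horner_coef mulr_suml mulr_sumr; apply: eq_bigr => i _.
  rewrite !mulr_sumr; apply: eq_bigr => j _; ring.
rewrite exchange_big big1 // => i _; rewrite exchange_big big1 // => j _.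
rewrite -mulr_sumr orth ?mulr0 //.
  by rewrite addn2; apply: leq_ltn_trans sf; apply: ltn_ord.
by rewrite addn2; apply: leq_ltn_trans sg; apply: ltn_ord.
Qed.

(** The product of the equations x = X l for l in A and y = Y l for l in B vanishes at every point
    but l0, and its degree in each variable is at most n - 2. *)
Let separate l0 (A B : {set 'I_n}) : (#|A|.+1 < n)%N -> (#|B|.+1 < n)%N ->
  (forall l, l != l0 -> (l \in A) || (l \in B)) ->
  (forall l, l \in A -> X l != X l0) -> (forall l, l \in B -> Y l != Y l0) -> False.
Proof.
move=> cA cB AB Ax By.
pose f := \prod_(l in A) ('X - (X l)%:P); pose g := \prod_(l in B) ('X - (Y l)%:P).
have sz (Z : 'I_n -> K) (S : {set 'I_n}) : size (\prod_(l in S) ('X - (Z l)%:P)) = #|S|.+1.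
  rewrite size_prod; last by move=> l _; rewrite polyXsubC_eq0.
  under eq_bigr do rewrite size_XsubC.
  by rewrite sum_nat_const -[#|[pred i in S]|]/#|S|; lia.
have := @orth_poly f g; rewrite !sz => /(_ cA cB).
rewrite (bigD1 l0) //= big1 ?addr0 => [|l ll0]; last first.
  case/orP: (AB l ll0) => [lA|lB].
    by rewrite /f horner_prod (bigD1 l) //= hornerXsubC subrr !mul0r mulr0.
  suff -> : g.[Y l] = 0 by rewrite !mulr0.
  by rewrite /g horner_prod (bigD1 l) //= hornerXsubC subrr mul0r.
have fX : f.[X l0] != 0.
  rewrite /f horner_prod; apply/prodf_neq0 => l lA.
  by rewrite hornerXsubC subr_eq0 eq_sym Ax.
have gY : g.[Y l0] != 0.
  rewrite /g horner_prod; apply/prodf_neq0 => l lA.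
  by rewrite hornerXsubC subr_eq0 eq_sym By.
by apply/eqP; rewrite !mulf_neq0.
Qed.

(** Otherwise the points other than l0 lie on at most n - 2 vertical and at most n - 2 horizontal
    lines avoiding l0. If another point shares the abscissa of l0, the points of other abscissa go
    to A and the rest to B. If none does, a single point j of other ordinate goes to B, which needs
    1 <= n - 2. *)
Lemma separation l0 : (forall l, X l = X l0) \/ (forall l, Y l = Y l0).
Proof.
have [/forallP aX|] := boolP [forall l, X l == X l0]; first by left=> l; apply/eqP.
have [/forallP aY|] := boolP [forall l, Y l == Y l0]; first by right=> l; apply/eqP.
rewrite !negb_forall => /existsP[j Yj] /existsP[i Xi]; exfalso.
have card2 (A : {set 'I_n}) a b : a \notin A -> b \notin A -> a != b -> (#|A|.+1 < n)%N.
  move=> aA bA ab; have := max_card (mem (a |: (b |: A))).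
  by rewrite !cardsU1 card_ord !inE (negPf ab) aA bA.
have il0 : i != l0 by apply: contraNneq Xi => ->.
have jl0 : j != l0 by apply: contraNneq Yj => ->.
case: (boolP [exists l, (l != l0) && (X l == X l0)]) => [/existsP[h /andP[hl0 hX]]|].
  apply: (@separate l0 [set l | X l != X l0] [set l | (l != l0) && (X l == X l0)]).
  - by apply: (card2 _ h l0) => //; rewrite inE negbK.
  - by apply: (card2 _ i l0) => //; rewrite inE ?eqxx // (negPf Xi) andbF.
  - by move=> l ll0; rewrite !inE ll0 orNb.
  - by move=> l; rewrite inE.
  move=> l; rewrite inE => /andP[ll0 /eqP Xl]; apply: contra ll0 => /eqP Yl.
  by apply/eqP/XY.
rewrite negb_exists => /forallP aX.
apply: (@separate l0 [set l | (l != l0) && (l != j)] [set j]).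
- by apply: (card2 _ j l0) => //; rewrite inE eqxx ?andbF.
- by rewrite cards1.
- by move=> l ll0; rewrite !inE ll0 orNb.
- by move=> l; rewrite inE => /andP[ll0 _]; have := aX l; rewrite ll0.
by move=> l; rewrite inE => /eqP ->.
Qed.

End Separation.

(** * Regular functions in k(x) and traces *)

Section RegularTrace.
Variables (k : closedFieldType) (K : fieldType) (iota : {rmorphism k -> K}).
Variables (p m : nat) (alpha : 'I_m.+1 -> k) (lam : 'I_(p ^ m) -> k).
Hypothesis hA : additive_setup alpha lam.
Local Notation L := (additive_poly p alpha).
Local Notation q := (p ^ m)%N.
Local Notation ev1 := (ev1 iota).
Local Notation ev2 := (ev2 iota).
Let q2 : (2 < q)%N := as_gt2 hA.

Variables (c : k) (x y : K).
Hypotheses (c0 : c != 0) (hC : is_curve iota L c x y).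
Variables (delta : K -> K) (s : k).
Hypothesis hd : derivation iota id delta.
Hypotheses (dx : delta x = iota s * ev1 x L) (dy : delta y = - iota s * ev1 y L).

Let hC' : is_curve iota L c y x := is_curve_swap hC.
Let y0 : y != 0 := curve_y_neq0 hA hC.
Let x0 : x != 0 := curve_x_neq0 hA hC.

(** x - lam i vanishes to order q at this point at infinity, which exceeds the pole order q - 2
    allowed to regular functions. *)
Lemma x_sub_lam i : exists r, local_ring iota x y^-1 (lam i) 0 r /\
  x - iota (lam i) = y^-1 ^+ q * r.
Proof.
have w0 : y^-1 != 0 by rewrite invr_eq0.
have sp := infinity_smooth_point hA c0 hC i.
have [M [Ma eM]] := L_difference hA (lam i).
rewrite (L_lam hA) addr0 in eM.
have sL : (size L <= q.+1)%N by rewrite (size_L hA).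
pose Q : {poly {poly k}} := M%:P * map_poly polyC (rev_poly q L).
have Q0 : pt (lam i) 0 Q != 0.
  rewrite ptM pt_map ptC Ma mulf_neq0 ?(as_low hA) //.
  rewrite horner_coef0 /rev_poly coef_poly /= subn0.
  by rewrite (coef_additive_pexp alpha (as_pchar hA) ord_max) (as_lead hA).
exists (iota (- c) * (ev2 x y^-1 Q)^-1); split.
  by apply: localM; [exact: localC|exact: local_inv].
have Q0' := pt_ev_neq0 sp Q0.
apply: (mulIf Q0'); rewrite mulrA divfK //.
rewrite ev2M ev2_map ev2C (ev1_rev _ w0 sL) invrK rmorphN.
have := is_curve_eq hC; have := congr1 (ev1 x) eM; rewrite ev1M ev1B ev1X ev1C => -> <-.
by ring.
Qed.

(** A root a of g lies under a point of the curve: an affine one if L(a) is nonzero, where T is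
    finite; one at infinity otherwise, where T has a pole of order at most q - 2 but g vanishes to
    order at least q. Either way f(a) = 0, against coprimality. At a pole of x, the same bound on T
    bounds the degree. *)
Lemma regular_ratio T f g : regular iota delta T -> coprimep f g -> ev1 x g != 0 ->
  T = ev1 x f / ev1 x g -> exists f1 : {poly k}, (size f1 < q)%N /\ T = ev1 x f1.
Proof.
move=> rT fg g0 TE; have fE : ev1 x f = T * ev1 x g by rewrite TE divfK.
have noroot a : g.[a] != 0.
  apply/negP => /eqP ga; suff fa : f.[a] = 0.
    by have := coprimep_root fg (introT rootP fa); rewrite ga eqxx.
  have [La|La] := eqVneq L.[a] 0.
    have [i ai] := L_root hA La; rewrite {}ai in ga *.
    have sp := infinity_smooth_point hA c0 hC i.
    have [r [Rr hr]] := regular_infinity hA c0 hC hd dx dy i rT.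
    have [r1 [Rr1 e1]] := local_ev1_residue sp f.
    have [g1 eg] : exists g1, g = g1 * ('X - (lam i)%:P) by apply/factor_theorem/rootP.
    have [r2 [Rr2 e2]] := x_sub_lam i.
    have wR : local_ring iota x y^-1 (lam i) 0 y^-1.
      by have := local_ev1' iota x y^-1 (lam i) 0 'X; rewrite ev1X.
    apply: (local_residue0 sp (r := y^-1 * (r * (ev1 x g1 * r2)) - r1)).
      apply: (localD sp); last exact: localN.
      apply: localM => //; apply: localM => //; apply: localM => //; exact: local_ev1.
    apply: (addIr ((y^-1 - iota 0) * r1)); rewrite -e1 fE hr eg ev1M ev1B ev1X ev1C e2.
    have -> : y^-1 ^+ q = y^-1 ^+ (q - 2) * (y^-1 * y^-1) by rewrite -expr2 -exprD subnK // ltnW.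
    rewrite rmorph0 subr0 !exprVn; field.
    by rewrite y0 expf_neq0.
  have [b Lb] := L_onto hA (- c / L.[a]).
  have ab : L.[a] * L.[b] = - c by rewrite Lb mulrCA divff // mulr1.
  have sp := affine_smooth_point hA c0 hC ab.
  have RT := regular_affine hA c0 hC hd dx dy ab rT.
  have [r1 [Rr1 e1]] := local_ev1_residue sp f.
  have [r2 [Rr2 e2]] := local_ev1_residue sp g.
  apply: (local_residue0 sp (r := T * r2 - r1)).
    by apply: (localD sp); [exact: localM|exact: localN].
  apply: (addIr ((y - iota b) * r1)); rewrite -e1 fE e2 ga rmorph0; ring.
have sg : size g = 1%N.
  by apply/eqP/negPn/negP => /closed_rootP[a /rootP ga]; have := noroot a; rewrite ga eqxx.
have {sg} gE : g = (g`_0)%:P by apply: size1_polyC; rewrite sg.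
have g00 : g`_0 != 0 by have := noroot 0; rewrite horner_coef0.
have T1 : T = ev1 x ((g`_0)^-1 *: f) by rewrite TE gE ev1Z ev1C fmorphV coefC mulrC.
exists ((g`_0)^-1 *: f); split => //; move: (_ *: f) T1 => f1 T1.
have [i _] := lam_zero hA.
have sp := infinity_smooth_point hA c0 hC' i.
have hR := local_valuation_ring sp.
have dx' : delta y = iota (- s) * ev1 y L by rewrite rmorphN.
have dy' : delta x = - iota (- s) * ev1 x L by rewrite rmorphN opprK.
have [r [Rr hr]] := regular_infinity hA c0 hC' hd dx' dy' i rT.
have notx : ~ local_ring iota y x^-1 (lam i) 0 x.
  by have := local_param_inv sp; rewrite rmorph0 subr0 invrK.
have Rv : local_ring iota y x^-1 (lam i) 0 x^-1 by case: (vrV hR x).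
rewrite ltnNge; apply/negP => sf; case: notx.
have [n sn] : exists n, size f1 = n.+1.
  by exists (size f1).-1; rewrite prednK //; apply: leq_trans sf; lia.
have notx : ~ local_ring iota y x^-1 (lam i) 0 x.
  by have := local_param_inv sp; rewrite rmorph0 subr0 invrK.
have [eps [e Re Re' eps0]] := vr_pole hR notx sn.
have nq : (q <= n.+1)%N by rewrite -sn.
have xE : r * eps^-1 * x^-1 ^+ (n.+1 - q) = x.
  have xn : x ^+ n = x ^+ (q - 2) * x * x ^+ (n.+1 - q).
    by rewrite -exprSr -exprD; congr (_ ^+ _); move: q2 nq; lia.
  have : x ^+ (q - 2) * r = x ^+ (q - 2) * x * x ^+ (n.+1 - q) * eps.
    by rewrite -hr T1 e xn.
  rewrite -!mulrA => /(mulfI (expf_neq0 _ x0)) ->.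
  by rewrite exprVn; field; rewrite eps0 expf_neq0.
by rewrite -[X in local_ring _ _ _ _ _ X]xE; apply: (vrM hR); [exact: (vrM hR)|exact: (vrX hR)].
Qed.

Variable tau : 'I_q -> {rmorphism K -> K}.
Hypothesis hT : y_translations iota lam x y tau.
Let tc i a : tau i (iota a) = iota a. Proof. by case: (hT i). Qed.
Let tx i : tau i x = x. Proof. by case: (hT i). Qed.
Let ty i : tau i y = y + iota (lam i). Proof. by case: (hT i). Qed.

(** Both sides are derivations twisted by [tau i], and they agree on x and y because L(y + lam i) =
    L(y). *)
Lemma tau_delta i z : tau i (delta z) = delta (tau i z).
Proof.
rewrite -[RHS]mul1r.
have d1 : derivation iota (tau i) (fun z => tau i (delta z)).
  split => [a b|a b|a]; first by rewrite (derivationD hd) rmorphD.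
    by rewrite (derivationM hd) rmorphD !rmorphM.
  by rewrite (derivationC hd) rmorph0.
have d2 : derivation iota (tau i) (fun z => delta (tau i z)).
  split => [a b|a b|a]; first by rewrite rmorphD (derivationD hd).
    by rewrite rmorphM (derivationM hd).
  by rewrite tc (derivationC hd).
apply: (derivation_unique (tc i) d1 d2 hC); rewrite mul1r /=.
  by rewrite dx tx rmorphM tc rmorph_ev1 // tx dx.
rewrite dy ty (derivationD hd) (derivationC hd) addr0 dy rmorphM rmorphN tc.
rewrite rmorph_ev1 // ty (ev1_LD _ hA); congr (_ * _).
by rewrite ev1_iota (L_lam hA) rmorph0 addr0.
Qed.

(** The translations fix every point where y is infinite: with w = 1/y, 1/(y + lam j) = w / (1 + lam
    j w). *)
Lemma tau_local i j z : local_ring iota x y^-1 (lam i) 0 z ->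
  local_ring iota x y^-1 (lam i) 0 (tau j z).
Proof.
have sp := infinity_smooth_point hA c0 hC i.
have hR := local_valuation_ring sp.
have wR : local_ring iota x y^-1 (lam i) 0 y^-1.
  by have := local_ev1' iota x y^-1 (lam i) 0 'X; rewrite ev1X.
have U u r : u != 0 -> local_ring iota x y^-1 (lam i) 0 r ->
    local_ring iota x y^-1 (lam i) 0 (iota u + y^-1 * r)^-1.
  by move=> u0 Rr; have := local_unit sp u0 Rr; rewrite rmorph0 subr0.
have yl : y + iota (lam j) != 0.
  by rewrite -(opprK (iota _)) subr_eq0 -rmorphN (curve_y_ne hA hC).
have [t [Rt te]] : exists t, local_ring iota x y^-1 (lam i) 0 t /\ tau j y^-1 = y^-1 * t.
  exists (iota 1 + y^-1 * iota (lam j))^-1; split.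
    by apply: U; [exact: oner_neq0|exact: localC].
  rewrite fmorphV ty -invfM; congr (_^-1).
  by rewrite rmorph1 mulrDr mulr1 mulVKf.
have Rw : local_ring iota x y^-1 (lam i) 0 (tau j y^-1) by rewrite te; apply: localM.
have pol P : local_ring iota x y^-1 (lam i) 0 (ev2 x (tau j y^-1) P).
  apply: (ev2_ind (S := local_ring iota x y^-1 (lam i) 0)) => //.
  - exact: localC.
  - by have := local_ev1 iota x y^-1 (lam i) 0 'X; rewrite ev1X.
  - exact: (localD sp).
  exact: localM.
move=> [P [Q [Q0 ->]]]; rewrite fmorph_div !rmorph_ev2 // tx; apply: localM => //.
move: Q0; elim/poly_ind: Q => [|S f _]; first by rewrite /pt !horner0 eqxx.
rewrite ptD ptM ptX mulr0 add0r ptC => f0.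
rewrite ev2D ev2M ev2X ev2C te.
have [r [Rr ->]] := local_ev1_residue sp f.
rewrite rmorph0 subr0.
have -> : ev2 x (y^-1 * t) S * (y^-1 * t) + (iota f.[lam i] + y^-1 * r) =
   iota f.[lam i] + y^-1 * (ev2 x (tau j y^-1) S * t + r) by rewrite te; ring.
by apply: U => //; apply: (localD sp) => //; apply: localM.
Qed.

(* Expansion at a pole of [y]: the polar part is a polynomial in [y] and
   the power sums of the roots of [L] kill its trace. *)
Lemma trace_regular h : regular iota delta h -> \sum_i tau i h = 0.
Proof.
move=> rh; set T := \sum_i tau i h.
have rT : regular iota delta T.
  apply: regular_sum => // i; rewrite -[tau i h]divr1.
  apply: regular_twist => //; first by rewrite oner_eq0.
  by move=> z; rewrite mul1r tau_delta.
have [|f [g [fg g0 TE]]] := @fixed_ratio _ _ _ _ _ _ _ hA _ _ _ _ hC hT T.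
  by move=> j; apply: tau_sum_fixed hA _ _ _ _ hC hT _ _.
have [f1 [sf {}TE]] := regular_ratio rT fg g0 TE.
suff f0 : f1 = 0 by rewrite TE f0 ev1_0.
(* The trace is a polynomial f1 in x of degree at most q - 2; it is shown to vanish at the q points
   where y is infinite, that is, at x = lam i. *)
apply: (@roots_geq_poly_eq0 _ _ [seq lam i | i : 'I_q]).
- apply/allP => _ /mapP[i _ ->]; apply/rootP.
  have sp := infinity_smooth_point hA c0 hC i.
  have [r [Rr hr]] := regular_infinity hA c0 hC hd dx dy i rh.
  have exp n : exists (g1 : {poly k}) r1, [/\ (size g1 <= n.+1)%N, local_ring iota x y^-1 (lam i) 0 r1
      & y ^+ n * r = ev1 y g1 + y^-1 * r1].
    elim: n => [|n [g1 [r1 [sg Rr1 e]]]].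
      have [u [r1 [Rr1 e]]] := local_residue sp Rr.
      exists u%:P, r1; rewrite ev1C mul1r size_polyC_leq1; split => //.
      by rewrite e rmorph0 subr0.
    have [u [r2 [Rr2 e2]]] := local_residue sp Rr1.
    exists (g1 * 'X + u%:P), r2; split => //.
      rewrite (leq_trans (size_polyD _ _)) // geq_max (leq_trans (size_polyC_leq1 _)) // andbT.
      by rewrite (leq_trans (size_polyMleq _ _)) // size_polyX addn2.
    rewrite exprS -mulrA e ev1D ev1M ev1X ev1C -addrA.
    have -> : y^-1 * r1 = y^-1 * (iota u + y^-1 * r2) by rewrite e2 rmorph0 subr0.
    by field.
  have [g1 [r1 [sg Rr1 e]]] := exp (q - 2)%N.
  have wR : local_ring iota x y^-1 (lam i) 0 y^-1.
    by have := local_ev1' iota x y^-1 (lam i) 0 'X; rewrite ev1X.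
  have [r2 [Rr2 T2]] : exists r2, local_ring iota x y^-1 (lam i) 0 r2 /\ T = y^-1 * r2.
    exists (y * \sum_j tau j (y^-1 * r1)); split; last first.
      rewrite mulKf // /T hr e.
      under eq_bigr do rewrite rmorphD /=.
      rewrite big_split /= [X in X + _ = _](_ : _ = 0) ?add0r //.
      under eq_bigr do rewrite rmorph_ev1 // ty.
      (* As a function of lam j, the translate g1(y + lam j) of the polar part is a polynomial over
         K of degree at most q - 2. *)
      have sg1 : (size (map_poly iota g1 \Po ('X + y%:P)) < q)%N.
        rewrite size_comp_poly2 ?size_map_poly ?size_XaddC //.
        by apply: leq_ltn_trans sg _; move: q2; lia.
      rewrite -[RHS](additive_power_sum iota (as_pchar hA) (as_low hA) (as_lead hA) (as_inj hA) (as_prod hA) sg1).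
      apply: eq_bigr => j _; rewrite horner_comp ev1E hornerD hornerX hornerC.
      by rewrite addrC.
    rewrite mulr_sumr; apply: (vr_sum (local_valuation_ring sp)) => j.
    rewrite rmorphM mulrA; apply: localM; last exact: tau_local.
    have U r' : local_ring iota x y^-1 (lam i) 0 r' ->
        local_ring iota x y^-1 (lam i) 0 (iota 1 + y^-1 * r')^-1.
      by move=> Rr'; have := local_unit sp (oner_neq0 _) Rr'; rewrite rmorph0 subr0.
    have := U _ (localC iota x y^-1 (lam i) 0 (lam j)).
    rewrite fmorphV ty rmorph1.
    have yl : y + iota (lam j) != 0.
      by rewrite -(opprK (iota _)) subr_eq0 -rmorphN (curve_y_ne hA hC).
    by have -> : y / (y + iota (lam j)) = (1 + y^-1 * iota (lam j))^-1 by field; rewrite y0 yl.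
  have [r3 [Rr3 e3]] := local_ev1_residue sp f1.
  apply: (local_residue0 sp (r := r2 - r3)).
    by apply: (localD sp) => //; apply: localN.
  apply: (addIr ((y^-1 - iota 0) * r3)); rewrite -e3 -TE T2 rmorph0 subr0; ring.
- by rewrite map_inj_uniq ?enum_uniq //; apply: as_inj hA.
by rewrite size_map -cardE card_ord ltnW.
Qed.

End RegularTrace.

(** * Automorphisms *)

(** The degree count for F' L = kappa L(F): if deg F = n + 2 the right side has degree q (n + 2),
    the left side at most n + 1 + q. Here d is the size of F'. *)
Fact degree_aux q n d :
  (2 < q)%N -> (d < n.+3)%N -> (d + q).-1 = (q * n.+2)%N -> False.
Proof. by move=> q2 dn; rewrite !mulnS; have := leq_mul q2 (leqnn n); lia. Qed.

Record automorphism (k K : fieldType) (iota : {rmorphism k -> K})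
    (sigma sigma' : {rmorphism K -> K}) : Prop := Automorphism {
  autC : forall a, sigma (iota a) = iota a;
  autC' : forall a, sigma' (iota a) = iota a;
  autK : cancel sigma sigma';
  autK' : cancel sigma' sigma
}.

Section Automorphisms.
Variables (k : closedFieldType) (K : fieldType) (iota : {rmorphism k -> K}).
Variables (p m : nat) (alpha : 'I_m.+1 -> k) (lam : 'I_(p ^ m) -> k).
Hypothesis hA : additive_setup alpha lam.
Local Notation L := (additive_poly p alpha).
Local Notation q := (p ^ m)%N.
Local Notation ev1 := (ev1 iota).
Local Notation ev2 := (ev2 iota).
Let q2 : (2 < q)%N := as_gt2 hA.

(* Equivalently, [L (a X) = a L (X)]. *)
Definition scalar (a : k) : Prop := forall i, alpha i != 0 -> a ^+ (p ^ i) = a.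

Lemma ev1_L_affine a b z : scalar a -> L.[b] = 0 ->
  ev1 (iota a * z + iota b) L = iota a * ev1 z L.
Proof.
move=> sa Lb; rewrite (ev1_LD iota hA) ev1_iota Lb rmorph0 addr0 !(ev1_LE iota).
rewrite additive_hornerZ // => i; rewrite fmorph_eq0 => /sa e.
by rewrite -rmorphXn e.
Qed.

Section OneCurve.
Variables (c : k) (x y : K).
Hypotheses (c0 : c != 0) (hC : is_curve iota L c x y).
Variable delta : K -> K.
Hypothesis hd : derivation iota id delta.
Hypotheses (dx : delta x = ev1 x L) (dy : delta y = - ev1 y L).
Variable tau : 'I_q -> {rmorphism K -> K}.
Hypothesis hT : y_translations iota lam x y tau.
Let tc i a : tau i (iota a) = iota a. Proof. by case: (hT i). Qed.
Let tx i : tau i x = x. Proof. by case: (hT i). Qed.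
Let ty i : tau i y = y + iota (lam i). Proof. by case: (hT i). Qed.
Let dx1 : delta x = iota 1 * ev1 x L. Proof. by rewrite rmorph1 mul1r. Qed.
Let dy1 : delta y = - iota 1 * ev1 y L. Proof. by rewrite rmorph1 mulN1r. Qed.

(** sigma delta and delta sigma are both derivations twisted by sigma, hence proportional; the
    second is not zero, since sigma is onto and delta x = L(x) is nonzero. *)
Lemma derivation_twist sigma sigma' : automorphism iota sigma sigma' ->
  exists u : K, u != 0 /\ forall z, sigma (delta z) = u * delta (sigma z).
Proof.
move=> hs; have sc := autC hs.
have d1 : derivation iota sigma (fun z => sigma (delta z)).
  split => [a b|a b|a]; first by rewrite (derivationD hd) rmorphD.
    by rewrite (derivationM hd) rmorphD !rmorphM.
  by rewrite (derivationC hd) rmorph0.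
have d2 : derivation iota sigma (fun z => delta (sigma z)).
  split => [a b|a b|a]; first by rewrite rmorphD (derivationD hd).
    by rewrite rmorphM (derivationM hd).
  by rewrite sc (derivationC hd).
have La := deriv_additive alpha (as_pchar hA).
have y1 := derivation_curve_y sc d1 (as_low hA) La c0 hC.
have y2 := derivation_curve_y sc d2 (as_low hA) La c0 hC.
have Lx0 := ev1_Lx_neq0 hA hC.
have d20 : delta (sigma x) != 0.
  apply/eqP => e0; have := Lx0; rewrite -dx -(autK' hs x).
  have d0 : derivation iota sigma (fun=> 0).
    by split => *; rewrite ?addr0 // mul0r mulr0 addr0.
  have := @derivation_unique _ _ _ _ _ _ 0 _ _ _ _ sc d2 d0 hC.
  rewrite /= mulr0 y2 e0 mulr0 => /(_ erefl erefl) ->.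
  by rewrite eqxx.
exists (sigma (delta x) / delta (sigma x)); split.
  by rewrite mulf_neq0 ?invr_eq0 // fmorph_eq0 dx.
apply: (derivation_unique sc d1 d2 hC); rewrite /=; first by rewrite divfK.
by rewrite y1 y2; field; rewrite ?fmorph_eq0 ?d20 ?Lx0.
Qed.

Lemma image_fixed sigma sigma' : automorphism iota sigma sigma' ->
  (forall i, tau i (sigma x) = sigma x) \/ (forall i, tau i (sigma y) = sigma y).
Proof.
move=> hs; have [u [u0 su]] := derivation_twist hs.
have [i0 li0] := lam_zero hA.
have t0 z : tau i0 z = z := tau_zero hC hT z li0.
(* The points are the images of (x, y) under the conjugates of the translations. The weights come
   from [regular_twist], which turns a regular h into sigma h / u, whose trace vanishes. *)
pose X i := sigma' (tau i (sigma x)); pose Y i := sigma' (tau i (sigma y)).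
have := @separation K q X Y (fun i => sigma' (tau i u^-1)) q2 _ _ _ i0.
have X0 : X i0 = x by rewrite /X t0 (autK hs).
have Y0 : Y i0 = y by rewrite /Y t0 (autK hs).
rewrite X0 Y0; case => [i|i j||hX|hY].
- by rewrite !fmorph_eq0 invr_eq0.
- rewrite /X /Y => /fmorph_inj eX /fmorph_inj eY.
  have E z : tau i (sigma z) = tau j (sigma z).
    apply: (is_curve_rmorph_eq (f := tau i \o sigma) (g := tau j \o sigma) hC) => //= a.
    by rewrite (autC hs) !tc.
  have := E (sigma' y); rewrite (autK' hs) !ty => /addrI/fmorph_inj.
  exact: (as_inj hA).
- move=> i j iq jq; have rh := regular_monomial hA c0 hC hd dx dy iq jq.
  have := trace_regular hA c0 hC hd dx1 dy1 hT (regular_twist (autC hs) u0 su rh).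
  move/(congr1 sigma'); rewrite rmorph0 rmorph_sum /= => e; rewrite -[RHS]e.
  apply: eq_bigr => l _; rewrite /X /Y !rmorphM !rmorphXn /=.
  by rewrite mulrC.
- by left=> i; rewrite -[RHS](congr1 sigma (hX i)) /X (autK' hs).
by right=> i; rewrite -[RHS](congr1 sigma (hY i)) /Y (autK' hs).
Qed.

(** For w = f/g in lowest terms the equation reads (f' g - f g') L g^(q-2) = kappa g^q L(f/g). As q
    > 2, g divides the right side, to which it is coprime, so g is constant. Then F' L = kappa L(F)
    forces deg F = 1; the coefficient of X gives kappa = 1 and the others give the scalar condition
    on a. *)
Lemma affine_image w kappa : (forall i, tau i w = w) -> (forall a, w != iota a) ->
  kappa != 0 -> delta w = iota kappa * ev1 w L ->
  exists a b : k, [/\ a != 0, scalar a, L.[b] = 0 & w = iota a * x + iota b].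
Proof.
move=> tw wn k0 dw; have [f [g [fg g0 wE]]] := fixed_ratio hA hC hT tw.
pose hd' : derivation iota (idfun : {rmorphism K -> K}) delta := hd.
have dev h : delta (ev1 x h) = ev1 x h^`() * ev1 x L.
  by rewrite (derivation_ev1 _ hd') // dx.
have q0 : (0 < q)%N by rewrite ltnW // ltnW.
have numE f' g' : ev1 x g' != 0 ->
    ev1 (ev1 x f' / ev1 x g') L = ev1 x (additive_num p alpha f' g') / ev1 x g' ^+ q.
  move=> g0'; rewrite (ev1_LE iota) additive_hornerE [RHS]mulrC.
  apply: (mulfI (expf_neq0 q g0')); rewrite mulVKf ?expf_neq0 //.
  rewrite /additive_num ev1_sum mulr_sumr.
  apply: eq_bigr => i _ /=; rewrite ev1Z ev1M !ev1Xn expr_div_n.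
  rewrite -{1}(subnKC (leq_pexp (as_pchar hA) i)) exprD; field.
  exact: expf_neq0.
have [g1 eg] : exists g1, g = g1%:P.
  have ode : (f^`() * g - f * g^`()) * L * g ^+ (q - 2) = kappa *: additive_num p alpha f g.
    apply: (ev1_inj (size_L_gt1 hA) hC).
    have := dw; rewrite wE numE // (derivation_div hd') // !dev /=.
    rewrite ev1Z !ev1M ev1B !ev1M ev1Xn.
    have -> : ev1 x g ^+ q = ev1 x g ^+ (q - 2) * ev1 x g ^+ 2 by rewrite -exprD subnK // ltnW.
    move/(congr1 (fun t => t * (ev1 x g ^+ 2 * ev1 x g ^+ (q - 2)))) => e.
    transitivity (iota kappa *
      (ev1 x (additive_num p alpha f g) / (ev1 x g ^+ (q - 2) * ev1 x g ^+ 2)) *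
      (ev1 x g ^+ 2 * ev1 x g ^+ (q - 2))); last by field; rewrite ?expf_neq0 ?g0.
    by rewrite -e; field; rewrite ?g0.
  have gn : g %| additive_num p alpha f g.
    rewrite -(dvdpZr _ _ k0) -ode.
    have -> : (q - 2 = (q - 3).+1)%N by move: q2; lia.
    by rewrite exprSr mulrA dvdp_mull.
  have cg : coprimep g f by rewrite coprimep_sym.
  have := coprimep_additive_num (as_pchar hA) (as_lead hA) cg.
  rewrite coprimep_def (eqp_size (dvdp_gcd_idl gn)) => /eqP s1.
  by exists g`_0; apply: size1_polyC; rewrite s1.
have g10 : g1 != 0 by move: g0; rewrite eg ev1C fmorph_eq0.
pose F := g1^-1 *: f.
have wF : w = ev1 x F by rewrite wE eg /F ev1Z ev1C fmorphV mulrC.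
have ode : F^`() * L = kappa *: (L \Po F).
  apply: (ev1_inj (size_L_gt1 hA) hC).
  by rewrite ev1M ev1Z ev1_comp -wF -dw -dev -wF.
have sF : (1 < size F)%N.
  rewrite ltnNge; apply/negP => /size1_polyC eF.
  by have := wn F`_0; rewrite wF {1}eF ev1C eqxx.
have F2 : size F = 2%N.
  have F0 : F^`() * L != 0.
    rewrite ode scaler_eq0 (negPf k0) /= comp_poly_eq0 //.
    by rewrite -size_poly_gt0 (size_L hA).
  have F'0 : F^`() != 0 by apply: contra F0 => /eqP ->; rewrite mul0r.
  have L0 : L != 0 by apply: contra F0 => /eqP ->; rewrite mulr0.
  have := congr1 (fun h : {poly k} => (size h).-1) ode.
  rewrite size_mul // size_scale // size_comp_poly (size_L hA) /=.
  have F1 : F != 0 by rewrite -size_poly_gt0 ltnW.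
  have := lt_size_deriv F1; move: sF q2; rewrite /=.
  case: (size F) => [|[|[|n]]] // _ q2' lF; rewrite addnS /= => e.
  by case: (degree_aux q2' lF e).
have FE : F = F`_1 *: 'X + (F`_0)%:P.
  apply/polyP => -[|[|i]]; rewrite coefD coefZ coefX coefC /= ?mulr0 ?mulr1 ?add0r ?addr0 //.
  by rewrite nth_default // F2.
have a0 : F`_1 != 0.
  by have := lead_coef_eq0 F; rewrite lead_coefE F2 /= => ->; rewrite -size_poly_eq0 F2.
move: a0 FE; move: F`_1 F`_0 => a b a0 FE.
have {}ode : a *: L = kappa *: (additive_poly p (fun i => alpha i * a ^+ (p ^ i)) + L.[b]%:P).
  rewrite -(additive_comp_affine alpha a b (as_pchar hA)) -FE -ode FE.
  by rewrite derivD derivZ derivX derivC addr0 alg_polyC mul_polyC.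
have cf i : a * alpha i = kappa * (alpha i * a ^+ (p ^ i)).
  have := congr1 (fun h : {poly k} => h`_(p ^ i)) ode.
  rewrite !coefZ coefD coefC -[(p ^ i == 0)%N]/(p ^ i == 0)%N.
  rewrite (negPf (lt0n_neq0 (pexp_gt0 (as_pchar hA) i))) addr0.
  by rewrite !(coef_additive_pexp _ (as_pchar hA)).
have k1 : kappa = 1.
  have e := cf ord0; rewrite expn0 expr1 in e.
  by apply: (mulIf (mulf_neq0 (as_low hA) a0)); rewrite mul1r -e mulrC.
rewrite k1 in cf ode; exists a, b; split => //.
- move=> i ai; have := cf i; rewrite mul1r mulrC => /(mulfI ai) //.
- have := congr1 (fun h : {poly k} => h.[0]) ode.
  rewrite scale1r hornerZ hornerD hornerC (additive_horner0 _ (as_pchar hA)) mulr0.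
  by rewrite (additive_horner0 _ (as_pchar hA)) add0r.
by rewrite wF FE ev1D ev1Z ev1X ev1C.
Qed.

End OneCurve.

(** The q^2 products of a translation in y and one in x, conjugated by sigma, would all fix x; but
    an automorphism fixing x sends y to one of the q elements y + lam l. *)
Lemma fixed_by_both c x y (tau tau' : 'I_q -> {rmorphism K -> K}) sigma sigma' :
  is_curve iota L c x y -> y_translations iota lam x y tau ->
  y_translations iota lam y x tau' -> automorphism iota sigma sigma' ->
  c != 0 ->
  ~ ((forall i, tau i (sigma x) = sigma x) /\ (forall i, tau' i (sigma x) = sigma x)).
Proof.
move=> hC hT hT' hs c0 [h h'].
have tc i : forall a, tau i (iota a) = iota a by case: (hT i).
have tx i : tau i x = x by case: (hT i).
have ty i : tau i y = y + iota (lam i) by case: (hT i).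
have tc' i : forall a, tau' i (iota a) = iota a by case: (hT' i).
have tx' i : tau' i y = y by case: (hT' i).
have ty' i : tau' i x = x + iota (lam i) by case: (hT' i).
pose f (w : 'I_q * 'I_q) z := sigma' (tau w.1 (tau' w.2 (sigma z))).
have fx w : f w x = x by rewrite /f h' h (autK hs).
have fc w a : f w (iota a) = iota a by rewrite /f (autC hs) tc' tc (autC' hs).
have fy w : exists l, f w y = y + iota (lam l).
  have e := is_curve_eq hC.
  have : ev1 (f w x) L * ev1 (f w y) L = - iota c.
    have fm t : f w (ev1 t L) = ev1 (f w t) L.
      have sc := autC hs; have sc' := autC' hs; have c1 := tc w.1; have c2 := tc' w.2.
      by rewrite /f !rmorph_ev1.
    by rewrite -!fm /f -!rmorphM e !rmorphN /= (autC hs) tc' tc (autC' hs).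
  rewrite fx -e => /(mulfI (ev1_Lx_neq0 hA hC)) => e'.
  have [|l el] := @ev1_L_root _ _ iota _ _ _ _ hA (f w y - y).
    apply: (addIr (ev1 y L)); rewrite -(ev1_LD iota hA) subrK add0r.
    exact: e'.
  by exists l; rewrite -el addrC subrK.
have [l hl] := fin_all_exists fy.
have linj : injective l.
  move=> w w' e; have eqf : forall z, f w z = f w' z.
    have := is_curve_rmorph_eq (f := sigma' \o (tau w.1 \o (tau' w.2 \o sigma)))
      (g := sigma' \o (tau w'.1 \o (tau' w'.2 \o sigma))) hC; apply => /= [a||].
    - by rewrite -[LHS]/(f w (iota a)) -[RHS]/(f w' (iota a)) !fc.
    - by rewrite -[LHS]/(f w x) -[RHS]/(f w' x) !fx.
    by rewrite -[LHS]/(f w y) -[RHS]/(f w' y) !hl e.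
  have := eqf (sigma' x); have := eqf (sigma' y); rewrite /f (autK' hs) => /fmorph_inj.
  rewrite !tx' !ty => /addrI/fmorph_inj/(as_inj hA) e1.
  rewrite (autK' hs) => /fmorph_inj; rewrite !ty' !rmorphD !tx !tc.
  move=> /addrI/fmorph_inj/(as_inj hA) e2.
  by rewrite [w]surjective_pairing [w']surjective_pairing e1 e2.
have := leq_card l linj; rewrite card_prod card_ord; move: q2; nia.
Qed.

(** [image_fixed] is applied for both orders of the coordinates, with - delta for the second, and
    [fixed_by_both] leaves two compatible combinations, the direct and the exchanging one. The
    multipliers are inverse to each other because sigma preserves L(x) L(y) = - c. *)
Lemma automorphism_form c x y sigma sigma' : c != 0 -> is_curve iota L c x y ->
  automorphism iota sigma sigma' ->
  exists a b b' : k, [/\ a != 0, scalar a, L.[b] = 0, L.[b'] = 0 &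
    (sigma x = iota a * x + iota b /\ sigma y = iota a^-1 * y + iota b') \/
    (sigma x = iota a * y + iota b /\ sigma y = iota a^-1 * x + iota b')].
Proof.
move=> c0 hC hs; have hC' := is_curve_swap hC.
have [tau hT] := y_translations_exist hA hC; have [tau' hT'] := y_translations_exist hA hC'.
have [delta [hd dx dy]] := derivation_exists (deriv_additive alpha (as_pchar hA)) hC.
pose delta' z := - delta z.
have hd' : derivation iota id delta'.
  split => [a b|a b|a]; rewrite /delta'.
  - by rewrite (derivationD hd) opprD.
  - by rewrite (derivationM hd); ring.
  by rewrite (derivationC hd) oppr0.
have dx' : delta' y = ev1 y L by rewrite /delta' dy opprK.
have dy' : delta' x = - ev1 x L by rewrite /delta' dx.
have d1 := image_fixed c0 hC hd dx dy hT hs.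
have d2 := image_fixed c0 hC' hd' dx' dy' hT' hs.
have n1 := fixed_by_both hC hT hT' hs c0.
have n2 := fixed_by_both hC' hT' hT hs c0.
have [u [u0 su]] := derivation_twist c0 hC hd dx hs.
have nC z b : (forall a, z != iota a) -> sigma z != iota b.
  move=> zn; apply: contra (zn b) => /eqP e.
  by rewrite -(autK hs z) e (autC' hs).
have xn : forall a, x != iota a := curve_y_ne hA hC'.
have yn : forall a, y != iota a := curve_y_ne hA hC.
have q0 : (0 + 2 <= q)%N by rewrite ltnW.
(* 1/u is the transport by sigma of the regular function 1. *)
have r1 : regular iota delta u^-1.
  have := regular_monomial hA c0 hC hd dx dy q0 q0; rewrite !expr0 mulr1.
  by move/(regular_twist (autC hs) u0 su); rewrite rmorph1 mul1r.
have dx1 : delta x = iota 1 * ev1 x L by rewrite rmorph1 mul1r.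
have dy1 : delta y = - iota 1 * ev1 y L by rewrite rmorph1 mulN1r.
have dx1' : delta y = iota (-1) * ev1 y L by rewrite rmorphN rmorph1 mulN1r.
have dy1' : delta x = - iota (-1) * ev1 x L by rewrite rmorphN opprK rmorph1 mul1r.
have tdelta i z : tau i (delta z) = delta (tau i z) := tau_delta hA hC hd dx1 dy1 hT i z.
have tdelta' i z : tau' i (delta z) = delta (tau' i z) := tau_delta hA hC' hd dx1' dy1' hT' i z.
have Lz z : (forall a, z != iota a) -> ev1 z L != 0.
  move=> zn; apply/eqP => /(@ev1_L_root _ _ iota _ _ _ _ hA)[l e].
  by have := zn (lam l); rewrite e eqxx.
have ux : delta (sigma x) = u^-1 * ev1 (sigma x) L.
  by apply: (mulfI u0); rewrite -su dx (rmorph_ev1 _ _ (autC hs)) mulVKf.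
have uy : delta (sigma y) = - u^-1 * ev1 (sigma y) L.
  apply: (mulfI u0); rewrite -su dy rmorphN (rmorph_ev1 _ _ (autC hs)).
  by rewrite mulNr mulrN mulVKf.
(* [1 / u] is regular and lies in both [k(x)] and [k(y)] *)
have const w w' : (forall a, w != iota a) -> (forall a, w' != iota a) ->
    (forall i, tau i w = w) -> (forall i, tau' i w' = w') ->
    (exists s, s != 0 /\ delta w = iota s * u^-1 * ev1 w L) ->
    (exists s, s != 0 /\ delta w' = iota s * u^-1 * ev1 w' L) ->
    exists kappa, kappa != 0 /\ u^-1 = iota kappa.
  move=> wn wn' tw tw' [s [s0 es]] [s' [s0' es']].
  have s1 : iota s != 0 by rewrite fmorph_eq0.
  have s1' : iota s' != 0 by rewrite fmorph_eq0.
  have uw : u^-1 = delta w / (iota s * ev1 w L) by rewrite es; field; rewrite u0 s1 Lz.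
  have uw' : u^-1 = delta w' / (iota s' * ev1 w' L) by rewrite es'; field; rewrite u0 s1' Lz.
  have tu i : tau i u^-1 = u^-1.
    have tc : forall a, tau i (iota a) = iota a by case: (hT i).
    by rewrite uw fmorph_div rmorphM /= tdelta rmorph_ev1 // tc tw.
  have tu' i : tau' i u^-1 = u^-1.
    have tc : forall a, tau' i (iota a) = iota a by case: (hT' i).
    by rewrite uw' fmorph_div rmorphM /= tdelta' rmorph_ev1 // tc tw'.
  have [f [g [fg g0 e]]] := fixed_ratio hA hC hT tu.
  have [f' [g' [fg' g0' e']]] := fixed_ratio hA hC' hT' tu'.
  have [f1 [sf1 e1]] := regular_ratio hA c0 hC hd dx1 dy1 r1 fg g0 e.
  have [f2 [sf2 e2]] := regular_ratio hA c0 hC' hd dx1' dy1' r1 fg' g0' e'.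
  (* f2(y) = f1(x) is a relation of y-degree below q, so it is trivial and both sides are
     constant. *)
  have P0 : map_poly polyC f2 - f1%:P = 0.
    apply: (ev2_small_eq0 (size_L_gt1 hA) hC).
      rewrite (leq_ltn_trans (size_polyD _ _)) // size_polyN (size_L hA) ltnS.
      rewrite geq_max size_map_polyC (ltnW sf2) (leq_trans (size_polyC_leq1 _)) //.
      by rewrite ltnW // ltnW.
    by rewrite ev2B ev2_map ev2C -e1 -e2 subrr.
  have := congr1 (fun P : {poly {poly k}} => P`_0) P0.
  rewrite coefB coef_map coefC coef0 /= => /eqP; rewrite subr_eq0 => /eqP ef.
  have eu : u^-1 = iota f2`_0 by rewrite e1 -ef ev1C.
  by exists f2`_0; split => //; rewrite -(fmorph_eq0 iota) -eu invr_eq0.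
have E := is_curve_eq hC.
have E' : ev1 (sigma x) L * ev1 (sigma y) L = - iota c.
  by rewrite -!(rmorph_ev1 _ _ (autC hs)) -rmorphM E rmorphN (autC hs).
have c0' : iota c != 0 by rewrite fmorph_eq0.
have prod a a' : a != 0 -> iota a * iota a' * - iota c = - iota c -> a' = a^-1.
  move=> a0 e; apply: (fmorph_inj iota); apply: (mulfI (_ : iota a != 0)).
    by rewrite fmorph_eq0.
  rewrite fmorphV mulfV ?fmorph_eq0 //; apply: (mulIf (_ : - iota c != 0)).
    by rewrite oppr_eq0.
  by rewrite mul1r.
have sx : exists s, s != 0 /\ delta (sigma x) = iota s * u^-1 * ev1 (sigma x) L.
  by exists 1; rewrite oner_eq0 rmorph1 mul1r.
have sy : exists s, s != 0 /\ delta (sigma y) = iota s * u^-1 * ev1 (sigma y) L.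
  by exists (-1); rewrite oppr_eq0 oner_eq0 rmorphN rmorph1 mulN1r.
have xs a : sigma x != iota a := nC x a xn.
have ys a : sigma y != iota a := nC y a yn.
case: d1 => h1.
  case: d2 => h2; last by case: n1.
  have [kappa [k0 ek]] := const _ _ xs ys h1 h2 sx sy.
  have [a [b [a0 sa Lb ex]]] : exists a b : k, [/\ a != 0, scalar a, L.[b] = 0 &
      sigma x = iota a * x + iota b].
    by apply: (affine_image c0 hC hd dx hT h1 xs k0); rewrite ux ek.
  have [a' [b' [a0' sa' Lb' ey]]] : exists a b : k, [/\ a != 0, scalar a, L.[b] = 0 &
      sigma y = iota a * y + iota b].
    apply: (affine_image c0 hC' hd' dx' hT' h2 ys k0).
    by rewrite /delta' uy ek mulNr opprK.
  exists a, b, b'; split => //; left; split => //; rewrite ey; congr (iota _ * _ + _).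
  by apply: prod => //; rewrite -[in RHS]E' ex ey !ev1_L_affine // -E; ring.
case: d2 => h2; first by case: n2.
have [kappa [k0 ek]] := const _ _ ys xs h1 h2 sy sx.
have [a [b [a0 sa Lb ex]]] : exists a b : k, [/\ a != 0, scalar a, L.[b] = 0 &
    sigma x = iota a * y + iota b].
  apply: (affine_image c0 hC' hd' dx' hT' h2 xs (kappa := - kappa)); first by rewrite oppr_eq0.
  by rewrite /delta' ux ek rmorphN mulNr.
have [a' [b' [a0' sa' Lb' ey]]] : exists a b : k, [/\ a != 0, scalar a, L.[b] = 0 &
    sigma y = iota a * x + iota b].
  apply: (affine_image c0 hC hd dx hT h1 ys (kappa := - kappa)); first by rewrite oppr_eq0.
  by rewrite uy ek rmorphN.
exists a, b, b'; split => //; right; split => //; rewrite ey; congr (iota _ * _ + _).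
by apply: prod => //; rewrite -[in RHS]E' ex ey !ev1_L_affine // -E; ring.
Qed.

End Automorphisms.

(** * Subfields k(t) *)

Section RationalFunctions.
Variables (k : closedFieldType) (K : fieldType) (iota : {rmorphism k -> K}).
Local Notation ev1 := (ev1 iota).
Local Notation ev2 := (ev2 iota).

Definition in_kt (t z : K) : Prop :=
  exists P Q : {poly k}, ev1 t Q != 0 /\ z = ev1 t P / ev1 t Q.

Lemma in_kt_ev1 t P : in_kt t (ev1 t P).
Proof. by exists P, 1; rewrite ev1_1 oner_eq0 divr1. Qed.

Lemma in_ktC t a : in_kt t (iota a).
Proof. by have := in_kt_ev1 t a%:P; rewrite ev1C. Qed.

Lemma in_kt_id t : in_kt t t.
Proof. by have := in_kt_ev1 t 'X; rewrite ev1X. Qed.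

Lemma in_ktD t u v : in_kt t u -> in_kt t v -> in_kt t (u + v).
Proof.
move=> [P [Q [Q0 ->]]] [P1 [Q1 [Q10 ->]]]; exists (P * Q1 + P1 * Q), (Q * Q1).
by rewrite addf_div // ev1D !ev1M mulf_neq0.
Qed.

Lemma in_ktM t u v : in_kt t u -> in_kt t v -> in_kt t (u * v).
Proof.
move=> [P [Q [Q0 ->]]] [P1 [Q1 [Q10 ->]]]; exists (P * P1), (Q * Q1).
by rewrite mulf_div !ev1M mulf_neq0.
Qed.

Lemma in_ktV t u : in_kt t u -> in_kt t u^-1.
Proof.
move=> [P [Q [Q0 ->]]]; rewrite invf_div.
have [P0|P0] := eqVneq (ev1 t P) 0; last by exists Q, P.
by rewrite P0 invr0 mulr0 -(rmorph0 iota); apply: in_ktC.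
Qed.

Lemma in_kt_trans t t' z : in_kt t t' -> in_kt t' z -> in_kt t z.
Proof.
move=> h [P [Q [_ ->]]]; have pol f : in_kt t (ev1 t' f).
  apply: (ev1_ind (S := in_kt t)) => //.
  - exact: in_ktC.
  - exact: in_ktD.
  exact: in_ktM.
by apply: in_ktM; last apply: in_ktV.
Qed.

(** Over an algebraically closed k a relation for t splits into factors t - a, none of which
    vanishes. *)
Lemma ev1_eq0_nonconst t f : (forall a, t != iota a) -> ev1 t f = 0 -> f = 0.
Proof.
move=> tn; have [r ->] := closed_field_poly_normal f.
rewrite ev1Z ev1E rmorph_prod horner_prod => /eqP; rewrite mulf_eq0 fmorph_eq0.
case/orP => [/eqP ->|]; first by rewrite scale0r.
rewrite prodf_seq_eq0 => /hasP[a _] /=.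
by rewrite rmorphB /= map_polyX map_polyC hornerXsubC subr_eq0 (negPf (tn a)).
Qed.

(* [K] has dimension at most [N] over [k(t)]. *)
Definition few_dependent (t : K) (N : nat) : Prop :=
  forall n (z : 'I_n -> K), (N < n)%N -> exists u : 'I_n -> K,
    [/\ exists i, u i != 0, forall i, in_kt t (u i) & \sum_i u i * z i = 0].

Lemma clear_denominators t w N (u : 'I_N.+1 -> K) : (exists i, u i != 0) ->
  (forall i, in_kt t (u i)) -> \sum_i u i * w ^+ i = 0 ->
  exists Pi : {poly {poly k}}, [/\ Pi != 0, (size Pi <= N.+1)%N & ev2 t w Pi = 0].
Proof.
move=> [i0 ui0] ut e.
have ut' i : exists PQ : {poly k} * {poly k}, ev1 t PQ.2 != 0 /\ u i = ev1 t PQ.1 / ev1 t PQ.2.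
  by have [P [Q h]] := ut i; exists (P, Q).
have [g hg] := fin_all_exists ut'.
pose c i := (g i).1 * \prod_(j | j != i) (g j).2.
have ev1_prod (A : pred 'I_N.+1) (F : 'I_N.+1 -> {poly k}) :
  ev1 t (\prod_(j | A j) F j) = \prod_(j | A j) ev1 t (F j) by exact: rmorph_prod.
have cE i : ev1 t (c i) = u i * \prod_j ev1 t (g j).2.
  have [g0 ->] := hg i.
  by rewrite ev1M ev1_prod [in RHS](bigD1 i) //= mulrA divfK.
have d0 : \prod_j ev1 t (g j).2 != 0 by apply/prodf_neq0 => j _; case: (hg j).
exists (\poly_(i < N.+1) c (inord i)); split; last 1 first.
- rewrite ev2H (@horner_coef_wide _ N.+1); last first.
    by rewrite (leq_trans (size_poly _ _)) // size_poly.
  transitivity ((\sum_i u i * w ^+ i) * \prod_j ev1 t (g j).2); last by rewrite e mul0r.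
  rewrite mulr_suml.
  apply: eq_bigr => i _; rewrite coef_map /= coef_poly ltn_ord inord_val cE.
  by rewrite mulrAC.
- apply: contra_neq ui0 => P0.
  have := congr1 (fun P : {poly {poly k}} => ev1 t P`_i0) P0.
  rewrite coef_poly ltn_ord inord_val coef0 ev1_0 cE => /eqP.
  by rewrite mulf_eq0 (negPf d0) orbF => /eqP.
exact: size_poly.
Qed.

(** N + 1 powers of w are dependent over k(t), hence over k(t'). Lower bounds for the size of a
    relation over k[t'] thus become lower bounds for N, and t' may be a convenient parameter. *)
Lemma power_relation (t t' w : K) N : few_dependent t N -> in_kt t' t ->
  exists Pi : {poly {poly k}}, [/\ Pi != 0, (size Pi <= N.+1)%N & ev2 t' w Pi = 0].
Proof.
move=> hN tt'; have [u [u0 ut e]] := hN N.+1 (fun i => w ^+ i) (ltnSn _).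
exact: (clear_denominators u0 (fun i => in_kt_trans tt' (ut i)) e).
Qed.

(* Dividing by [t - s] as often as possible, a relation can be reduced at [t = s]. *)
Lemma primitive_relation t w s (Pi : {poly {poly k}}) : t != iota s ->
  Pi != 0 -> ev2 t w Pi = 0 -> exists Pi' : {poly {poly k}},
  [/\ (size Pi' <= size Pi)%N, ev2 t w Pi' = 0 & map_poly (horner_eval s) Pi' != 0].
Proof.
move=> ts; have [n] := ubnP (sizeY Pi); elim: n Pi => // n IH Pi sPi P0 e.
have [z|z] := eqVneq (map_poly (horner_eval s) Pi) 0; last by exists Pi.
have dv i : exists q : {poly k}, Pi`_i = q * ('X - s%:P).
  apply/factor_theorem/rootP.
  have := congr1 (fun f : {poly k} => f`_i) z; rewrite coef0 coef_map_id0 //.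
  by rewrite /horner_eval horner0.
pose Q := \poly_(i < size Pi) (Pi`_i %/ ('X - s%:P)).
have PQ : Pi = ('X - s%:P)%:P * Q.
  apply/polyP => i; rewrite coefCM coef_poly; case: ltnP => h.
    by have [q ->] := dv i; rewrite mulpK ?polyXsubC_eq0 // mulrC.
  by rewrite nth_default // mulr0.
have Q0 : Q != 0 by apply: contra_neq P0 => Q0; rewrite PQ Q0 mulr0.
have eQ : ev2 t w Q = 0.
  move: e; rewrite PQ ev2M ev2C ev1B ev1X ev1C => /eqP; rewrite mulf_eq0 subr_eq0.
  by rewrite (negPf ts) => /eqP.
have sQ : (sizeY Q < sizeY Pi)%N.
  rewrite !sizeYE PQ (swapXY_is_monoid_morphism _).2 swapXY_polyC.
  have sw0 : swapXY Q != 0 by rewrite swapXY_eq0.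
  rewrite size_mul //; last by rewrite map_polyC_eq0 polyXsubC_eq0.
  by rewrite size_map_polyC size_XsubC.
have [|Pi' [s1 e1 h1]] := IH Q _ Q0 eQ; first exact: leq_trans sQ _.
by exists Pi'; split => //; apply: leq_trans s1 _; apply: size_poly.
Qed.

Section Specialization.
Variables (c : k) (x y : K) (L : {poly k}).
Hypothesis hC : is_curve iota L c x y.

(** Substituting H0/H1 for the parameter and clearing denominators turns Pi into a polynomial that
    vanishes on the curve, hence a multiple of the relation. This is an identity of polynomials, so
    it can be evaluated at pairs (xi, eta) off the curve with H0 = s H1: up to a power of H1, the
    reduction of Pi at s is a multiple of the relation restricted to that fibre. *)
Lemma specialize t (H0 H1 Pi : {poly {poly k}}) :
  ev2 x y H0 = t * ev2 x y H1 -> ev2 t x Pi = 0 ->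
  exists M Q, forall xi eta s, ev2 xi eta H0 = iota s * ev2 xi eta H1 ->
    ev2 xi eta H1 ^+ M * ev1 xi (map_poly (horner_eval s) Pi)
    = ev2 xi eta Q * ev2 xi eta (curve_rel L c).
Proof.
move=> tE e; pose M := sizeY Pi.
pose R := \sum_(i < size Pi) ('X^i)%:P *
  \sum_(j < M) (Pi`_i`_j)%:P%:P * (H0 ^+ j * H1 ^+ (M - j)).
have ev2_sum (I : finType) (F : I -> {poly {poly k}}) u v :
  ev2 u v (\sum_i F i) = \sum_i ev2 u v (F i).
  exact: (big_morph (ev2 u v) (ev2D iota u v) (ev2_0 iota u v)).
have RE u v T : ev2 u v H0 = T * ev2 u v H1 -> ev2 u v R = ev2 u v H1 ^+ M * ev2 T u Pi.
  move=> h; rewrite /R ev2_sum [ev2 T u Pi]ev2E mulr_sumr; apply: eq_bigr => i _.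
  rewrite ev2M ev2C ev1Xn ev1X ev2_sum.
  have -> : ev1 T Pi`_i = \sum_(j < M) iota Pi`_i`_j * T ^+ j.
    rewrite ev1E (@horner_coef_wide _ M); last first.
      by rewrite (leq_trans (size_poly _ _)) // max_size_coefXY.
    by apply: eq_bigr => j _; rewrite coef_map.
  rewrite mulr_suml !mulr_sumr; apply: eq_bigr => j _.
  rewrite !ev2M !ev2Xn !ev2C ev1C h exprMn.
  rewrite -[X in _ = ev2 u v H1 ^+ X * _](subnKC (ltnW (ltn_ord j))) exprD; ring.
have [Q eQ] : exists Q : {poly {poly k}}, R = Q * curve_rel L c.
  by apply/(proj1 hC); rewrite (RE _ _ t) // e mulr0.
exists M, Q => xi eta s h; rewrite -ev2M -eQ (RE _ _ (iota s)) //; congr (_ * _).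
rewrite ev1E.
have -> : map_poly iota (map_poly (horner_eval s) Pi) = map_poly (ev1 (iota s)) Pi.
  rewrite -map_poly_comp; apply: eq_map_poly => f /=.
  by rewrite ev1_iota.
by rewrite -ev2H.
Qed.

End Specialization.
End RationalFunctions.

(** * Degrees over k(t) *)

Section Degrees.
Variables (k : closedFieldType) (K : fieldType) (iota : {rmorphism k -> K}).
Variables (p m : nat) (alpha : 'I_m.+1 -> k) (lam : 'I_(p ^ m) -> k).
Hypothesis hA : additive_setup alpha lam.
Local Notation L := (additive_poly p alpha).
Local Notation q := (p ^ m)%N.
Local Notation ev1 := (ev1 iota).
Local Notation ev2 := (ev2 iota).
Let q2 : (2 < q)%N := as_gt2 hA.

Lemma ev2_iota a b P : ev2 (iota a) (iota b) P = iota (pt a b P).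
Proof.
elim/poly_ind: P => [|P f IH]; first by rewrite ev2_0 /pt !horner0 rmorph0.
by rewrite ev2D ev2M ev2X ev2C IH ptD ptM ptX ptC rmorphD rmorphM /= ev1_iota.
Qed.

Lemma ev2_poly x f Q : ev2 x (ev1 x f) Q = ev1 x Q.[f].
Proof.
elim/poly_ind: Q => [|P g IH]; first by rewrite ev2_0 horner0 ev1_0.
by rewrite ev2D ev2M ev2X ev2C IH hornerD hornerM hornerX hornerC ev1D ev1M.
Qed.

Section OneCurve.
Variables (c : k) (x y : K).
Hypotheses (c0 : c != 0) (hC : is_curve iota L c x y).
Let einj := ev1_inj (size_L_gt1 hA) hC.
Let xne : forall a, x != iota a := curve_y_ne hA (is_curve_swap hC).

Lemma fiber_root t (H0 H1 Pi : {poly {poly k}}) s a b :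
  ev2 x y H0 = t * ev2 x y H1 -> ev2 t x Pi = 0 -> L.[a] * L.[b] = - c ->
  pt a b H0 = s * pt a b H1 -> pt a b H1 != 0 ->
  (map_poly (horner_eval s) Pi).[a] = 0.
Proof.
move=> tE e ab h0 h1; have [M [Q /(_ (iota a) (iota b) s)]] := specialize hC tE e.
rewrite !ev2_iota h0 rmorphM => /(_ erefl); rewrite ev1_iota -rmorphXn -!rmorphM.
move/fmorph_inj; rewrite /curve_rel ptD ptM pt_map !ptC hornerC ab addNr mulr0.
by move/eqP; rewrite mulf_eq0 expf_eq0 (negPf h1) andbF => /eqP.
Qed.

Lemma bilinear_eq0 A B C D :
  iota A + iota B * x + iota C * y + iota D * (x * y) = 0 ->
  [/\ A = 0, B = 0, C = 0 & D = 0].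
Proof.
move=> e; pose P : {poly {poly k}} := (A%:P + B *: 'X)%:P + (C%:P + D *: 'X)%:P * 'X.
have P0 : P = 0.
  apply: (ev2_small_eq0 (size_L_gt1 hA) hC).
    rewrite (size_L hA) ltnS (leq_trans (size_polyD _ _)) // geq_max.
    rewrite (leq_trans (size_polyC_leq1 _)) ?(leq_trans _ q2) //=.
    rewrite (leq_trans (size_polyMleq _ _)) // size_polyX addn2 /=.
    by rewrite (leq_trans (size_polyC_leq1 _ : _ < 2)%N).
  rewrite ev2D ev2M ev2X !ev2C !ev1D !ev1Z !ev1X !ev1C -[RHS]e; ring.
have c0' := congr1 (fun P : {poly {poly k}} => P`_0) P0.
have c1' := congr1 (fun P : {poly {poly k}} => P`_1) P0.
rewrite coef0 coefD coefMX coefC /= addr0 in c0'.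
rewrite coef0 coefD coefMX !coefC /= add0r in c1'.
have := congr1 (fun f : {poly k} => f`_0) c0'; have := congr1 (fun f : {poly k} => f`_1) c0'.
have := congr1 (fun f : {poly k} => f`_0) c1'; have := congr1 (fun f : {poly k} => f`_1) c1'.
by rewrite !coef0 !coefD !coefZ !coefX !coefC /= !mulr0 !mulr1 ?addr0 !add0r.
Qed.

Lemma nonconst A B C D : (B != 0) || (C != 0) || (D != 0) ->
  forall a, iota A + iota B * x + iota C * y + iota D * (x * y) != iota a.
Proof.
move=> h a; apply/eqP => e.
have [|_ B0 C0 D0] := @bilinear_eq0 (A - a) B C D.
  transitivity (iota A + iota B * x + iota C * y + iota D * (x * y) - iota a).
    by rewrite rmorphB; ring.
  by rewrite e subrr.
by move: h; rewrite B0 C0 D0 eqxx.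
Qed.

(** On the fibre x + gamma y = 0 the relation restricts to L(x) L(- x/gamma) + c, of degree 2q. *)
Lemma degree_line gamma Pi : gamma != 0 -> Pi != 0 ->
  ev2 (x + iota gamma * y) x Pi = 0 -> (q + q < size Pi)%N.
Proof.
move=> g0 P0 e; set t := x + _ in e.
have ts : t != iota 0.
  have := @nonconst 0 1 gamma 0; rewrite oner_eq0 /= => /(_ isT 0).
  by rewrite !rmorph0 rmorph1 add0r mul1r mul0r addr0.
have [Pi' [s' e' P0']] := primitive_relation ts P0 e.
apply: leq_trans s'.
pose H : {poly {poly k}} := 'X%:P + gamma%:P%:P * 'X.
have tE : ev2 x y H = t * ev2 x y 1.
  by rewrite ev2_1 mulr1 ev2D ev2M ev2X !ev2C ev1X ev1C.
pose f : {poly k} := (- gamma^-1) *: 'X.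
have [M [Q /(_ x (ev1 x f) 0)]] := specialize hC tE e'.
rewrite ev2_1 expr1n !mul1r ev2D ev2M ev2X !ev2C ev1X ev1C rmorph0 mul0r.
have -> : x + iota gamma * ev1 x f = 0.
  by rewrite ev1Z ev1X rmorphN mulNr mulrN mulrA -rmorphM divff // rmorph1 mul1r subrr.
move=> /(_ erefl); rewrite ev2_poly ev2_curve_rel -ev1_comp -ev1M -(ev1C iota x) -ev1D -ev1M.
move/einj => E.
have sz : (size (map_poly (horner_eval 0%R) Pi') <= size Pi')%N := size_poly _ _.
apply: leq_trans sz.
have sf : size f = 2%N by rewrite size_scale ?size_polyX // oppr_eq0 invr_eq0.
have sD : size (L * (L \Po f) + c%:P) = (q + q).+1.
  have sc : size (L \Po f) = q.+1 by rewrite size_comp_poly2 ?(size_L hA).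
  have n1 : L != 0 by rewrite -size_poly_gt0 (size_L hA).
  have n2 : L \Po f != 0 by rewrite -size_poly_gt0 sc.
  have sm : size (L * (L \Po f)) = (q + q).+1.
    by rewrite size_mul // sc (size_L hA) addSn addnS.
  rewrite size_polyDl sm // (leq_ltn_trans (size_polyC_leq1 _)) //.
  by rewrite ltnS addn_gt0 (ltnW (ltnW q2)).
move: P0'; rewrite E mulf_eq0 negb_or => /andP[Q0 D0].
by rewrite size_mul // sD; move: Q0; rewrite -size_poly_gt0; case: (size _) => // n _; rewrite addSn leq_addl.
Qed.

(** On the fibre x = y the relation restricts to L(x)^2 + c, of degree 2q. The denominator
    contributes only a power of x, which is coprime to it since L(0) = 0. *)
Lemma degree_ratio Pi : Pi != 0 -> ev2 (x / y) x Pi = 0 -> (q + q < size Pi)%N.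
Proof.
move=> P0 e; have y0 := curve_y_neq0 hA hC.
have ts : x / y != iota 1.
  rewrite rmorph1; apply/eqP => e1.
  have := @nonconst 0 1 (-1) 0; rewrite oner_eq0 /= => /(_ isT 0).
  have -> : x = y by rewrite -(divfK y0 x) e1 mul1r.
  by rewrite !rmorph0 rmorphN rmorph1 add0r mul1r mulN1r mul0r addr0 subrr eqxx.
have [Pi' [s' e' P0']] := primitive_relation ts P0 e.
apply: leq_trans s'.
have tE : ev2 x y 'X%:P = x / y * ev2 x y 'X.
  by rewrite ev2C ev1X ev2X divfK.
have [M [Q /(_ x (ev1 x 'X) 1)]] := specialize hC tE e'.
rewrite ev2C ev2X rmorph1 mul1r => /(_ erefl).
rewrite ev2_poly ev2_curve_rel ev1X -(ev1C iota x) -ev1M -ev1D.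
have -> : x ^+ M = ev1 x 'X^M by rewrite ev1Xn ev1X.
rewrite -!ev1M => /einj E.
have sm : size (L * L) = (q + q).+1.
  have n1 : L != 0 by rewrite -size_poly_gt0 (size_L hA).
  by rewrite size_mul // (size_L hA) addSn addnS.
have sD : size (L * L + c%:P) = (q + q).+1.
  rewrite size_polyDl sm // (leq_ltn_trans (size_polyC_leq1 _)) //.
  by rewrite ltnS addn_gt0 (ltnW (ltnW q2)).
have cp : coprimep (L * L + c%:P) 'X^M.
  rewrite coprimep_expr // coprimepX /root hornerD hornerM hornerC.
  by rewrite (additive_horner0 _ (as_pchar hA)) mul0r add0r.
have dv : L * L + c%:P %| map_poly (horner_eval 1) Pi'.
  by rewrite -(Gauss_dvdpr _ cp) E dvdp_mull.
have := dvdp_leq P0' dv; rewrite sD => h; apply: leq_trans h (size_poly _ _).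
Qed.

(** The fibre (x + B)(y + B) = 1 is parametrized by (x - B, 1/x - B). Cleared of denominators the
    relation becomes G0, of degree at least 2q - 1 and of order at most 1 at 0; the top and the
    bottom term each drop by one when L(B) = 0. The part coprime to x has degree at least 2q - 2. *)
Lemma degree_hyperbola B Pi : Pi != 0 ->
  ev2 ((x + iota B) * (y + iota B)) x Pi = 0 -> ((q + q).-1 <= size Pi)%N.
Proof.
move=> P0 e; set t := _ * _ in e; have x0 := curve_x_neq0 hA hC.
have ts : t != iota 1.
  have := @nonconst (B * B) B B 1; rewrite oner_eq0 orbT => /(_ isT 1).
  rewrite !rmorph1 rmorphM; congr (_ != _); rewrite /t; ring.
have [Pi' [s' e' P0']] := primitive_relation ts P0 e.
apply: leq_trans s'.
pose H : {poly {poly k}} := ('X + B%:P)%:P * ('X + B%:P%:P).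
have tE : ev2 x y H = t * ev2 x y 1.
  by rewrite ev2_1 mulr1 ev2M ev2D ev2X !ev2C ev1D ev1X !ev1C.
have [M [Q /(_ (x - iota B) (x^-1 - iota B) 1)]] := specialize hC tE e'.
rewrite ev2_1 expr1n !mul1r mulr1 ev2M ev2D ev2X !ev2C ev1D ev1X !ev1C !subrK.
rewrite divff // rmorph1 => /(_ erefl).
have [n [f ef]] : exists n f, x ^+ n * ev2 (x - iota B) (x^-1 - iota B) Q = ev1 x f.
  apply: (ev2_ind (S := fun z => exists n f, x ^+ n * z = ev1 x f)).
  - by move=> a; exists 0%N, a%:P; rewrite mul1r ev1C.
  - by exists 0%N, ('X - B%:P); rewrite mul1r ev1B ev1X ev1C.
  - exists 1%N, (1 - B *: 'X); rewrite ev1B ev1_1 ev1Z ev1X expr1 mulrBr divff //.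
    by rewrite mulrC.
  - move=> u v [n [f ef]] [n' [f' ef']]; exists (n + n')%N, (f * 'X^n' + f' * 'X^n).
    by rewrite ev1D !ev1M !ev1Xn ev1X -ef -ef' exprD; ring.
  move=> u v [n [f ef]] [n' [f' ef']]; exists (n + n')%N, (f * f').
  by rewrite ev1M -ef -ef' exprD; ring.
pose b := L.[B]; pose r := rev_poly q L.
have sL : (size L <= q.+1)%N by rewrite (size_L hA).
have er : ev1 x r = x ^+ q * ev1 x^-1 L by rewrite (ev1_rev _ x0 sL).
pose G0 := (L - b%:P) * (r - b *: 'X^q) + c *: 'X^q.
have eG : x ^+ q * ev2 (x - iota B) (x^-1 - iota B) (curve_rel L c) = ev1 x G0.
  rewrite ev2_curve_rel -!rmorphN !(ev1_LD iota hA) !ev1_iota.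
  rewrite (additive_hornerN _ (as_pchar hA)) rmorphN.
  rewrite ev1D ev1M !ev1B !ev1Z ev1Xn ev1X ev1C er; ring.
move=> E.
have {E}E : 'X^(n + q) * (map_poly (horner_eval 1) Pi' \Po ('X - B%:P)) = f * G0.
  apply: einj; rewrite !ev1M ev1Xn ev1X ev1_comp ev1B ev1X ev1C -ef -eG E exprD; ring.
have P1 : map_poly (horner_eval 1) Pi' \Po ('X - B%:P) != 0.
  by rewrite comp_poly_eq0 // size_XsubC.
have sP1 : size (map_poly (horner_eval 1) Pi' \Po ('X - B%:P)) = size (map_poly (horner_eval 1) Pi').
  by rewrite size_comp_poly2 // size_XsubC.
have sz : (size (map_poly (horner_eval 1%R) Pi') <= size Pi')%N := size_poly _ _.
apply: leq_trans sz; rewrite -sP1.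
have q0 : (0 < q)%N by rewrite ltnW // ltnW.
have L1 : L`_1 = alpha ord0 := coef_additive_pexp alpha (as_pchar hA) ord0.
have L0 : L`_0 = 0 by rewrite -horner_coef0 (additive_horner0 _ (as_pchar hA)).
have r0 : r`_0 = alpha ord_max.
  by rewrite coef_poly /= subn0 (coef_additive_pexp alpha (as_pchar hA) ord_max).
have sr : (q <= size (r - b *: 'X^q)%R)%N.
  rewrite -[X in (X <= _)%N](prednK q0) ltnNge; apply/negP => /(nth_default 0).
  rewrite coefB coefZ coefXn ltn_eqF ?prednK // mulr0 subr0 coef_poly.
  have -> : (q - q.-1 = 1)%N by rewrite -{1}(prednK q0) subSnn.
  by rewrite ltnS leq_pred L1 => /eqP; rewrite (negPf (as_low hA)).
have sLb : size (L - b%:P) = q.+1.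
  rewrite size_polyDl ?(size_L hA) // size_polyN.
  by rewrite (leq_ltn_trans (size_polyC_leq1 _)) // ltnS.
have sG0 : (q + q <= size G0)%N.
  have n1 : L - b%:P != 0 by rewrite -size_poly_gt0 sLb.
  have n2 : r - b *: 'X^q != 0 by rewrite -size_poly_gt0 (leq_trans q0).
  have sm : (q + q <= size ((L - b%:P) * (r - b *: 'X^q))%R)%N.
    by rewrite size_mul // sLb addSn /= leq_add2l.
  rewrite size_polyDl //; apply: leq_ltn_trans (size_scale_leq _ _) _.
  by rewrite size_polyXn; apply: leq_trans sm; rewrite -[X in (X <= _)%N]addn2 leq_add2l ltnW.
have G00 : G0 != 0 by rewrite -size_poly_gt0; apply: leq_trans sG0; rewrite addn_gt0 q0.
have [j [g gr gE]] := multiplicity_XsubC G0 0; rewrite G00 /= subr0 in gr gE.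
have j1 : (j <= 1)%N.
  rewrite leqNgt; apply/negP => j2.
  have cz i : (i < 2)%N -> G0`_i = 0.
    by move=> i2; rewrite gE coefMXn (leq_trans i2 j2).
  have q1 : (1 == q) = false by rewrite ltn_eqF // ltnW.
  have q0' : (0 == q)%N = false by rewrite ltn_eqF.
  have := cz 0%N isT; rewrite /G0 coefD coefZ coefXn q0' mulr0 addr0 coefM big_ord_recl big_ord0 /= addr0.
  rewrite !coefB !coefZ !coefXn !coefC q0' L0 r0 mulr0 subr0 sub0r /= => /eqP.
  rewrite mulf_eq0 oppr_eq0 (negPf (as_lead hA)) orbF => /eqP b0.
  have := cz 1%N isT; rewrite /G0 b0 scale0r !subr0 coefD coefZ coefXn q1 mulr0 addr0.
  rewrite coefM !big_ord_recl big_ord0 /= L0 mul0r add0r addr0 /bump /= L1 subnn r0.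
  by move/eqP; rewrite mulf_eq0 (negPf (as_low hA)) (negPf (as_lead hA)).
have g0 : g != 0 by apply: contra_neq G00 => g0; rewrite gE g0 mul0r.
have sg : size G0 = (j + size g)%N by rewrite gE size_mulXn.
have cp : coprimep g 'X^(n + q) by rewrite coprimep_expr // coprimepX.
have dv : g %| map_poly (horner_eval 1) Pi' \Po ('X - B%:P).
  by rewrite -(Gauss_dvdpr _ cp) E gE mulrA -mulrA mulrCA dvdp_mulr.
apply: leq_trans (dvdp_leq P1 dv); rewrite -subn1 leq_subLR.
by apply: leq_trans sG0 _; rewrite sg leq_add2r.
Qed.

(** With x = f/g and y = f1/g1 in lowest terms, the relation makes g^q L(f/g) a constant multiple of
    g1^q, so its derivative vanishes. That derivative is a nonzero multiple of g^(q-2) (f' g - f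
    g'); hence delta x = 0, whereas delta x = L(x). *)
Lemma not_rational t : ~ (in_kt iota t x /\ in_kt iota t y).
Proof.
move=> [[f0 [g00 [g000 ex]]] [f10 [g10 [g100 ey]]]].
have tn a : t != iota a.
  apply/eqP => ta; have := xne (f0.[a] / g00.[a]).
  by rewrite ex ta !ev1_iota fmorph_div eqxx.
have tinj u v : ev1 t u = ev1 t v -> u = v.
  move=> e; apply/eqP; rewrite -subr_eq0; apply/eqP; apply: (ev1_eq0_nonconst tn).
  by rewrite ev1B e subrr.
have [f [g [fg g0 {}ex]]] := ratio_coprime g000 ex.
have [f1 [g1 [fg1 g10' {}ey]]] := ratio_coprime g100 ey.
have [delta [hd dx _]] := derivation_exists (deriv_additive alpha (as_pchar hA)) hC.
pose hd' : derivation iota (idfun : {rmorphism K -> K}) delta := hd.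
have Lx0 := ev1_Lx_neq0 hA hC.
have numE f' g' : ev1 t g' != 0 ->
    ev1 (ev1 t f' / ev1 t g') L = ev1 t (additive_num p alpha f' g') / ev1 t g' ^+ q.
  move=> g0'; rewrite (ev1_LE iota) additive_hornerE [RHS]mulrC.
  apply: (mulfI (expf_neq0 q g0')); rewrite mulVKf ?expf_neq0 //.
  rewrite /additive_num ev1_sum mulr_sumr.
  apply: eq_bigr => i _ /=; rewrite ev1Z ev1M !ev1Xn expr_div_n.
  rewrite -{1}(subnKC (leq_pexp (as_pchar hA) i)) exprD; field.
  exact: expf_neq0.
have E : additive_num p alpha f g * additive_num p alpha f1 g1 = - c *: (g ^+ q * g1 ^+ q).
  apply: tinj; rewrite ev1Z !ev1M !ev1Xn rmorphN.
  have := is_curve_eq hC; rewrite {1}ex {1}ey !numE // => <-.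
  by field; rewrite !expf_neq0.
have cp : coprimep (additive_num p alpha f g) (g ^+ q).
  rewrite coprimep_expr // coprimep_sym.
  by apply: (coprimep_additive_num (as_pchar hA) (as_lead hA)); rewrite coprimep_sym.
have cp1 : coprimep (g1 ^+ q) (additive_num p alpha f1 g1).
  rewrite coprimep_expl //.
  by apply: (coprimep_additive_num (as_pchar hA) (as_lead hA)); rewrite coprimep_sym.
have c0' : - c != 0 by rewrite oppr_eq0.
have d1 : additive_num p alpha f g %| g1 ^+ q.
  by rewrite -(Gauss_dvdpr _ cp) -(dvdpZr _ _ c0') -E dvdp_mulr.
have d2 : g1 ^+ q %| additive_num p alpha f g.
  by rewrite -(Gauss_dvdpl _ cp1) E dvdpZr // dvdp_mull.
have /eqpP[[u v] /= /andP[u0 v0] uv] : additive_num p alpha f g %= g1 ^+ q by rewrite /eqp d1 d2.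
have m0 : (0 < m)%N by move: q2; case: (m).
have dg : (g1 ^+ q)^`() = 0.
  rewrite deriv_exp -mulr_natr natrX.
  by rewrite (pcharf0 (rmorph_pchar polyC (as_pchar hA))) expr0n gtn_eqF ?mulr0.
have := congr1 (fun h : {poly k} => h^`()) uv.
rewrite !derivZ dg scaler0 (deriv_additive_num _ (as_pchar hA)) ?(ltnW q2) //.
move/eqP; rewrite !scaler_eq0 (negPf u0) (negPf (as_low hA)) /= mulf_eq0 expf_eq0.
have gne : g != 0 by apply: contra g0 => /eqP ->; rewrite ev1_0.
rewrite (negPf gne) andbF /= => /eqP W.
have := Lx0; rewrite -dx ex (derivation_div hd') // !(derivation_ev1 _ hd') //=.
have -> : ev1 t f^`() * delta t * ev1 t g - ev1 t f * (ev1 t g^`() * delta t)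
  = ev1 t (f^`() * g - f * g^`()) * delta t by rewrite ev1B !ev1M; ring.
by rewrite W ev1_0 !mul0r eqxx.
Qed.

End OneCurve.
End Degrees.

(** * Pencils and their Galois groups *)

Section Classification.
Variables (k : closedFieldType) (K : fieldType) (iota : {rmorphism k -> K}).
Variables (p m : nat) (alpha : 'I_m.+1 -> k) (lam : 'I_(p ^ m) -> k).
Hypothesis hA : additive_setup alpha lam.
Local Notation L := (additive_poly p alpha).
Local Notation q := (p ^ m)%N.
Local Notation ev1 := (ev1 iota).
Local Notation ev2 := (ev2 iota).
Local Notation scalar := (scalar p alpha).
Let q2 : (2 < q)%N := as_gt2 hA.

(* The pullback of the form [A Z + B X + C Y + D W] along [(x : y : 1 : x y)]. *)
Definition bilinear (x y : K) (A B C D : k) : K :=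
  iota A + iota B * x + iota C * y + iota D * (x * y).

(** The form in which the Galois hypothesis is used: N distinct automorphisms fixing t, together
    with the bound [K : k(t)] <= N. *)
Definition is_galois_group (t : K) (N : nat) (sig sig' : 'I_N -> {rmorphism K -> K}) : Prop :=
  [/\ forall i, automorphism iota (sig i) (sig' i), forall i, sig i t = t,
      forall i j, sig i =1 sig j -> i = j & few_dependent iota t N].

(** Linear independence of the rows (A, B, C, 0) and (A', B', C', D') of coefficients of Z, X, Y, W,
    the first form being reduced to have no W term. *)
Definition independent (A B C A' B' C' D' : k) : Prop :=
  forall u v, u * A + v * A' = 0 -> u * B + v * B' = 0 -> u * C + v * C' = 0 ->
  v * D' = 0 -> u = 0 /\ v = 0.

Lemma mobius_in_kt g0 g1 h0 h1 (a00 a01 a10 a11 : k) : g0 != 0 -> h0 != 0 ->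
  h0 = iota a00 * g0 + iota a01 * g1 -> h1 = iota a10 * g0 + iota a11 * g1 ->
  in_kt iota (g1 / g0) (h1 / h0).
Proof.
move=> g00 h00 e0 e1; set s := g1 / g0.
have E0 : h0 = g0 * (iota a00 + iota a01 * s) by rewrite e0 /s; field.
have E1 : h1 = g0 * (iota a10 + iota a11 * s) by rewrite e1 /s; field.
have -> : h1 / h0 = (iota a10 + iota a11 * s) / (iota a00 + iota a01 * s).
  move: h00; rewrite E1 E0 mulf_eq0 negb_or => /andP[_ d0].
  by field; rewrite g00 d0.
by apply: in_ktM; [|apply: in_ktV]; apply: in_ktD; try (apply: in_ktM); try exact: in_ktC; exact: in_kt_id.
Qed.

Lemma aut_in_kt sigma sigma' t z : automorphism iota sigma sigma' -> sigma t = t ->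
  in_kt iota t z -> sigma z = z.
Proof.
move=> hs st [P [Q [_ ->]]].
by rewrite fmorph_div !rmorph_ev1 ?st //; apply: autC hs.
Qed.

Section OneCurve.
Variables (c : k) (x y : K).
Hypotheses (c0 : c != 0) (hC : is_curve iota L c x y).

(** Degree 2 in y is below q because q > 2. The invariance of a pencil is a relation of bidegree at
    most (2, 2), so its coefficients can be compared. *)
Lemma quad_eq0 c00 c10 c20 c01 c11 c21 c02 c12 c22 :
  iota c00 + iota c10 * x + iota c20 * (x * x)
  + (iota c01 + iota c11 * x + iota c21 * (x * x)) * y
  + (iota c02 + iota c12 * x + iota c22 * (x * x)) * (y * y) = 0 ->
  [/\ [/\ c00 = 0, c10 = 0 & c20 = 0], [/\ c01 = 0, c11 = 0 & c21 = 0] &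
      [/\ c02 = 0, c12 = 0 & c22 = 0]].
Proof.
move=> e; pose f (u v w : k) : {poly k} := u%:P + v *: 'X + w *: 'X^2.
have ef u v w : ev1 x (f u v w) = iota u + iota v * x + iota w * (x * x).
  by rewrite !ev1D !ev1Z ev1Xn ev1X ev1C expr2.
pose P : {poly {poly k}} := \poly_(i < 3) nth 0 [:: f c00 c10 c20; f c01 c11 c21; f c02 c12 c22] i.
have P0 : P = 0.
  apply: (ev2_small_eq0 (size_L_gt1 hA) hC).
    by rewrite (size_L hA) ltnS (leq_trans (size_poly _ _)).
  rewrite ev2H (@horner_coef_wide _ 3); last first.
    by rewrite (leq_trans (size_poly _ _)) // size_poly.
  rewrite !big_ord_recl big_ord0 /= !coef_map !coef_poly /= !ef -[RHS]e; ring.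
have fz u v w : f u v w = 0 -> [/\ u = 0, v = 0 & w = 0].
  move=> f0; have g i : (f u v w)`_i = 0 by rewrite f0 coef0.
  have := g 0%N; have := g 1%N; have := g 2%N.
  by rewrite /f !coefD !coefZ !coefX !coefXn !coefC /= !mulr0 !mulr1 ?addr0 ?add0r.
have g i : P`_i = 0 by rewrite P0 coef0.
by split; apply: fz; [have := g 0%N|have := g 1%N|have := g 2%N]; rewrite coef_poly.
Qed.

Lemma bil_neq0 A B C D : (A != 0) || (B != 0) || (C != 0) || (D != 0) -> bilinear x y A B C D != 0.
Proof.
move=> h; apply/eqP => /(bilinear_eq0 hA hC)[A0 B0 C0 D0].
by move: h; rewrite A0 B0 C0 D0 eqxx.
Qed.

Lemma aut_eq sigma sigma' rho rho' : automorphism iota sigma sigma' ->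
  automorphism iota rho rho' -> sigma x = rho x -> sigma y = rho y -> sigma =1 rho.
Proof.
move=> hs hr; apply: (is_curve_rmorph_eq hC) => a.
by rewrite (autC hs) (autC hr).
Qed.

Section Pencil.
Variables (A B C A' B' C' D' : k).
Hypothesis hi : independent A B C A' B' C' D'.
Let h0 := bilinear x y A B C 0.
Let h1 := bilinear x y A' B' C' D'.
Let t := h1 / h0.

Lemma pencil_h0_neq0 : h0 != 0.
Proof.
apply/eqP => /(bilinear_eq0 hA hC)[A0 B0 C0 _].
have [||||u0 _] := hi (u := 1) (v := 0); rewrite ?mul0r ?addr0 ?mul1r //.
by move/eqP: u0; rewrite oner_eq0.
Qed.

Lemma pencil_invariant (sigma : {rmorphism K -> K}) : sigma t = t -> sigma h1 * h0 = sigma h0 * h1.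
Proof.
have z := pencil_h0_neq0; have sz : sigma h0 != 0 by rewrite fmorph_eq0.
rewrite /t fmorph_div => /eqP; rewrite eqr_div // => /eqP ->.
by rewrite mulrC.
Qed.

(** Here sigma h0 - h0 is the constant d and sigma h1 - h1 = d1 + D' b' x + D' b y, so invariance
    reads (sigma h1 - h1) h0 = d h1. In the last two cases h0 and h1 share the factor x - a or y -
    a, and t is an affine function of y or of x respectively. *)
Lemma pencil_translation sigma sigma' b b' : automorphism iota sigma sigma' ->
  sigma t = t -> sigma x = x + iota b -> sigma y = y + iota b' -> (b != 0) || (b' != 0) ->
  [\/ D' = 0 /\ B * C' = B' * C,
      exists a, [/\ B != 0, C = 0, A = - a * B, A' = - a * B' & C' = - a * D'] |
      exists a, [/\ C != 0, B = 0, A = - a * C, A' = - a * C' & B' = - a * D']].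
Proof.
move=> hs st sx sy bb; have sc := autC hs; have e := pencil_invariant st.
have s0 : sigma h0 = bilinear (x + iota b) (y + iota b') A B C 0.
  by rewrite /h0 /bilinear !rmorphD !rmorphM !sc sx sy.
have s1 : sigma h1 = bilinear (x + iota b) (y + iota b') A' B' C' D'.
  by rewrite /h1 /bilinear !rmorphD !rmorphM !sc sx sy.
pose d := B * b + C * b'; pose d1 := B' * b + C' * b' + D' * b * b'.
have [] := @quad_eq0 (d1 * A - d * A') (d1 * B + D' * b' * A - d * B') (D' * b' * B)
  (d1 * C + D' * b * A - d * C') (D' * b' * C + D' * b * B - d * D') 0 (D' * b * C) 0 0.
  have : sigma h1 * h0 - sigma h0 * h1 = 0 by rewrite e subrr.
  rewrite s0 s1 /h0 /h1 /bilinear => <-; rewrite /d /d1 !rmorphB !rmorphD !rmorphM rmorph0.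
  ring.
move=> [c00 c10 c20] [c01 c11 _] [c02 _ _].
have [D0|D0] := eqVneq D' 0.
  constructor 1; split => //; rewrite D0 !mul0r ?addr0 ?subr0 in c10 c01.
  have [||||_ d0] := hi (u := d1) (v := - d); rewrite ?mulNr ?D0 ?mulr0 ?oppr0 //.
  have d0' : d = 0 by rewrite -[d]opprK d0 oppr0.
  have d10 : d1 = 0.
    have [||||//] := hi (u := d1) (v := - d); rewrite ?mulNr ?D0 ?mulr0 ?oppr0 //.
  move: d0' d10; rewrite /d /d1 D0 !mul0r addr0 => z0 z1.
  case/orP: bb => bn; apply: (mulIf bn); apply/eqP; rewrite -subr_eq0; apply/eqP.
    transitivity (C' * (B * b + C * b') - C * (B' * b + C' * b')); first ring.
    by rewrite z0 z1 !mulr0 subrr.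
  transitivity (B * (B' * b + C' * b') - B' * (B * b + C * b')); first ring.
  by rewrite z0 z1 !mulr0 subrr.
have Rb : (b' == 0) || (B == 0).
  by move/eqP: c20; rewrite !mulf_eq0 (negPf D0).
have Rc : (b == 0) || (C == 0).
  by move/eqP: c02; rewrite !mulf_eq0 (negPf D0).
have row0 : A = 0 -> B = 0 -> C = 0 -> False.
  move=> A0 B0 C0; have := pencil_h0_neq0; rewrite /h0 /bilinear A0 B0 C0 rmorph0.
  by rewrite !mul0r !addr0 eqxx.
have [b0|b0] := eqVneq b 0.
  have b'0 : b' != 0 by move: bb; rewrite b0 eqxx.
  have B0 : B = 0 by move: Rb; rewrite (negPf b'0) => /eqP.
  have C0 : C != 0.
    apply/eqP => C0; apply: row0 => //.
    have : D' * b' * A = 0 by rewrite -[RHS]c10 /d /d1 b0 B0 C0; ring.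
    by move/eqP; rewrite !mulf_eq0 (negPf D0) (negPf b'0) => /eqP.
  constructor 3; exists (- (A / C)); split => //.
  - by rewrite opprK divfK.
  - rewrite opprK; apply: (mulIf C0); rewrite mulrAC divfK //; apply: (mulIf b'0).
    apply/eqP; rewrite eq_sym -subr_eq0; apply/eqP; rewrite -[RHS]c00 /d /d1 b0 B0; ring.
  rewrite opprK; apply: (mulIf C0); rewrite mulrAC divfK //; apply: (mulIf b'0).
  apply/eqP; rewrite eq_sym -subr_eq0; apply/eqP.
  rewrite -[RHS]c10 /d /d1 b0 B0; ring.
have C0 : C = 0 by move: Rc; rewrite (negPf b0) => /eqP.
have [b'0|b'0] := eqVneq b' 0; last first.
  have B0 : B = 0 by move: Rb; rewrite (negPf b'0) => /eqP.
  case: row0 => //; have : D' * b' * A = 0 by rewrite -[RHS]c10 /d /d1 B0 C0; ring.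
  by move/eqP; rewrite !mulf_eq0 (negPf D0) (negPf b'0) => /eqP.
have B0 : B != 0.
  apply/eqP => B0; apply: row0 => //.
  have : D' * b * A = 0 by rewrite -[RHS]c01 /d /d1 b'0 B0 C0; ring.
  by move/eqP; rewrite !mulf_eq0 (negPf D0) (negPf b0) => /eqP.
constructor 2; exists (- (A / B)); split => //.
- by rewrite opprK divfK.
- rewrite opprK; apply: (mulIf B0); rewrite mulrAC divfK //; apply: (mulIf b0).
  apply/eqP; rewrite eq_sym -subr_eq0; apply/eqP; rewrite -[RHS]c00 /d /d1 b'0 C0; ring.
rewrite opprK; apply: (mulIf B0); rewrite mulrAC divfK //; apply: (mulIf b0).
apply/eqP; rewrite eq_sym -subr_eq0; apply/eqP.
rewrite -[RHS]c01 /d /d1 b'0 C0; ring.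
Qed.

(** sigma acts on 1, x, y, xy with eigenvalues 1, a, 1/a, 1; the four conditions are coefficients of
    the invariance relation, each multiplied by 1 - a or 1 - 1/a. *)
Lemma pencil_homothety sigma sigma' a : automorphism iota sigma sigma' ->
  sigma t = t -> sigma x = iota a * x -> sigma y = iota a^-1 * y -> a != 0 -> a != 1 ->
  [/\ A' * B = A * B', A' * C = A * C', D' * B = 0 & D' * C = 0].
Proof.
move=> hs st sx sy a0 a1; have sc := autC hs; have e := pencil_invariant st.
have s0 : sigma h0 = bilinear (iota a * x) (iota a^-1 * y) A B C 0.
  by rewrite /h0 /bilinear !rmorphD !rmorphM !sc sx sy.
have s1 : sigma h1 = bilinear (iota a * x) (iota a^-1 * y) A' B' C' D'.
  by rewrite /h1 /bilinear !rmorphD !rmorphM !sc sx sy.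
have aa : iota a * iota a^-1 = 1 by rewrite -rmorphM divff // rmorph1.
have [] := @quad_eq0 0 ((1 - a) * (A' * B - A * B')) 0
  ((1 - a^-1) * (A' * C - A * C')) ((a - a^-1) * (B' * C - B * C')) ((1 - a) * (D' * B))
  0 ((1 - a^-1) * (D' * C)) 0.
  have : sigma h1 * h0 - sigma h0 * h1 = 0 by rewrite e subrr.
  rewrite s0 s1 /h0 /h1 /bilinear => <-; rewrite !(rmorphM, rmorphB, rmorph1, rmorph0).
  have xy : iota a * x * (iota a^-1 * y) = x * y by rewrite mulrACA aa mul1r.
  rewrite xy; ring.
have u0 : 1 - a != 0 by rewrite subr_eq0 eq_sym.
have v0 : 1 - a^-1 != 0 by rewrite subr_eq0 eq_sym invr_eq1.
move=> [_ /eqP + _] [/eqP + _ /eqP +] [_ /eqP + _].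
rewrite ![(1 - _) * _ == 0]mulf_eq0 (negPf u0) (negPf v0) !subr_eq0 /=.
by move=> /eqP e1 /eqP e2 /eqP e3 /eqP e4.
Qed.

Lemma pencil_swap sigma sigma' : automorphism iota sigma sigma' ->
  sigma t = t -> sigma x = y -> sigma y = x -> ~ (D' = 0 /\ B * C' = B' * C) ->
  [/\ D' != 0, B = C & B' = C'].
Proof.
move=> hs st sx sy nd; have sc := autC hs; have e := pencil_invariant st.
have s0 : sigma h0 = bilinear y x A B C 0.
  by rewrite /h0 /bilinear !rmorphD !rmorphM !sc sx sy.
have s1 : sigma h1 = bilinear y x A' B' C' D'.
  by rewrite /h1 /bilinear !rmorphD !rmorphM !sc sx sy.
have [] := @quad_eq0 0 (A' * B + A * C' - A * B' - A' * C) (C' * B - B' * C)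
  (A' * C + A * B' - A * C' - A' * B) 0 (D' * (B - C)) (B' * C - C' * B) (D' * (C - B)) 0.
  have : sigma h1 * h0 - sigma h0 * h1 = 0 by rewrite e subrr.
  rewrite s0 s1 /h0 /h1 /bilinear => <-; rewrite !(rmorphM, rmorphB, rmorphD, rmorph0).
  ring.
move=> [_ e1 e2] [_ _ /eqP e3] _.
have D0 : D' != 0.
  apply/eqP => d0; apply: nd; split => //.
  by rewrite [B * C']mulrC; apply/eqP; rewrite -subr_eq0 e2.
move: e3; rewrite mulf_eq0 (negPf D0) subr_eq0 /= => /eqP BC.
split => //; rewrite BC in e1 e2.
apply/eqP; rewrite eq_sym -subr_eq0; apply/negPn/negP => n0.
have C0 : C = 0.
  by move/eqP: e2; rewrite -mulrBl mulf_eq0 (negPf n0) => /eqP.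
have A0 : A = 0.
  have : A * (C' - B') = 0 by rewrite -e1; ring.
  by move/eqP; rewrite mulf_eq0 (negPf n0) orbF => /eqP.
have := pencil_h0_neq0; rewrite /h0 /bilinear BC A0 C0 rmorph0.
by rewrite !mul0r !addr0 eqxx.
Qed.

End Pencil.
End OneCurve.
End Classification.

Lemma injective_count (T : eqType) N (g : 'I_N -> T) (s : seq T) :
  injective g -> (forall i, g i \in s) -> (N <= size s)%N.
Proof.
move=> gi gs; rewrite -[X in (X <= _)%N](size_enum_ord N) -(size_map g).
apply: uniq_leq_size; first by rewrite map_inj_uniq ?enum_uniq.
by move=> _ /mapP[i _ ->].
Qed.

Lemma frobenius_fixed (k : closedFieldType) p i : p \in [pchar k] -> (0 < i)%N ->
  exists s : seq k, [/\ uniq s, size s = (p ^ i)%N & forall a, a ^+ (p ^ i) = a <-> a \in s].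
Proof.
move=> hp i0; set n := (p ^ i)%N.
have n1 : (1 < n)%N by rewrite -(expn0 p) ltn_exp2l ?prime_gt1 ?(pcharf_prime hp).
have sz : size ('X^n - 'X : {poly k}) = n.+1.
  by rewrite size_polyDl ?size_polyXn // size_polyN size_polyX.
have [s e] := closed_field_poly_normal ('X^n - 'X : {poly k}).
have l1 : lead_coef ('X^n - 'X : {poly k}) = 1.
  by rewrite lead_coefDl ?lead_coefXn // size_polyN size_polyX size_polyXn.
rewrite l1 scale1r in e; exists s; split.
- rewrite -separable_prod_XsubC -e unlock derivB derivXn derivX.
  rewrite -mulr_natr natrX (pcharf0 (rmorph_pchar polyC hp)) expr0n gtn_eqF // mulr0 sub0r.
  by rewrite -[X in coprimep _ X]scaleN1r coprimepZr ?oppr_eq0 ?oner_eq0 // coprimep1.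
- by have := sz; rewrite e size_prod_XsubC => -[].
move=> a; rewrite -(root_prod_XsubC s) -e /root !hornerE subr_eq0.
by split=> [->|/eqP].
Qed.

(** * Which pencils admit enough automorphisms *)

Section Classification.
Variables (k : closedFieldType) (K : fieldType) (iota : {rmorphism k -> K}).
Variables (p m : nat) (alpha : 'I_m.+1 -> k) (lam : 'I_(p ^ m) -> k).
Hypothesis hA : additive_setup alpha lam.
Variable r : nat.
Hypotheses (r0 : (0 < r)%N) (rm : (r < m)%N).
Hypothesis hr : forall a, a != 0 -> scalar p alpha a -> a ^+ (p ^ r) = a.
Local Notation L := (additive_poly p alpha).
Local Notation q := (p ^ m)%N.
Local Notation ev1 := (ev1 iota).
Local Notation ev2 := (ev2 iota).
Local Notation scalar := (scalar p alpha).
Local Notation bil := (bilinear iota).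
Let q2 : (2 < q)%N := as_gt2 hA.
Let p1 : (1 < p)%N := prime_gt1 (pcharf_prime (as_pchar hA)).
Let pr1 : (1 < p ^ r)%N.
Proof. by rewrite -{1}(expn0 p) ltn_exp2l. Qed.
(** This is how r < m is used: it keeps the group of k(xy) smaller than the degree. *)
Let prq : (2 * p ^ r <= q)%N.
Proof.
apply: leq_trans (leq_mul p1 (leqnn _)) _.
by rewrite -expnS leq_pexp2l // ltnW.
Qed.
Let q4 : (4 <= q)%N.
Proof. by apply: leq_trans prq; rewrite (leq_mul (leqnn 2) pr1). Qed.

Lemma scalarV a : a != 0 -> scalar a -> scalar a^-1.
Proof. by move=> a0 sa i ai; rewrite exprVn sa. Qed.

Lemma is_curve_translate c x y b b' : is_curve iota L c x y -> L.[b] = 0 -> L.[b'] = 0 ->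
  is_curve iota L c (x + iota b) (y + iota b').
Proof.
move=> hC Lb Lb'; have one : forall i, alpha i != 0 -> 1 ^+ (p ^ i) = 1 :> k.
  by move=> *; rewrite expr1n.
have := is_curve_affine hA hC (oner_neq0 _) Lb' one; rewrite rmorph1 !mul1r => /is_curve_swap hC'.
have := is_curve_affine hA hC' (oner_neq0 _) Lb one; rewrite rmorph1 !mul1r => /is_curve_swap //.
Qed.

Section OneCurve.
Variables (c : k) (x y : K).
Hypotheses (c0 : c != 0) (hC : is_curve iota L c x y).

Lemma bil_inj A B C D A' B' C' D' : bil x y A B C D = bil x y A' B' C' D' ->
  [/\ A = A', B = B', C = C' & D = D'].
Proof.
move=> e; have [] := @bilinear_eq0 _ _ iota _ _ _ _ hA _ _ _ hC (A - A') (B - B') (C - C') (D - D').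
  transitivity (bil x y A B C D - bil x y A' B' C' D'); last by rewrite e subrr.
  by rewrite /bilinear !rmorphB; ring.
by move=> /eqP + /eqP + /eqP + /eqP; rewrite !subr_eq0 => /eqP -> /eqP -> /eqP -> /eqP ->.
Qed.

(** Distinct abscissas of points with t = s are distinct roots of the relation reduced at t = s. *)
Lemma fiber_count t (H0 H1 Pi : {poly {poly k}}) s (rs : seq k) :
  ev2 x y H0 = t * ev2 x y H1 -> t != iota s -> Pi != 0 -> ev2 t x Pi = 0 ->
  uniq rs -> (forall a, a \in rs -> exists b,
    [/\ L.[a] * L.[b] = - c, pt a b H0 = s * pt a b H1 & pt a b H1 != 0]) ->
  (size rs < size Pi)%N.
Proof.
move=> tE ts P0 e u h; have [Pi' [s' e' P0']] := primitive_relation ts P0 e.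
apply: leq_trans s'.
have sz : (size (map_poly (horner_eval s) Pi') <= size Pi')%N := size_poly _ _.
apply: leq_trans sz; apply: max_poly_roots => //.
apply/allP => a /h[b [ab h0 h1]]; apply/rootP.
exact: (fiber_root hC tE e' ab h0 h1).
Qed.

Section Pencil.
Variables (A B C A' B' C' D' : k).
Hypothesis hi : independent A B C A' B' C' D'.
Let h0 := bil x y A B C 0.
Let h1 := bil x y A' B' C' D'.
Let t := h1 / h0.
Variables (N : nat) (sig sig' : 'I_N -> {rmorphism K -> K}).
Hypothesis hG : is_galois_group iota t sig sig'.
Let h00 : h0 != 0 := pencil_h0_neq0 hA hC hi.

Lemma pencil_in_kt t' u0 u1 v0 v1 : iota u0 * h0 + iota u1 * h1 != 0 ->
  t' * (iota u0 * h0 + iota u1 * h1) = iota v0 * h0 + iota v1 * h1 -> in_kt iota t t'.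
Proof.
move=> d0 e.
have -> : t' = (iota v0 * h0 + iota v1 * h1) / (iota u0 * h0 + iota u1 * h1).
  by rewrite -e mulfK.
exact: mobius_in_kt h00 d0 erefl erefl.
Qed.

Lemma in_kt_pencil t' g0 a00 a01 a10 a11 : g0 != 0 ->
  h0 = iota a00 * g0 + iota a01 * (t' * g0) -> h1 = iota a10 * g0 + iota a11 * (t' * g0) ->
  in_kt iota t' t.
Proof.
move=> g00 e0 e1; have := mobius_in_kt g00 h00 e0 e1.
by rewrite mulfK.
Qed.

Lemma pencil_const s : t != iota s.
Proof.
apply/eqP => ts; have : bil x y A' B' C' D' = bil x y (s * A) (s * B) (s * C) 0.
  transitivity (iota s * h0); first by rewrite -ts /t divfK.
  by rewrite /h0 /bilinear !rmorphM rmorph0; ring.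
move=> /bil_inj[eA eB eC eD].
have [||||_ /eqP] := hi (u := - s) (v := 1); rewrite ?eA ?eB ?eC ?eD ?mul1r ?mulNr ?addNr //.
by rewrite oner_eq0.
Qed.

Lemma group_form i : exists a b b', [/\ a != 0, scalar a, L.[b] = 0, L.[b'] = 0 &
    (sig i x = iota a * x + iota b /\ sig i y = iota a^-1 * y + iota b') \/
    (sig i x = iota a * y + iota b /\ sig i y = iota a^-1 * x + iota b')].
Proof. by have [hs _ _ _] := hG; apply: (automorphism_form hA c0 hC (hs i)). Qed.

Lemma group_eq i j : sig i x = sig j x -> sig i y = sig j y -> i = j.
Proof.
have [hs _ di _] := hG; move=> ex ey; apply: di.
exact: (aut_eq hC (hs i) (hs j)).
Qed.

(** If neither x nor y is absent, k(t) = k(x + gamma y). The automorphisms fixing x + gamma y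
    without exchanging the coordinates are translations by (- gamma b', b'), at most q of them; the
    degree 2q forces an exchanging one, and its multiplier must be gamma. *)
Lemma degenerate_pencil : D' = 0 -> B * C' = B' * C ->
  [\/ B = 0 /\ B' = 0, C = 0 /\ C' = 0 |
      exists gamma, [/\ gamma != 0, scalar gamma, C = gamma * B & C' = gamma * B']].
Proof.
move=> D0 dep; have [hs ht di hN] := hG.
have [[B0 B'0]|Bn] := classic (B = 0 /\ B' = 0); first by constructor 1.
have [[C0' C'0]|Cn] := classic (C = 0 /\ C' = 0); first by constructor 2.
have [g eC eC'] : exists2 g, C = g * B & C' = g * B'.
  have [B0|B0] := eqVneq B 0.
    have [B'0|B'0] := eqVneq B' 0; first by case: Bn.
    exists (C' / B'); last by rewrite divfK.
    move/eqP: dep; rewrite B0 mul0r mulr0 eq_sym mulf_eq0 (negPf B'0) => /eqP -> //.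
  exists (C / B); first by rewrite divfK.
  by rewrite mulrAC [C * _]mulrC -dep mulrAC divff // mul1r.
have g0 : g != 0.
  by apply: contra_notN Cn => /eqP g0; rewrite eC eC' g0 !mul0r.
constructor 3; exists g; split => //.
(* The determinant of the pencil with respect to 1 and x + gamma y. *)
pose d := A * B' - A' * B.
have d0 : d != 0.
  apply/eqP => d0.
  have [||||bz1 bz2] := hi (u := B') (v := - B); rewrite ?D0 ?eC ?eC' ?mulr0 //.
  - by rewrite -[RHS]d0 /d; ring.
  - by ring.
  - by ring.
  by apply: Bn; split => //; rewrite -[B]opprK bz2 oppr0.
have h0E : h0 = iota A + iota B * (x + iota g * y).
  by rewrite /h0 /bilinear eC rmorphM rmorph0; ring.
have h1E : h1 = iota A' + iota B' * (x + iota g * y).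
  by rewrite /h1 /bilinear eC' D0 rmorphM rmorph0; ring.
have tt : in_kt iota t (x + iota g * y).
  apply: (@pencil_in_kt _ B' (- B) (- A') A).
    have -> : iota B' * h0 + iota (- B) * h1 = iota d.
      by rewrite h0E h1E /d rmorphB !rmorphM rmorphN; ring.
    by rewrite fmorph_eq0.
  by rewrite h0E h1E !rmorphN; ring.
have fixl i : sig i (x + iota g * y) = x + iota g * y := aut_in_kt (hs i) (ht i) tt.
have [[i [a [b [b' [a0 sa [sx sy]]]]]]|hI] := classic (exists i a b b',
    [/\ a != 0, scalar a & sig i x = iota a * y + iota b /\ sig i y = iota a^-1 * x + iota b']).
  have := fixl i; rewrite rmorphD rmorphM (autC (hs i)) sx sy => e.
  have : bil x y (b + g * b') (g / a) a 0 = bil x y 0 1 g 0.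
    transitivity (x + iota g * y); last by rewrite /bilinear !rmorph0 rmorph1; ring.
    rewrite -[RHS]e /bilinear !rmorphD !rmorphM rmorph0; ring.
  by move=> /bil_inj[_ _ <- _].
have hT i : exists b', L.[b'] = 0 /\ sig i x = x + iota (- g * b') /\ sig i y = y + iota b'.
  have [a [b [b' [a0 sa Lb Lb' [[sx sy]|h]]]]] := group_form i; last first.
    by case: hI; exists i, a, b, b'.
  have := fixl i; rewrite rmorphD rmorphM (autC (hs i)) sx sy => e.
  have : bil x y (b + g * b') a (g / a) 0 = bil x y 0 1 g 0.
    transitivity (x + iota g * y); last by rewrite /bilinear !rmorph0 rmorph1; ring.
    rewrite -[RHS]e /bilinear !rmorphD !rmorphM rmorph0; ring.
  move=> /bil_inj[bb aa _ _]; exists b'; split => //; rewrite aa invr1 rmorph1 !mul1r.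
  by split => //; congr (_ + iota _); apply/eqP; rewrite mulNr -addr_eq0 bb.
have [f hf] := fin_all_exists hT.
have Nq : (N <= q)%N.
  have := @injective_count _ N f (codom lam); rewrite size_codom card_ord; apply.
    move=> i j e; have [_ [xi yi]] := hf i; have [_ [xj yj]] := hf j.
    by apply: group_eq; rewrite ?xi ?yi ?xj ?yj e.
  move=> i; have [/(L_root hA)[j ->] _] := hf i; exact: codom_f.
have tt' : in_kt iota (x + iota g * y) t.
  by apply: (in_kt_pencil (oner_neq0 K)); rewrite !mulr1; [exact: h0E|exact: h1E].
have [Pi [P0 sP e]] := power_relation x hN tt'.
have := leq_trans (degree_line hA hC g0 P0 e) sP; rewrite ltnS => h.
have := leq_trans h Nq; rewrite -[X in (_ <= X)%N]addn0 leq_add2l leqNgt => /negP[].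
by rewrite ltnW // ltnW.
Qed.

(** Otherwise [pencil_homothety] leaves two fields: k(x/y), fixed only by (u x, u y) with u^2 = 1,
    and k(xy), fixed only by (u x, y/u) and (u y, x/u) with u in F_(p^r). At most 2, respectively 2
    p^r <= q, automorphisms face degrees at least 2q, respectively 2q - 2. *)
Lemma homothety_degenerate sigma sigma' a : automorphism iota sigma sigma' ->
  sigma t = t -> sigma x = iota a * x -> sigma y = iota a^-1 * y -> a != 0 -> a != 1 ->
  D' = 0 /\ B * C' = B' * C.
Proof.
move=> hs st sx sy a0 a1; apply: NNPP => nl.
have [hs' ht di hN] := hG.
have [eB eC eDB eDC] := pencil_homothety hA hC hi hs st sx sy a0 a1.
have [D0|D0] := eqVneq D' 0.
  have dep : B * C' != B' * C by apply: contra_notN nl => /eqP.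
  have A0 : A = 0.
    have : A * (B * C' - B' * C) = 0.
      transitivity ((A * C') * B - (A * B') * C); first ring.
      by rewrite -eB -eC; ring.
    by move/eqP; rewrite mulf_eq0 [_ - _ == 0]subr_eq0 (negPf dep) orbF => /eqP.
  have A'0 : A' = 0.
    apply/eqP/negPn/negP => A'0; move/eqP: dep; apply.
    move/eqP: eB; move/eqP: eC; rewrite A0 !mul0r !mulf_eq0 (negPf A'0) /= => /eqP -> /eqP ->.
    by rewrite mul0r mulr0.
  have y0 := curve_y_neq0 hA hC.
  have tt : in_kt iota t (x / y).
    apply: (@pencil_in_kt _ B' (- B) (- C') C).
      have -> : iota B' * h0 + iota (- B) * h1 = iota (B' * C - B * C') * y.
        by rewrite /h0 /h1 /bilinear A0 A'0 D0 rmorphB !rmorphM rmorphN rmorph0; ring.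
      by rewrite mulf_neq0 // fmorph_eq0 subr_eq0 eq_sym.
    have -> : iota (- C') * h0 + iota C * h1 = iota (B' * C - B * C') * x.
      by rewrite /h0 /h1 /bilinear A0 A'0 D0 rmorphB !rmorphM rmorphN rmorph0; ring.
    have -> : iota B' * h0 + iota (- B) * h1 = iota (B' * C - B * C') * y.
      by rewrite /h0 /h1 /bilinear A0 A'0 D0 rmorphB !rmorphM rmorphN rmorph0; ring.
    by field.
  have fixl i : sig i x * y = x * sig i y.
    have := aut_in_kt (hs' i) (ht i) tt; rewrite fmorph_div => /eqP.
    by rewrite eqr_div ?fmorph_eq0 // => /eqP ->.
  have hf i : exists a, a ^+ 2 = 1 /\ sig i x = iota a * x /\ sig i y = iota a^-1 * y.
    have [u [b [b' [u0 su Lb Lb' h]]]] := group_form i; have := fixl i.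
    case: h => -[-> ->] e.
      have : bil x y 0 0 b u = bil x y 0 b' 0 u^-1.
        transitivity ((iota u * x + iota b) * y); last rewrite e; rewrite /bilinear !rmorph0; ring.
      move=> /bil_inj[_ <- -> uu]; exists u; rewrite rmorph0 !addr0; split => //.
      by rewrite expr2 {2}uu divff.
    exfalso; have [] := @quad_eq0 _ _ iota _ _ _ _ hA _ _ _ hC 0 (- b') (- u^-1) b 0 0 u 0 0.
      transitivity ((iota u * y + iota b) * y - x * (iota u^-1 * x + iota b')); last by rewrite e subrr.
      by rewrite !rmorphN !rmorph0; ring.
    by move=> _ _ [/eqP]; rewrite (negPf u0).
  have [f {}hf] := fin_all_exists hf.
  have N2 : (N <= 2)%N.
    apply: (@injective_count _ N f [:: 1; -1]).
      move=> i j e; have [_ [xi yi]] := hf i; have [_ [xj yj]] := hf j.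
      by apply: group_eq; rewrite ?xi ?yi ?xj ?yj e.
    by move=> i; have [/eqP + _] := hf i; rewrite sqrf_eq1 !inE.
  have tt' : in_kt iota (x / y) t.
    apply: (@in_kt_pencil _ y C B C' B' y0); rewrite divfK //.
      by rewrite /h0 /bilinear A0 rmorph0; ring.
    by rewrite /h1 /bilinear A'0 D0 rmorph0; ring.
  have [Pi [P0 sP e]] := power_relation x hN tt'.
  have := leq_trans (degree_ratio hA c0 hC P0 e) (leq_trans sP _) => /(_ 3 N2).
  by move: q4; clear; lia.
move/eqP: eDB; move/eqP: eDC; rewrite !mulf_eq0 (negPf D0) /= => /eqP C0' /eqP B0.
have A0 : A != 0.
  by apply: contraNneq h00 => A0; rewrite /h0 /bilinear A0 B0 C0' rmorph0 !mul0r !addr0.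
have B'0 : B' = 0.
  by move/eqP: eB; rewrite B0 mulr0 eq_sym mulf_eq0 (negPf A0) => /eqP.
have C'0 : C' = 0.
  by move/eqP: eC; rewrite C0' mulr0 eq_sym mulf_eq0 (negPf A0) => /eqP.
have tt : in_kt iota t ((x + iota 0) * (y + iota 0)).
  apply: (@pencil_in_kt _ D' 0 (- A') A).
    by rewrite rmorph0 mul0r addr0 mulf_neq0 // fmorph_eq0.
  by rewrite /h0 /h1 /bilinear B0 C0' B'0 C'0 rmorphN rmorph0; ring.
have fixl i : sig i x * sig i y = x * y.
  by have := aut_in_kt (hs' i) (ht i) tt; rewrite rmorph0 !addr0 rmorphM.
have hf i : exists wa : bool * k, wa.2 ^+ (p ^ r) = wa.2 /\
    (sig i x = iota wa.2 * (if wa.1 then y else x) /\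
     sig i y = iota wa.2^-1 * (if wa.1 then x else y)).
  have [u [b [b' [u0 su Lb Lb' h]]]] := group_form i; have := fixl i.
  case: h => -[-> ->] e.
    have : bil x y (b * b') (u * b') (b * u^-1) 1 = bil x y 0 0 0 1.
      transitivity ((iota u * x + iota b) * (iota u^-1 * y + iota b')).
        rewrite /bilinear !rmorphM rmorph1 fmorphV; field; by rewrite fmorph_eq0.
      by rewrite e /bilinear rmorph0 rmorph1; ring.
    move=> /bil_inj[_ /eqP + /eqP + _]; rewrite !mulf_eq0 invr_eq0 (negPf u0) orbF /= => /eqP -> /eqP ->.
    by exists (false, u); rewrite rmorph0 !addr0 /=; split => //; apply: hr.
  have : bil x y (b * b') (b * u^-1) (u * b') 1 = bil x y 0 0 0 1.
    transitivity ((iota u * y + iota b) * (iota u^-1 * x + iota b')).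
      rewrite /bilinear !rmorphM rmorph1 fmorphV; field; by rewrite fmorph_eq0.
    by rewrite e /bilinear rmorph0 rmorph1; ring.
  move=> /bil_inj[_ /eqP + /eqP + _]; rewrite !mulf_eq0 invr_eq0 (negPf u0) orbF /= => /eqP -> /eqP ->.
  by exists (true, u); rewrite rmorph0 !addr0 /=; split => //; apply: hr.
have [f {}hf] := fin_all_exists hf.
have [s [_ ss hs2]] := frobenius_fixed (as_pchar hA) r0.
have N2 : (N <= 2 * p ^ r)%N.
  have := @injective_count _ N f [seq (w, z) | w <- [:: true; false], z <- s].
  rewrite size_allpairs ss; apply.
    move=> i j e; have [_ [xi yi]] := hf i; have [_ [xj yj]] := hf j.
    by apply: group_eq; rewrite ?xi ?yi ?xj ?yj e.
  move=> i; have [/hs2 h _] := hf i; rewrite [f i]surjective_pairing.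
  by apply/allpairsP; exists (f i); split => //; case: (f i).1.
have tt' : in_kt iota ((x + iota 0) * (y + iota 0)) t.
  apply: (@in_kt_pencil _ 1 A 0 A' D' (oner_neq0 K)); rewrite !mulr1.
    by rewrite /h0 /bilinear B0 C0' rmorph0; ring.
  by rewrite /h1 /bilinear B'0 C'0 rmorph0; ring.
have [Pi [P0 sP e]] := power_relation x hN tt'.
have := leq_trans (degree_hyperbola hA hC P0 e) sP.
have := leq_trans N2 prq; move: q4; clear; lia.
Qed.

(** Otherwise both forms are symmetric, and up to a Moebius map t is (x + b)(y + b) or (xy - eta) /
    (x + y - xi). In the second case some fibre has too many points. If z (xi - z) = eta, the fibre
    at z is (x - z)(y - z) = 0, with q points of the curve on y = z unless L(z) = 0. This gives L(u)
    = L(xi - u) = 0, so L(xi) = 0, and on the fibre x + y = xi the relation becomes L(x)^2 = c, with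
    at least q solutions. *)
Lemma swap_degenerate sigma sigma' : automorphism iota sigma sigma' ->
  sigma t = t -> sigma x = y -> sigma y = x -> (N <= 2)%N -> D' = 0 /\ B * C' = B' * C.
Proof.
move=> hs st sx sy N2; apply: NNPP => nl; have [_ _ _ hN] := hG.
have [D0 eB eB'] := pencil_swap hA hC hi hs st sx sy nl.
have [B0|B0] := eqVneq B 0.
  have C0' : C = 0 by rewrite -eB.
  have A0 : A != 0.
    by apply: contraNneq h00 => A0; rewrite /h0 /bilinear A0 B0 C0' rmorph0 !mul0r !addr0.
  pose b := B' / D'.
  have tt : in_kt iota ((x + iota b) * (y + iota b)) t.
    apply: (@in_kt_pencil _ 1 A 0 (A' - D' * b ^+ 2) D' (oner_neq0 K)); rewrite !mulr1.
      by rewrite /h0 /bilinear B0 C0' rmorph0; ring.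
    have eb : iota D' * iota b = iota B' by rewrite -rmorphM /b mulrC divfK.
    by rewrite /h1 /bilinear -eB' -eb rmorphB !rmorphM; ring.
  have [Pi [P0 sP e]] := power_relation x hN tt.
  have := leq_trans (degree_hyperbola hA hC P0 e) (leq_trans sP _) => /(_ 3 N2).
  by move: q4; clear; lia.
(* Chosen so that h0 = B (x + y - xi) and h1 = (B'/B) h0 + D' (xy - eta). *)
pose xi := - A / B; pose eta := (A' - A * B' / B) / - D'.
have [u uv] : exists u, u * (xi - u) = eta.
  have sz : size ('X^2 - (xi *: 'X - eta%:P) : {poly k}) != 1.
    rewrite size_polyDl ?size_polyXn // size_polyN (leq_ltn_trans (size_polyD _ _)) // gtn_max size_polyN.
    rewrite (leq_ltn_trans (size_scale_leq _ _)) ?size_polyX //.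
    by rewrite (leq_ltn_trans (size_polyC_leq1 _)).
  have [u /rootP] := closed_rootP _ sz.
  rewrite !hornerE => e; exists u; apply/eqP; rewrite -subr_eq0 -oppr_eq0 -e; apply/eqP; ring.
pose g0 := x + y - iota xi; pose g1 := x * y - iota eta.
have g00 : g0 != 0.
  have : bil x y (- xi) 1 1 0 != 0 by apply: (bil_neq0 hA hC); rewrite oner_eq0 orbT.
  by congr (_ != 0); rewrite /bilinear /g0 rmorphN rmorph1 rmorph0; ring.
have g10 : g1 != 0.
  have : bil x y (- eta) 0 0 1 != 0 by apply: (bil_neq0 hA hC); rewrite oner_eq0 orbT.
  by congr (_ != 0); rewrite /bilinear /g1 rmorphN rmorph1 rmorph0; ring.
have exi : iota B * iota xi = - iota A by rewrite -rmorphM /xi mulrC divfK ?rmorphN.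
have h0E : h0 = iota B * g0.
  by rewrite /h0 /bilinear -eB /g0 mulrBr exi rmorph0; ring.
have h1E : h1 = iota (B' / B * B) * g0 + iota D' * g1.
  have eet : iota D' * iota eta = iota (A * (B' / B)) - iota A'.
    by rewrite -rmorphM -rmorphB; congr (iota _); rewrite /eta; field; rewrite oppr_eq0 D0 B0.
  rewrite rmorphM -mulrA -h0E /h0 /h1 /bilinear -eB' -eB /g1 [iota D' * (_ - _)]mulrBr eet.
  have -> : iota B' = iota (B' / B) * iota B by rewrite -rmorphM divfK.
  by rewrite rmorphM rmorph0; ring.
have tt : in_kt iota (g1 / g0) t.
  by apply: (@in_kt_pencil _ g0 B 0 (B' / B * B) D' g00); rewrite (divfK g00) // rmorph0 mul0r addr0.
(* The fibre g0 = 0 lies at infinity for g1/g0, so the inverse parameter is needed as well. *)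
have tt1 : in_kt iota (g0 / g1) t.
  apply: (@in_kt_pencil _ g1 0 B D' (B' / B * B) g10); rewrite (divfK g10).
    by rewrite rmorph0 mul0r add0r.
  by rewrite addrC.
pose G0 : {poly {poly k}} := 'X%:P + 'X - xi%:P%:P.
pose G1 : {poly {poly k}} := 'X%:P * 'X - eta%:P%:P.
have G0E v w : ev2 v w G0 = v + w - iota xi.
  by rewrite ev2B ev2D ev2X !ev2C ev1X ev1C.
have G1E v w : ev2 v w G1 = v * w - iota eta.
  by rewrite ev2B ev2M ev2X !ev2C ev1X ev1C.
have ptG0 v w : pt v w G0 = v + w - xi.
  by rewrite /pt !hornerE.
have ptG1 v w : pt v w G1 = v * w - eta.
  by rewrite /pt !hornerE.
have li : injective lam := as_inj hA.
have Llam v i : L.[v + lam i] = L.[v].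
  by rewrite (additive_hornerD _ (as_pchar hA)) (L_lam hA) addr0.
have roots z : z * (xi - z) = eta -> L.[z] = 0.
  move=> ez; apply/eqP/negPn/negP => Lz.
  have [w Lw] := L_onto hA (- c / L.[z]).
  have [Pi [P0 sP e]] := power_relation x hN tt.
  (* Abscissas of the points on y = z; the one with g0 = 0 is removed, and at least q - 1 >= 3
     remain. *)
  pose rs := [seq v <- [seq w + lam i | i : 'I_q] | v != xi - z].
  have urs : uniq [seq w + lam i | i : 'I_q].
    by rewrite map_inj_uniq ?enum_uniq // => i j /addrI /li.
  have srs : (q.-1 <= size rs)%N.
    rewrite size_filter -(leq_add2r (count (predC (fun v => v != xi - z)) [seq w + lam i | i : 'I_q])) count_predC.
    rewrite size_map size_enum_ord.
    have -> : count (predC (fun v => v != xi - z)) [seq w + lam i | i : 'I_q] = count_mem (xi - z) [seq w + lam i | i : 'I_q].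
      by apply: eq_count => v /=; rewrite negbK.
    rewrite count_uniq_mem //; move: q4; case: (_ \in _) => /=; clear; lia.
  have := @fiber_count (g1 / g0) G1 G0 Pi z rs; rewrite G1E G0E divfK // => /(_ erefl).
  have tz : g1 / g0 != iota z.
    apply/eqP => ez'; have : bil x y (- eta) 0 0 1 = bil x y (- z * xi) z z 0.
      transitivity g1; first by rewrite /bilinear /g1 rmorphN rmorph1 rmorph0; ring.
      have -> : g1 = iota z * g0 by rewrite -ez' divfK.
      by rewrite /g0 /bilinear mulNr rmorphN rmorphM rmorph0; ring.
    by move=> /bil_inj[_ _ _ /eqP]; rewrite oner_eq0.
  move=> /(_ tz P0 e (filter_uniq _ urs)) h.
  have {h} : (size rs < size Pi)%N.
    apply: h => v; rewrite mem_filter => /andP[vn /mapP[i _ ev]].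
    exists z; rewrite ptG0 ptG1; split.
    - by rewrite ev Llam Lw divfK.
    - by rewrite -ez; ring.
    - by rewrite subr_eq0 -[xi](subrK z) (inj_eq (addIr z)).
  by move: srs sP N2 q4; clear; lia.
have Lu := roots _ uv; have Lv : L.[xi - u] = 0 by apply: roots; rewrite -uv; ring.
have Lxi : L.[xi] = 0.
  by rewrite -[xi](subrK u) (additive_hornerD _ (as_pchar hA)) Lv Lu addr0.
have [d d2] : exists d, d ^+ 2 = c.
  have sz : size ('X^2 - c%:P : {poly k}) != 1 by rewrite size_XnsubC.
  have [d /rootP] := closed_rootP _ sz.
  by rewrite !hornerE => /eqP; rewrite subr_eq0 => /eqP <-; exists d.
have [w Lw] := L_onto hA d.
have [Pi [P0 sP e]] := power_relation x hN tt1.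
have := @fiber_count (g0 / g1) G0 G1 Pi 0 [seq w + lam i | i : 'I_q]; rewrite G1E G0E divfK // => /(_ erefl).
have tz : g0 / g1 != iota 0 by rewrite rmorph0 mulf_neq0 ?invr_eq0.
move=> /(_ tz P0 e) h.
have {h} : (size [seq (w + lam i)%R | i : 'I_q] < size Pi)%N.
  apply: h; first by rewrite map_inj_uniq ?enum_uniq // => i j /addrI /li.
  move=> v /mapP[i _ ev]; exists (xi - v); rewrite ptG0 ptG1 mul0r.
  have Lvv : L.[v] = d by rewrite ev Llam Lw.
  split.
  - by rewrite (additive_hornerB _ (as_pchar hA)) Lxi sub0r mulrN Lvv -expr2 d2.
  - by rewrite addrCA subrr addr0 subrr.
  - rewrite -uv; have -> : v * (xi - v) - u * (xi - u) = - ((v - u) * (v - (xi - u))) by ring.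
    have dn : d != 0 by apply: contraNneq c0 => d0; rewrite -d2 d0 expr0n.
    by rewrite oppr_eq0 mulf_neq0 // subr_eq0; apply: contraNneq dn => ev'; rewrite -Lvv ev' ?Lu ?Lv.
by rewrite size_map size_enum_ord; move: sP N2 q4; clear; lia.
Qed.

End Pencil.
End OneCurve.

Lemma in_kt_linear t z c0 c1 : (forall a, t != iota a) -> (c0 != 0) || (c1 != 0) ->
  ev1 t c0 + ev1 t c1 * z = 0 -> in_kt iota t z.
Proof.
move=> tn c01 e; have c10 : ev1 t c1 != 0.
  apply: contraTneq c01 => e1; move: e; rewrite e1 mul0r addr0 => e0.
  by rewrite (ev1_eq0_nonconst tn e0) (ev1_eq0_nonconst tn e1) eqxx.
exists (- c0), c1; split => //; rewrite ev1N; apply: (canRL (mulfK c10)).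
by apply/eqP; rewrite -addr_eq0 addrC mulrC e.
Qed.

Lemma in_kt_of_size2 t z N : (forall a, t != iota a) -> few_dependent iota t N -> (N <= 1)%N ->
  in_kt iota t z.
Proof.
move=> tn hN N1; have [Pi [P0 sP e]] := power_relation z hN (in_kt_id iota t).
have sP2 : (size Pi <= 2)%N by apply: leq_trans sP _; rewrite ltnS.
apply: (in_kt_linear (c0 := Pi`_0) (c1 := Pi`_1) tn).
  apply: contra_neqT P0; rewrite negb_or !negbK => /andP[/eqP p0 /eqP p1'].
  apply/polyP => -[|[|i]]; rewrite coef0 //.
  by rewrite nth_default // (leq_trans sP2).
rewrite -[RHS]e ev2H (@horner_coef_wide _ 2); last by rewrite (leq_trans (size_poly _ _)).
by rewrite !big_ord_recl big_ord0 !coef_map /= expr0 mulr1 expr1 addr0.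
Qed.

Section Main.
Variables (c : k) (x y : K).
Hypotheses (c0 : c != 0) (hC : is_curve iota L c x y).
Variables (A B C A' B' C' D' : k).
Hypothesis hi : independent A B C A' B' C' D'.
Let h0 := bil x y A B C 0.
Let h1 := bil x y A' B' C' D'.
Let t := h1 / h0.
Variables (N : nat) (sig sig' : 'I_N -> {rmorphism K -> K}).
Hypothesis hG : is_galois_group iota t sig sig'.

(** Since a <> 1, the affine map has a fixed point (x0, y0), and L(x0) = L(y0) = 0 because L
    commutes with multiplication by a. Moving the origin there keeps the curve and makes sigma a
    homothety. *)
Lemma non_translation_degenerate sigma sigma' a b b' : automorphism iota sigma sigma' -> sigma t = t ->
  a != 0 -> a != 1 -> scalar a -> L.[b] = 0 -> L.[b'] = 0 ->
  sigma x = iota a * x + iota b -> sigma y = iota a^-1 * y + iota b' ->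
  D' = 0 /\ B * C' = B' * C.
Proof.
move=> hs st a0 a1 sa Lb Lb' sx sy.
have center u v : u != 1 -> scalar u -> L.[v] = 0 ->
    exists2 z, L.[z] = 0 & u * z + v = z.
  move=> u1 su Lv; have u1' : 1 - u != 0 by rewrite subr_eq0 eq_sym.
  have e : u * (v / (1 - u)) + v = v / (1 - u) by field.
  exists (v / (1 - u)) => //; apply: (mulfI u1'); rewrite mulr0.
  have := congr1 (fun z => L.[z]) e.
  rewrite /= (additive_hornerD _ (as_pchar hA)) Lv addr0 (additive_hornerZ _ su) => e'.
  by rewrite mulrBl mul1r e' subrr.
have [x0 Lx0 ex0] := center a b a1 sa Lb.
have a1' : a^-1 != 1 by rewrite invr_eq1.
have [y0 Ly0 ey0] := center a^-1 b' a1' (scalarV a0 sa) Lb'.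
have hC' : is_curve iota L c (x - iota x0) (y - iota y0).
  rewrite -!rmorphN; apply: is_curve_translate => //.
    by rewrite (additive_hornerN _ (as_pchar hA)) Lx0 oppr0.
  by rewrite (additive_hornerN _ (as_pchar hA)) Ly0 oppr0.
pose A1 := A + B * x0 + C * y0; pose A1' := A' + B' * x0 + C' * y0 + D' * x0 * y0.
pose B1' := B' + D' * y0; pose C1' := C' + D' * x0.
have hi1 : independent A1 B C A1' B1' C1' D'.
  move=> u v eA eB eC eD; apply: hi => //.
  - transitivity (u * A1 + v * A1' - x0 * (u * B + v * B1') - y0 * (u * C + v * C1') + x0 * y0 * (v * D')).
      by rewrite /A1 /A1' /B1' /C1'; ring.
    by rewrite eA eB eC eD !mulr0 !subr0 addr0.
  - transitivity (u * B + v * B1' - y0 * (v * D')); first by rewrite /B1'; ring.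
    by rewrite eB eD mulr0 subr0.
  - transitivity (u * C + v * C1' - x0 * (v * D')); first by rewrite /C1'; ring.
    by rewrite eC eD mulr0 subr0.
have e0 : bil (x - iota x0) (y - iota y0) A1 B C 0 = h0.
  by rewrite /h0 /bilinear /A1 !rmorphD !rmorphM rmorph0; ring.
have e1 : bil (x - iota x0) (y - iota y0) A1' B1' C1' D' = h1.
  by rewrite /h1 /bilinear /A1' /B1' /C1' !rmorphD !rmorphM; ring.
have hG1 := hG; have st1 := st; rewrite /t -e0 -e1 in hG1 st1.
have sx1 : sigma (x - iota x0) = iota a * (x - iota x0).
  by rewrite rmorphB sx (autC hs) -{1}ex0 rmorphD rmorphM; ring.
have sy1 : sigma (y - iota y0) = iota a^-1 * (y - iota y0).
  by rewrite rmorphB sy (autC hs) -{1}ey0 rmorphD rmorphM; ring.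
have [D0 dep] := homothety_degenerate c0 hC' hi1 hG1 hs st1 sx1 sy1 a0 a1.
by split => //; move: dep; rewrite /B1' /C1' D0 !mul0r !addr0.
Qed.

(** Outside the listed cases an automorphism fixing t without exchanging the coordinates is trivial,
    and so is the product of two exchanging ones. Either N <= 1, and K = k(t) contradicts
    [not_rational], or N <= 2 with an exchanging involution, which [swap_degenerate] excludes. *)
Lemma pencil_classification :
  [\/ [/\ D' = 0, B * C' = B' * C & [\/ B = 0 /\ B' = 0, C = 0 /\ C' = 0 |
        exists gamma, [/\ gamma != 0, scalar gamma, C = gamma * B & C' = gamma * B']]],
      exists a, [/\ B != 0, C = 0, A = - a * B, A' = - a * B' & C' = - a * D'] |
      exists a, [/\ C != 0, B = 0, A = - a * C, A' = - a * C' & B' = - a * D']].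
Proof.
have [[D0 dep]|nl] := classic (D' = 0 /\ B * C' = B' * C).
  by constructor 1; split => //; apply: (degenerate_pencil c0 hC hi hG).
apply: NNPP => nc; have [hs ht di hN] := hG.
have xy_ind := bil_inj hC.
have trivI sigma sigma' a1 b1 : automorphism iota sigma sigma' -> sigma t = t ->
    sigma x = iota a1 * x + iota b1 -> sigma =1 id.
  move=> h st ex; have [a [b [b' [a0 sa Lb Lb' [[sx sy]|[sx sy]]]]]] := automorphism_form hA c0 hC h; last first.
    have : bil x y b 0 a 0 = bil x y b1 a1 0 0.
      transitivity (sigma x); [rewrite sx|rewrite ex]; rewrite /bilinear !rmorph0; ring.
    by move=> /xy_ind[_ _ a00 _]; rewrite a00 eqxx in a0.
  have [a1e|a1'] := eqVneq a 1; last first.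
    by case: nl; apply: (non_translation_degenerate h st a0 a1' sa Lb Lb' sx sy).
  rewrite a1e invr1 rmorph1 !mul1r in sx sy.
  have [bb|] := boolP ((b != 0) || (b' != 0)).
    have [//|[u hu]|[u hu]] := pencil_translation hA hC hi h st sx sy bb.
      by case: nc; constructor 2; exists u.
    by case: nc; constructor 3; exists u.
  rewrite negb_or !negbK => /andP[/eqP b0 /eqP b0'].
  rewrite b0 b0' rmorph0 !addr0 in sx sy.
  by apply: (is_curve_rmorph_eq (f := sigma) (g := idfun) hC) => //= z; rewrite (autC h).
have tn s : t != iota s := pencil_const hC hi s.
have typeI i a b : sig i x = iota a * x + iota b -> sig i =1 id.
  by move=> ex; apply: (trivI _ _ _ _ (hs i) (ht i) ex).
have comp_aut i j : automorphism iota (sig i \o sig j) (sig' j \o sig' i).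
  split => [z|z|z|z] /=; rewrite ?(autC (hs _)) ?(autC' (hs _)) //.
  - by rewrite (autK (hs i)) (autK (hs j)).
  - by rewrite (autK' (hs j)) (autK' (hs i)).
have [[i0 [a [b [b' [a0 sa Lb [sx sy]]]]]]|hI] := classic (exists i a b b',
    [/\ a != 0, scalar a, L.[b] = 0 & sig i x = iota a * y + iota b /\ sig i y = iota a^-1 * x + iota b']);
  last first.
  have N1 : (N <= 1)%N.
    apply: (@injective_count _ N (fun=> tt) [:: tt]) => // i j _; apply: di.
    have idi l : sig l =1 id.
      have [a [b [b' [a0 sa Lb Lb' [[sx sy]|h]]]]] := group_form c0 hC hG l.
        exact: typeI sx.
      by case: hI; exists l, a, b, b'.
    by move=> z; rewrite !idi.
  by apply: (not_rational hA c0 hC (t := t)); split; apply: (in_kt_of_size2 _ tn hN N1).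
have comp_id i j : (exists u v w, sig j x = iota u * y + iota v /\ sig i y = iota w * x + iota b') ->
    sig i \o sig j =1 id.
  move=> [u [v [w [ej ei]]]]; apply: (trivI _ _ (u * w) (u * b' + v) (comp_aut i j)).
    by rewrite /= ht ht.
  by rewrite /= ej rmorphD rmorphM !(autC (hs i)) ei !rmorphD !rmorphM; ring.
have invol : sig i0 \o sig i0 =1 id by apply: comp_id; exists a, b, a^-1.
have all2 i : sig i =1 id \/ i = i0.
  have [u [v [v' [u0 su Lv Lv' [[ex ey]|[ex ey]]]]]] := group_form c0 hC hG i.
    by left; apply: typeI ex.
  right; have e : sig i0 \o sig i =1 id by apply: comp_id; exists u, v, a^-1.
  by apply: di => z; apply: (fmorph_inj (sig i0)); have /= -> := e z; have /= -> := invol z.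
have N2 : (N <= 2)%N.
  apply: (@injective_count _ N (fun i => i == i0) [:: true; false]); last by move=> i; case: (i == i0).
  move=> i j; have [ei|->] := all2 i; have [ej|->] := all2 j => //.
  - by move=> _; apply: di => z; rewrite ei ej.
  - by rewrite eqxx => /eqP.
  - by rewrite eqxx => /esym/eqP ->.
(* With y1 as second coordinate the curve keeps its form, with constant a c, and the involution
   exchanges x and y1 exactly. *)
pose y1 := sig i0 x.
have hC1 : is_curve iota L (a * c) x y1 by rewrite /y1 sx; apply: (is_curve_affine hA).
have yE : y = iota a^-1 * (y1 - iota b).
  by rewrite /y1 sx addrK mulrA -rmorphM mulVf // rmorph1 mul1r.
pose d := a^-1.
have hi1 : independent (A - C * d * b) B (C * d) (A' - C' * d * b) (B' - D' * d * b) (C' * d) (D' * d).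
  have d0 : d != 0 by rewrite invr_eq0.
  move=> u v eA eB eC eD.
  have eC' : u * C + v * C' = 0 by apply: (mulIf d0); rewrite mul0r -[RHS]eC; ring.
  have eD' : v * D' = 0 by apply: (mulIf d0); rewrite mul0r -[RHS]eD; ring.
  apply: hi => //.
    transitivity (u * (A - C * d * b) + v * (A' - C' * d * b) + (u * C + v * C') * d * b); first ring.
    by rewrite eA eC' !mul0r addr0.
  transitivity (u * B + v * (B' - D' * d * b) + (v * D') * d * b); first ring.
  by rewrite eB eD' !mul0r addr0.
have e0 : bil x y1 (A - C * d * b) B (C * d) 0 = h0.
  by rewrite /h0 /bilinear yE !rmorphB !rmorphM rmorph0; ring.
have e1 : bil x y1 (A' - C' * d * b) (B' - D' * d * b) (C' * d) (D' * d) = h1.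
  by rewrite /h1 /bilinear yE !rmorphB !rmorphM; ring.
have hG1 := hG; have st1 := ht i0; rewrite /t -e0 -e1 in hG1 st1.
have ac0 : a * c != 0 by rewrite mulf_neq0.
have [D0 dep] := swap_degenerate ac0 hC1 hi1 hG1 (hs i0) st1 erefl (invol x) N2.
have d0 : d != 0 by rewrite invr_eq0.
have {}D0 : D' = 0 by apply: (mulIf d0); rewrite mul0r.
apply: nl; split => //; apply: (mulIf d0); rewrite -!mulrA dep D0 !mul0r subr0 //.
Qed.

End Main.
End Classification.

(** * Galois extensions of k(t) *)

Section RationalFunctionField.
Variables (k : closedFieldType) (K : fieldType) (iota : {rmorphism k -> K}) (t : K).

(** Membership in k(t) is made boolean by excluded middle, so that k(t) can be equipped as a field
    type. *)
Definition kt : {pred K} :=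
  fun z => if excluded_middle_informative (in_kt iota t z) then true else false.

Lemma ktP z : reflect (in_kt iota t z) (z \in kt).
Proof.
by rewrite unfold_in /kt; case: excluded_middle_informative => h; constructor.
Qed.

Lemma kt_divring_closed : divring_closed kt.
Proof.
split=> [|u v /ktP hu /ktP hv|u v /ktP hu /ktP hv]; apply/ktP.
- by rewrite -(rmorph1 iota); apply: in_ktC.
- apply: in_ktD => //; rewrite -mulN1r; apply: in_ktM => //.
  by rewrite -(rmorph1 iota) -rmorphN; apply: in_ktC.
- by apply: in_ktM => //; apply: in_ktV.
Qed.
HB.instance Definition _ := GRing.isDivringClosed.Build K kt kt_divring_closed.

Definition kt_field : Type := {z : K | z \in kt}.
HB.instance Definition _ := SubChoice.on kt_field.
HB.instance Definition _ := [SubChoice_isSubIntegralDomain of kt_field by <:].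
HB.instance Definition _ := [SubIntegralDomain_isSubField of kt_field by <:].

Lemma kt_field_poly (P : {poly K}) : (forall i, in_kt iota t P`_i) ->
  exists p : {poly kt_field}, map_poly val p = P.
Proof.
move=> h; exists (\poly_(i < size P) insubd (0 : kt_field) P`_i).
apply/polyP => i; rewrite coef_map coef_poly /=; case: ltnP => hi.
  by rewrite insubdK //; apply/ktP.
by rewrite nth_default.
Qed.

(** The product over [rs] is a polynomial over k(t) with root z. As z satisfies no relation of
    smaller degree it is irreducible, and its root field maps onto K, which z generates. Its roots
    are distinct and lie in K, so the extension is separable and normal. *)
Lemma galois_over_kt (rs : seq K) z : uniq rs -> z \in rs ->
  (forall i, in_kt iota t (\prod_(r <- rs) ('X - r%:P))`_i) ->
  (forall Pi : {poly {poly k}}, Pi != 0 -> ev2 iota t z Pi = 0 -> (size rs < size Pi)%N) ->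
  (forall S : K -> Prop, (forall a, in_kt iota t a -> S a) -> S z ->
    (forall a b, S a -> S b -> S (a + b)) -> (forall a b, S a -> S b -> S (a * b)) ->
    (forall a, S a -> S a^-1) -> forall w, S w) ->
  galois_extension (in_kt iota t) (fun _ => True).
Proof.
move=> urs zrs hP min gen; have [p pE] := kt_field_poly hP.
have pz : root (map_poly val p) z by rewrite pE root_prod_XsubC.
have sp : size p = (size rs).+1.
  by rewrite -(size_map_poly val p) pE size_prod_XsubC.
have p0 : p != 0 by rewrite -size_poly_gt0 sp.
have irr : irreducible_poly p.
  apply/(subfx_irreducibleP pz p0) => q qz q0; rewrite sp.
  pose u (i : 'I_(size q).-1.+1) : K := val q`_i.
  have sq : (size q).-1.+1 = size q by rewrite prednK // size_poly_gt0.
  have [||| Pi [P0 sP e]] := @clear_denominators _ _ iota t z (size q).-1 u.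
  - by exists ord_max; rewrite /u fmorph_eq0 /= -lead_coefE lead_coef_eq0.
  - by move=> i; apply/ktP; apply: valP.
  - rewrite -[RHS](rootP qz) (@horner_coef_wide _ (size q).-1.+1) ?size_map_poly ?sq //.
    by apply: eq_bigr => i _; rewrite coef_map.
  by apply: leq_trans (min Pi P0 e) _; rewrite sq in sP.
pose M0 : fieldExtType kt_field := SubFieldExtType pz irr.
pose g : {rmorphism M0 -> K}  := @subfx_inj _ _ val z p.
have gA a : g a%:A = val a by apply: (subfx_inj_base pz p0).
pose z' : M0  := @subfx_root _ _ val z p.
have gz' : g z' = z by apply: (subfx_inj_root pz p0).
have onto w : exists v, g v = w.
  move: w; apply: gen => [a /ktP ha||a b [u <-] [v <-]|a b [u <-] [v <-]|a [u <-]].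
  - by exists (Sub a ha)%:A; rewrite gA.
  - by exists z'.
  - by exists (u + v); rewrite rmorphD.
  - by exists (u * v); rewrite rmorphM.
  - by exists u^-1; rewrite fmorphV.
have [rs' rsE] : exists rs', map g rs' = rs.
  elim: (rs) => [|r s [s' <-]]; first by exists [::].
  by have [v <-] := onto r; exists (v :: s').
have pM : map_poly (in_alg M0) p = \prod_(r <- rs') ('X - r%:P).
  apply: (map_poly_inj g); rewrite -map_poly_comp rmorph_prod /=.
  rewrite (eq_map_poly gA) pE -rsE big_map; apply: eq_bigr => r _.
  by rewrite rmorphB /= map_polyX map_polyC.
have p1 : map_poly (in_alg M0) p \is a polyOver 1%VS by apply/polyOver1P; exists p.
have spl : splittingFieldFor 1 (map_poly (in_alg M0) p) {:M0}.
  exists rs'; first by rewrite pM eqpxx.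
  apply/eqP; rewrite eqEsubv subvf /=; apply/subvP => w _.
  have [q ->] := subfxEroot pz p0 w.
  apply: rpred_horner.
    by apply: (polyOverS (subvP (sub1v _))); apply/polyOver1P; exists q.
  apply: seqv_sub_adjoin; rewrite -(mem_map (fmorph_inj g)) rsE.
  by rewrite -[X in X \in _]/(g z') gz'.
have ax : splitting_field_axiom M0 by exists (map_poly (in_alg M0) p).
pose M : splittingFieldType kt_field := HB.pack M0 (FieldExt_isSplittingField.Build kt_field M0 ax).
exists kt_field, M, g; split.
- move=> w; split => [/ktP hw|[a ->]]; last by rewrite gA; apply/ktP; apply: valP.
  by exists (Sub w hw); rewrite gA.
- by move=> w; split => // _; have [v <-] := onto w; exists v.
apply/splitting_galoisField; exists (map_poly (in_alg M0) p); split => //.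
by rewrite pM separable_prod_XsubC -(map_inj_uniq (fmorph_inj g)) rsE.
Qed.

End RationalFunctionField.

Lemma galois_extension_eq (K : fieldType) (E E' L L' : K -> Prop) :
  (forall z, E z <-> E' z) -> (forall z, L z <-> L' z) ->
  galois_extension E L -> galois_extension E' L'.
Proof.
move=> hE hL [F [M [g [e1 e2 e3]]]]; exists F, M, g; split => // z.
  by rewrite -hE e1.
by rewrite -hL e2.
Qed.

(** * The Galois extensions K / k(x) and K / k(x + gamma y) *)

Section GaloisLines.
Variables (k : closedFieldType) (K : fieldType) (iota : {rmorphism k -> K}).
Variables (p m : nat) (alpha : 'I_m.+1 -> k) (lam : 'I_(p ^ m) -> k).
Hypothesis hA : additive_setup alpha lam.
Variables (c : k) (x y : K).
Local Notation L := (additive_poly p alpha).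
Local Notation q := (p ^ m)%N.
Local Notation ev1 := (ev1 iota).
Local Notation ev2 := (ev2 iota).
Local Notation scalar := (scalar p alpha).
Hypotheses (c0 : c != 0) (hC : is_curve iota L c x y).
Let LK : {poly K} := map_poly iota L.

Lemma iota_lam_inj : injective (fun i => iota (lam i)).
Proof. by move=> i j /fmorph_inj/(as_inj hA). Qed.

(** The translates u + lam i are the roots of L(X - u) = L(X) - L(u). *)
Lemma prod_translates u :
  \prod_(r <- [seq u + iota (lam i) | i : 'I_q]) ('X - r%:P)
  = (iota (alpha ord_max))^-1 *: (LK - (ev1 u L)%:P).
Proof.
have hp := iota_pchar iota hA.
have LE : LK = additive_poly p (fun i => iota (alpha i)) by apply: map_additive_poly.
have h1 : LK \Po (1 *: 'X + (- u)%:P) = LK - (ev1 u L)%:P.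
  rewrite LE (additive_comp_affine _ _ _ hp) (additive_hornerN _ hp) -(ev1_LE iota) polyCN.
  congr (_ - _); rewrite /additive_poly; apply: eq_bigr => i _.
  by rewrite expr1n mulr1.
have h2 : LK = iota (alpha ord_max) *: \prod_i ('X - (iota (lam i))%:P).
  rewrite /LK (as_prod hA) map_polyZ rmorph_prod /=; congr (_ *: _); apply: eq_bigr => i _.
  by rewrite rmorphB /= map_polyX map_polyC.
have n0 : iota (alpha ord_max) != 0 by rewrite fmorph_eq0 (as_lead hA).
rewrite -h1 h2 comp_polyZ scalerA mulVf // scale1r rmorph_prod /=.
rewrite big_map big_enum /=; apply: eq_bigr => i _.
by rewrite rmorphB /= comp_polyX comp_polyC scale1r !polyCD polyCN opprD addrA.
Qed.

(** L(X) - L(y) has its coefficients in k(x) because L(y) = - c / L(x); its degree q is minimal by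
    [ev2_small_eq0]. *)
Lemma galois_x : galois_extension (in_kt iota x) (fun _ : K => True).
Proof.
apply: (@galois_over_kt _ _ iota x [seq y + iota (lam i) | i : 'I_q] y).
- by rewrite map_inj_uniq ?enum_uniq // => i j /addrI /iota_lam_inj.
- have [i li] := lam_zero hA; apply/mapP; exists i; rewrite ?mem_enum //.
  by rewrite li rmorph0 addr0.
- move=> i; have Lx0 := ev1_Lx_neq0 hA hC.
  rewrite prod_translates coefZ coefB coefC coef_map.
  have -> : ev1 y L = iota (- c) / ev1 x L.
    by rewrite rmorphN -(is_curve_eq hC) mulrAC divff // mul1r.
  rewrite -fmorphV; apply: in_ktM; first exact: in_ktC.
  apply: in_ktD; first exact: in_ktC.
  rewrite -mulN1r -(rmorph1 iota) -rmorphN; apply: in_ktM; first exact: in_ktC.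
  case: ifP => _; last by rewrite -(rmorph0 iota); apply: in_ktC.
  by apply: in_ktM; [exact: in_ktC|apply: in_ktV; apply: in_kt_ev1].
- move=> Pi P0 e; rewrite size_map size_enum_ord ltnNge; apply: contra_neqN P0 => sP.
  by apply: (ev2_small_eq0 (size_L_gt1 hA) hC) => //; rewrite (size_L hA) ltnS.
move=> S Skt Sy SD SM SV; apply: (is_curve_ind hC) => // [a|].
  by apply: Skt; apply: in_ktC.
by apply: Skt; apply: in_kt_id.
Qed.

(** (L(X) - L(x)) (L(X) - L(gamma y)) has its coefficients in k(t): L(x) + L(gamma y) is L(t) by
    additivity, and L(x) L(gamma y) = - gamma c because gamma is a scalar. Its degree 2q is minimal
    by [degree_line]. *)
Lemma galois_sum gamma : gamma != 0 -> scalar gamma ->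
  galois_extension (in_kt iota (x + iota gamma * y)) (fun _ : K => True).
Proof.
move=> g0 sg; set t := x + _.
have g0' : iota gamma != 0 by rewrite fmorph_eq0.
pose rs u := [seq u + iota (lam i) | i : 'I_q].
have srs u : size (rs u) = q by rewrite size_map size_enum_ord.
apply: (@galois_over_kt _ _ iota t (rs x ++ rs (iota gamma * y)) x).
- have urs u : uniq (rs u).
    by rewrite map_inj_uniq ?enum_uniq // => i j /addrI /iota_lam_inj.
  rewrite cat_uniq !urs andbT /=; apply/hasPn => _ /mapP[i _ ->]; apply/negP => /mapP[j _ e].
  have [] := @bil_inj _ _ iota _ _ _ _ hA _ _ _ hC (lam i) 0 gamma 0 (lam j) 1 0 0.
    transitivity (iota gamma * y + iota (lam i)); first by rewrite /bilinear !rmorph0; ring.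
    by rewrite e /bilinear !rmorph0 rmorph1; ring.
  by move=> _ /esym/eqP; rewrite oner_eq0.
- have [i li] := lam_zero hA; rewrite mem_cat; apply/orP; left; apply/mapP; exists i; rewrite ?mem_enum //.
  by rewrite li rmorph0 addr0.
- rewrite big_cat /= !prod_translates -scalerAl -scalerAr scalerA.
  have Lgy : ev1 (iota gamma * y) L = iota gamma * ev1 y L.
    by rewrite -(ev1_L_affine iota hA y sg (additive_horner0 _ (as_pchar hA))) rmorph0 addr0.
  have -> : (LK - (ev1 x L)%:P) * (LK - (ev1 (iota gamma * y) L)%:P)
     = LK * LK - ev1 t L *: LK - (iota (gamma * c))%:P.
    have -> : iota (gamma * c) = - (ev1 x L * ev1 (iota gamma * y) L).
      by rewrite Lgy mulrCA (is_curve_eq hC) rmorphM mulrN opprK.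
    by rewrite /t (ev1_LD iota hA) -mul_polyC polyCN polyCM polyCD; ring.
  move=> i; rewrite coefZ !coefB coefC coefZ -rmorphM !coef_map /=.
  rewrite -!fmorphV; apply: in_ktM; first by apply: in_ktM; exact: in_ktC.
  have in_ktN u : in_kt iota t u -> in_kt iota t (- u).
    by move=> h; rewrite -mulN1r -(rmorph1 iota) -rmorphN; apply: in_ktM => //; apply: in_ktC.
  apply: in_ktD; last first.
    by apply: in_ktN; case: ifP => _; [|rewrite -(rmorph0 iota)]; apply: in_ktC.
  apply: in_ktD; first exact: in_ktC.
  apply: in_ktN; apply: in_ktM; last exact: in_ktC.
  exact: in_kt_ev1.
- by move=> Pi P0 e; rewrite size_cat !srs; exact: (degree_line hA hC g0 P0 e).
move=> S Skt Sx SD SM SV; apply: (is_curve_ind hC) => // [a|].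
  by apply: Skt; apply: in_ktC.
have -> : y = iota gamma^-1 * (t + iota (-1) * x).
  by rewrite rmorphN rmorph1 /t fmorphV; field.
apply: (SM); first by apply: Skt; apply: in_ktC.
apply: (SD); first by apply: Skt; apply: in_kt_id.
by apply: (SM) => //; apply: Skt; apply: in_ktC.
Qed.

End GaloisLines.

(** [g] is onto K, hence an isomorphism along which the Galois group is transported; its order is
    the dimension of M, which bounds the independent families. *)
Lemma galois_group_of_extension (k : closedFieldType) (K : fieldType)
    (iota : {rmorphism k -> K}) t : galois_extension (in_kt iota t) (fun _ : K => True) ->
  exists N (sig sig' : 'I_N -> {rmorphism K -> K}), is_galois_group iota t sig sig'.
Proof.
move=> [F [M [g [gE gL hG]]]].
have onto z : exists v, g v == z by have [v ->] := (gL z).1 I; exists v.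
pose h z := xchoose (onto z).
have hK : cancel h g by move=> z; apply/eqP/(xchooseP (onto z)).
have gK : cancel g h by move=> v; apply: (fmorph_inj g); rewrite hK.
have hB : zmod_morphism h by move=> a b; apply: (fmorph_inj g); rewrite rmorphB !hK.
have hM : monoid_morphism h.
  by split=> [|a b]; apply: (fmorph_inj g); rewrite ?rmorph1 ?rmorphM !hK.
pose hA := GRing.isZmodMorphism.Build K M h hB.
pose hM' := GRing.isMonoidMorphism.Build K M h hM.
pose h' : {rmorphism K -> M} := HB.pack h hA hM'.
pose Gal := 'Gal({:M} / 1)%g.
pose s (i : 'I_#|Gal|) := enum_val i.
pose conj (f : gal_of {:M}) : {rmorphism K -> K} := g \o f \o h'.
exists #|Gal|, (fun i => conj (s i)), (fun i => conj (s i)^-1%g).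
have fixE i z : in_kt iota t z -> conj (s i) z = z.
  move=> /gE[a ->]; rewrite /conj /= gK; congr (g _).
  by apply: (fixed_gal (sub1v _) (enum_valP i)); rewrite memvZ // mem1v.
have invK (f : gal_of {:M}) v : f (f^-1%g v) = v.
  by rewrite -galM ?memvf // mulVg gal_id.
have invK' (f : gal_of {:M}) v : f^-1%g (f v) = v.
  by rewrite -galM ?memvf // mulgV gal_id.
split.
- move=> i; split => z.
  + by apply: fixE; apply: in_ktC.
  + rewrite -{1}(fixE i (iota z) (in_ktC _ _ _)) /conj /= gK invK' hK //.
  + by rewrite /conj /= gK invK' hK.
  + by rewrite /conj /= gK invK hK.
- by move=> i; apply: fixE; apply: in_kt_id.
- move=> i j e; apply: enum_val_inj; apply/eqP/gal_eqP => v _.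
  by have := e (g v); rewrite /conj /= gK => /fmorph_inj.
move=> n z nN; have dimM : \dim {:M} = #|Gal|.
  by rewrite -(galois_dim hG) dimv1 divn1.
pose Z : n.-tuple M := [tuple h (z i) | i < n].
have Zi (i : 'I_n) : Z`_i = h (z i) by rewrite -tnth_nth tnth_mktuple.
have nf : ~~ free Z.
  apply/negP => /eqP fZ; have := dimvS (subvf <<Z>>%VS).
  by rewrite fZ size_tuple dimM leqNgt nN.
have [u [u0 e]] : exists u : 'I_n -> F, (exists i, u i != 0) /\ \sum_i u i *: Z`_i = 0.
  apply: NNPP => nu; case/negP: nf; apply/freeP => u e i; apply/eqP/negPn/negP => ui.
  by apply: nu; exists u; split => //; exists i.
exists (fun i => g (u i)%:A); split.
- have [i ui] := u0; exists i; rewrite fmorph_eq0 scaler_eq0 oner_eq0 orbF //.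
- by move=> i; apply/gE; exists (u i).
rewrite -[RHS](rmorph0 g) -e rmorph_sum; apply: eq_bigr => i _.
by rewrite Zi -[in RHS]mulr_algl rmorphM hK.
Qed.

(** * Image function fields *)

Section Bivariate.
Variable (k : fieldType).

Definition poly_of_mpoly : {mpoly k[2]} -> {poly {poly k}} :=
  mmap (polyC \o polyC) (fun i : 'I_2 => [:: 'X%:P; 'X]`_i).

Lemma poly_of_mpolyM g h : poly_of_mpoly (g * h) = poly_of_mpoly g * poly_of_mpoly h.
Proof. exact: (mmap_is_multiplicative _ _).1. Qed.

Lemma poly_of_mpolyD g h : poly_of_mpoly (g + h) = poly_of_mpoly g + poly_of_mpoly h.
Proof. exact: mmapD. Qed.

Lemma poly_of_mpolyC a : poly_of_mpoly a%:MP = a%:P%:P.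
Proof. exact: mmapC. Qed.

Lemma poly_of_mpolyX i : poly_of_mpoly 'X_i = [:: 'X%:P; 'X]`_i.
Proof. by rewrite /poly_of_mpoly mmapX mmap1U. Qed.

Lemma poly_of_mpoly_onto P : exists g, poly_of_mpoly g = P.
Proof.
elim/poly_ind: P => [|P f [g IH]]; first by exists 0; rewrite /poly_of_mpoly mmap0.
have [h hf] : exists h, poly_of_mpoly h = f%:P.
  elim/poly_ind: f => [|f a [h IHf]]; first by exists 0; rewrite /poly_of_mpoly mmap0.
  exists (h * 'X_(0 : 'I_2) + a%:MP).
  by rewrite poly_of_mpolyD poly_of_mpolyM poly_of_mpolyC poly_of_mpolyX IHf polyCD polyCM.
exists (g * 'X_(1 : 'I_2) + h).
by rewrite poly_of_mpolyD poly_of_mpolyM poly_of_mpolyX IH hf.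
Qed.

Lemma poly_of_mpoly_horner (i : 'I_2) (f : {poly k}) :
  poly_of_mpoly (horner_alg ('X_i : {mpoly k[2]}) f)
  = (map_poly (polyC \o polyC) f).[[:: 'X%:P; 'X]`_i].
Proof.
elim/poly_ind: f => [|f a IH]; first by rewrite !rmorph0 horner0 /poly_of_mpoly mmap0.
rewrite rmorphD rmorphM /= horner_algC horner_algX poly_of_mpolyD poly_of_mpolyM IH.
rewrite poly_of_mpolyX rmorphD rmorphM /= map_polyX map_polyC hornerD hornerM hornerX hornerC.
by congr (_ + _); rewrite -mul_mpolyC mulr1 poly_of_mpolyC.
Qed.

Lemma poly_of_mpoly_curve (L : {poly k}) c : poly_of_mpoly (curve_poly L L c) = curve_rel L c.
Proof.
rewrite /curve_poly /curve_rel poly_of_mpolyD poly_of_mpolyM poly_of_mpolyC !poly_of_mpoly_horner /=.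
congr (_ * _ + _).
  elim/poly_ind: L => [|L a IH]; first by rewrite rmorph0 horner0.
  rewrite rmorphD rmorphM /= map_polyX map_polyC hornerD hornerM hornerX hornerC IH.
  by rewrite polyCD polyCM.
elim/poly_ind: L => [|L a IH]; first by rewrite !rmorph0 horner0.
by rewrite !rmorphD !rmorphM /= !map_polyX !map_polyC hornerD hornerM hornerX hornerC IH.
Qed.

Variables (K : fieldType) (iota : {rmorphism k -> K}).

Lemma ev2_poly_of_mpoly x y g :
  ev2 iota x y (poly_of_mpoly g) = mmap iota (fun i : 'I_2 => [:: x; y]`_i) g.
Proof.
rewrite /poly_of_mpoly /mmap.
rewrite (big_morph _ (ev2D iota x y) (ev2_0 iota x y)); apply: eq_bigr => m _.
rewrite ev2M /= ev2C ev1C /mmap1 !big_ord_recl !big_ord0 /= !mulr1 ev2M.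
by rewrite !ev2Xn ev2C ev1X ev2X.
Qed.

Lemma is_curve_function_field (L : {poly k}) c x y :
  is_plane_curve_function_field iota (curve_poly L L c) x y -> is_curve iota L c x y.
Proof.
rewrite /is_plane_curve_function_field => -[ker gen]; split=> [P|z].
  have [g <-] := poly_of_mpoly_onto P; rewrite ev2_poly_of_mpoly ker.
  split=> [[h ->]|[Q e]].
    by exists (poly_of_mpoly h); rewrite poly_of_mpolyM poly_of_mpoly_curve.
  apply/ker; rewrite -ev2_poly_of_mpoly e; have [h <-] := poly_of_mpoly_onto Q.
  rewrite -(poly_of_mpoly_curve L c) -poly_of_mpolyM ev2_poly_of_mpoly.
  by apply/ker; exists h.
have [g [h [h0 ->]]] := gen z; exists (poly_of_mpoly g), (poly_of_mpoly h).
by rewrite !ev2_poly_of_mpoly.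
Qed.

End Bivariate.

Section ImageField.
Variables (k K : fieldType) (iota : {rmorphism k -> K}) (n : nat) (v : 'cV[K]_n).
Local Notation image := (image_function_field iota v).
Local Notation ev := (mmap iota (fun i : 'I_n => v i 0)).

Let evM g h : ev (g * h) = ev g * ev h.
Proof. exact: (mmap_is_multiplicative _ _).1. Qed.

Let ev_1 : ev 1 = 1.
Proof. exact: (mmap_is_multiplicative _ _).2. Qed.

Lemma image_C a : image (iota a).
Proof.
exists 0%N, (a *: 1), 1; split.
- by apply: dhomogZ; apply: dhomog1.
- exact: dhomog1.
- by rewrite ev_1 oner_eq0.
by rewrite mmapZ ev_1 mulr1 divr1.
Qed.

Lemma image_ratio i j : v j 0 != 0 -> image (v i 0 / v j 0).
Proof.
move=> vj; exists 1%N, 'X_i, 'X_j; rewrite !mmapX !mmap1U.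
by split => //; rewrite dhomogX; apply/eqP; apply: mdeg1.
Qed.

Lemma image_D a b : image a -> image b -> image (a + b).
Proof.
move=> [d [P [Q [hP hQ Q0 ->]]]] [d' [P' [Q' [hP' hQ' Q0' ->]]]].
exists (d + d')%N, (P * Q' + P' * Q), (Q * Q'); split.
- apply: dhomogD; first exact: dhomogM.
  by rewrite addnC; apply: dhomogM.
- exact: dhomogM.
- by rewrite evM mulf_neq0.
by rewrite mmapD !evM addf_div.
Qed.

Lemma image_M a b : image a -> image b -> image (a * b).
Proof.
move=> [d [P [Q [hP hQ Q0 ->]]]] [d' [P' [Q' [hP' hQ' Q0' ->]]]].
exists (d + d')%N, (P * P'), (Q * Q').
by split; rewrite ?evM ?mulf_neq0 ?mulf_div //; apply: dhomogM.
Qed.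

Lemma image_V a : image a -> image a^-1.
Proof.
move=> [d [P [Q [hP hQ Q0 ->]]]]; have [P0|P0] := eqVneq (ev P) 0.
  by rewrite P0 mul0r invr0 -(rmorph0 iota); apply: image_C.
by exists d, Q, P; split => //; rewrite invf_div.
Qed.

End ImageField.

(** A form of degree d divided by the d-th power of the second coordinate is a polynomial in the
    ratio of the coordinates. *)
Lemma image_pencil (k : closedFieldType) (K : fieldType) (iota : {rmorphism k -> K})
    (v : 'cV[K]_2) z : v 1 0 != 0 ->
  image_function_field iota v z <-> in_kt iota (v 0 0 / v 1 0) z.
Proof.
move=> v1; split=> [[d [P [Q [hP hQ Q0 ->]]]]|[f [g [g0 ->]]]]; last first.
  have pol h : image_function_field iota v (ev1 iota (v 0 0 / v 1 0) h).
    apply: (ev1_ind (S := image_function_field iota v)) => [a||a b|a b].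
    - exact: image_C.
    - exact: image_ratio.
    - exact: image_D.
    exact: image_M.
  by apply: image_M => //; apply: image_V.
set s := _ / _; pose ev := mmap iota (fun i => v i 0).
have hom (R : {mpoly k[2]}) : R \is d.-homog -> in_kt iota s (ev R / v 1 0 ^+ d).
  move=> /dhomogP hR; rewrite /ev /mmap mulr_suml big_seq.
  apply: (big_ind (in_kt iota s)); first by rewrite -(rmorph0 iota); apply: in_ktC.
    by move=> a b; apply: in_ktD.
  move=> m /hR md; have {}md : mdeg m = d by [].
  rewrite mdegE !big_ord_recl big_ord0 addn0 in md.
  rewrite -mulrA; apply: in_ktM; first exact: in_ktC.
  rewrite /mmap1 !big_ord_recl big_ord0 mulr1 -md exprD.
  have -> : lift ord0 ord0 = 1 :> 'I_2 by apply: val_inj.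
  have -> : v 0 0 ^+ m 0 * v 1 0 ^+ m 1 / (v 1 0 ^+ m ord0 * v 1 0 ^+ m 1) = ev1 iota s 'X^(m 0).
    by rewrite ev1Xn ev1X /s expr_div_n; field; rewrite !expf_neq0.
  exact: in_kt_ev1.
have -> : ev P / ev Q = (ev P / v 1 0 ^+ d) / (ev Q / v 1 0 ^+ d).
  by field; rewrite Q0 expf_neq0.
by apply: in_ktM; [|apply: in_ktV]; apply: hom.
Qed.

(** The third coordinate is 1, so the field of the image contains x and y: the map is birational
    onto its image. *)
Lemma image_phi_xy (k K : fieldType) (iota : {rmorphism k -> K}) (L : {poly k}) c x y z :
  is_curve iota L c x y -> image_function_field iota (phi_xy x y) z.
Proof.
move=> hC; have vZ : phi_xy x y iZ 0 = 1 by rewrite mxE.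
have coord i : image_function_field iota (phi_xy x y) (phi_xy x y i 0).
  by have := @image_ratio _ _ iota _ (phi_xy x y) i iZ; rewrite vZ divr1; apply; rewrite oner_eq0.
apply: (is_curve_ind (S := image_function_field iota (phi_xy x y)) hC) => [a|||a b|a b|a].
- exact: image_C.
- by have := coord iX; rewrite mxE.
- by have := coord iY; rewrite mxE.
- exact: image_D.
- exact: image_M.
exact: image_V.
Qed.

(** * Finite subfields and lines *)

(** Multiplication by a nonzero z of the subfield permutes its nonzero elements, so their product P
    satisfies z^(p^i - 1) P = P. Conversely, the p^i fixed points of the Frobenius power form a
    subfield. *)
Lemma in_subfield_of_orderP (k : closedFieldType) p i (z : k) : p \in [pchar k] -> (0 < i)%N ->
  in_subfield_of_order (p ^ i) z <-> z ^+ (p ^ i) = z.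
Proof.
move=> hp i0; have q0 : (0 < p ^ i)%N by rewrite expn_gt0 prime_gt0 // (pcharf_prime hp).
split=> [[s [us ss [s1 sB sV] zs]]|hz].
  have s0 : 0 \in s by rewrite -(subrr 1); apply: sB.
  have [->|z0] := eqVneq z 0; first by rewrite expr0n gtn_eqF.
  have sM u : u \in s -> z * u \in s.
    by move=> us'; rewrite -[u]invrK; apply: (sV) => //; rewrite -[u^-1]div1r; apply: (sV).
  pose r := rem 0 s; pose P := \prod_(u <- r) u.
  have ur : uniq r by rewrite rem_uniq.
  have rP u : (u \in r) = (u != 0) && (u \in s) by rewrite mem_rem_uniq // inE.
  have P0 : P != 0.
    by rewrite prodf_seq_neq0; apply/allP => u; rewrite rP => /andP[].
  have uz : uniq [seq z * u | u <- r] by rewrite map_inj_uniq //; apply: mulfI.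
  have sub : {subset [seq z * u | u <- r] <= r}.
    move=> _ /mapP[u + ->]; rewrite !rP => /andP[u0 /sM ->].
    by rewrite mulf_neq0.
  have [_ e] := uniq_min_size uz sub (eq_leq (esym (size_map _ _))).
  have : z ^+ (p ^ i).-1 * P = P.
    rewrite -[RHS](perm_big _ (uniq_perm uz ur e)) /= big_map big_split /=.
    by rewrite big_const_seq count_predT iter_mulr_1 size_rem // ss.
  rewrite -{2}[P]mul1r => /(mulIf P0) h.
  by rewrite -(prednK q0) exprS h mulr1.
have [s [us ss hs]] := frobenius_fixed hp i0.
have nat_p : [pchar k].-nat (p ^ i)%N by rewrite pcharf_pexp.
exists s; split => //; last exact/hs.
split=> [|u v /hs hu /hs hv|u v /hs hu /hs hv]; apply/hs.
- exact: expr1n.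
- by rewrite exprDn_pchar // exprNn_pchar // hu hv.
by rewrite expr_div_n hu hv.
Qed.

Section Lines.
Variable k : fieldType.

Definition row4 (a b c d : k) : 'I_4 -> k := fun j => [:: a; b; c; d]`_j.

Definition mx2 (f g : 'I_4 -> k) : 'M[k]_(2, 4) :=
  \matrix_(i, j) if i == 0 then f j else g j.

Definition dot (f : 'I_4 -> k) (v : 'cV[k]_4) : k :=
  f iX * v iX 0 + f iY * v iY 0 + f iZ * v iZ 0 + f iW * v iW 0.

Lemma sum4 (V : nmodType) (F : 'I_4 -> V) : \sum_j F j = F iX + F iY + F iZ + F iW.
Proof.
rewrite !big_ord_recl big_ord0 addr0 -!addrA.
by congr (F _ + (F _ + (F _ + F _))); apply: val_inj.
Qed.

Lemma mulmx4 n (H : 'M[k]_(n, 4)) v i : (H *m v) i 0 = dot (H i) v.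
Proof. by rewrite mxE sum4. Qed.

Lemma mulmx_eq0 n (H : 'M[k]_(n, 4)) (v : 'cV_4) : H *m v = 0 <-> forall i, dot (H i) v = 0.
Proof.
split=> [e i|h]; first by rewrite -mulmx4 e mxE.
by apply/colP => i; rewrite mulmx4 h mxE.
Qed.

Lemma mx2_eq0 f g (v : 'cV_4) : mx2 f g *m v = 0 <-> dot f v = 0 /\ dot g v = 0.
Proof.
rewrite mulmx_eq0; split=> [h|[h0 h1] i].
  by have := h 0; have := h 1; rewrite /dot !mxE.
rewrite /dot !mxE; case: eqP => _; [exact: h0|exact: h1].
Qed.

Lemma dim_kernel n (H : 'M[k]_(n, 4)) l : defined_by H l -> (4 <= \dim l + n)%N.
Proof.
move=> hH; pose f : 'Hom('cV[k]_4, 'cV[k]_n) := linfun (mulmx H).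
have ker : lker f = l.
  apply/vspaceP => v; rewrite memv_ker lfunE /=.
  by apply/eqP/idP => /hH.
have e : (\dim l + \dim (f @: fullv) = 4)%N.
  by rewrite -ker -[lker f in LHS]capfv limg_ker_dim dimvf dim_matrix.
rewrite -[X in (X <= _)%N]e leq_add2l.
by rewrite (leq_trans (dimvS (subvf _))) // dimvf dim_matrix mulr1.
Qed.

(** Dependent rows would make l the zero set of a single linear form, of dimension at least 3. *)
Lemma rows_independent (H : 'M[k]_(2, 4)) l u v : defined_by H l -> is_line l ->
  (forall j, u * H 0 j + v * H 1 j = 0) -> u = 0 /\ v = 0.
Proof.
move=> hH dl e; apply: NNPP => uv.
have [w hw] : exists w : 'rV[k]_4, forall x : 'cV[k]_4, (x \in l <-> w *m x = 0).
  have [u0|u0] := eqVneq u 0.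
    have v0 : v != 0 by apply: contra_notN uv => /eqP ->.
    exists (\row_j H 0 j) => x; rewrite (hH x) !mulmx_eq0; split=> [h i|h i].
      by rewrite -[RHS](h 0) /dot !mxE.
    have H1 j : H 1 j = 0.
      by apply: (mulfI v0); have := e j; rewrite u0 mul0r add0r mulr0.
    have := h 0; rewrite /dot !mxE.
    have [->|->] : i = 0 \/ i = 1; last by rewrite !H1 !mul0r !addr0.
      by case: i => -[|[|//]] ?; [left|right]; apply: val_inj.
    by [].
  have H0 j : H 0 j = - (v / u) * H 1 j.
    apply: (mulfI u0); apply/eqP; rewrite -subr_eq0 -[X in _ == X](e j).
    by apply/eqP; field.
  exists (\row_j H 1 j) => x; rewrite (hH x) !mulmx_eq0; split=> [h i|h i].
    by rewrite -[RHS](h 1) /dot !mxE.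
  have := h 0; rewrite /dot !mxE => e1.
  have [->|->] : i = 0 \/ i = 1; last by [].
    by case: i => -[|[|//]] ?; [left|right]; apply: val_inj.
  rewrite !H0; transitivity (- (v / u) * (H 1 iX * x iX 0 + H 1 iY * x iY 0 + H 1 iZ * x iZ 0 + H 1 iW * x iW 0)).
    by ring.
  by rewrite e1 mulr0.
by have := dim_kernel hw; rewrite dl.
Qed.

(** Invertible row operations that remove the W coefficient of the first form; on the ratio of the
    two forms they act by a Moebius map, so the field k(t) does not change. *)
Lemma echelon (H : 'M[k]_(2, 4)) : exists P Q : 'M[k]_2, Q *m P = 1%:M /\ (P *m H) 0 iW = 0.
Proof.
have [w0|w0] := eqVneq (H 0 iW) 0; first by exists 1%:M, 1%:M; rewrite !mul1mx.
pose b := H 1 iW / H 0 iW.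
exists (\matrix_(i, j) if i == 0 then if j == 0 then - b else 1 else if j == 0 then 1 else 0).
exists (\matrix_(i, j) if i == 0 then if j == 0 then 0 else 1 else if j == 0 then 1 else b).
split.
  apply/matrixP => i j; rewrite mxE !big_ord_recl big_ord0 !mxE /=.
  by case: i => -[|[|//]] ?; case: j => -[|[|//]] ?; rewrite /=; ring.
rewrite mxE !big_ord_recl big_ord0 !mxE /= addr0 mul1r /b.
have -> : lift ord0 ord0 = 1 :> 'I_2 by apply: val_inj.
by rewrite mulNr divfK // addNr.
Qed.

End Lines.

Lemma mulmx_phi (k : closedFieldType) (K : fieldType) (iota : {rmorphism k -> K}) n (H : 'M[k]_(n, 4)) x y i :
  (map_mx iota H *m phi_xy x y) i 0 = bilinear iota x y (H i iZ) (H i iX) (H i iY) (H i iW).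
Proof. by rewrite mxE sum4 !mxE /= /bilinear; ring. Qed.

Lemma line_of_forms (k : fieldType) (l : {vspace 'cV[k]_4}) A s A' s' b1 b2 :
  A * s' != A' * s ->
  (forall v : 'cV_4, v \in l <-> A * v iZ 0 + s * (b1 * v iX 0 + b2 * v iY 0) = 0 /\
                                 A' * v iZ 0 + s' * (b1 * v iX 0 + b2 * v iY 0) = 0) ->
  forall v : 'cV_4, v \in l <-> v iZ 0 = 0 /\ b1 * v iX 0 + b2 * v iY 0 = 0.
Proof.
move=> d h v; rewrite (h v); split=> [[e0 e1]|[-> ->]]; last by rewrite !mulr0 addr0.
have d0 : A * s' - A' * s != 0 by rewrite subr_eq0.
split; apply: (mulfI d0); rewrite mulr0.
  transitivity (s' * (A * v iZ 0 + s * (b1 * v iX 0 + b2 * v iY 0))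
     - s * (A' * v iZ 0 + s' * (b1 * v iX 0 + b2 * v iY 0))); first ring.
  by rewrite e0 e1 !mulr0 subrr.
transitivity (A * (A' * v iZ 0 + s' * (b1 * v iX 0 + b2 * v iY 0))
   - A' * (A * v iZ 0 + s * (b1 * v iX 0 + b2 * v iY 0))); first ring.
by rewrite e0 e1 !mulr0 subrr.
Qed.

Section Lines.
Variables (k : closedFieldType) (p r : nat).
Hypotheses (hp : p \in [pchar k]) (r0 : (0 < r)%N).
Local Notation in_sub := (in_subfield_of_order (p ^ r)).

Lemma in_sub0 : in_sub (0 : k).
Proof. by apply/(in_subfield_of_orderP _ hp r0); rewrite expr0n gtn_eqF // expn_gt0 prime_gt0 ?(pcharf_prime hp). Qed.

Lemma in_sub1 : in_sub (1 : k).
Proof. by apply/(in_subfield_of_orderP _ hp r0); rewrite expr1n. Qed.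

Lemma rational_line (l : {vspace 'cV[k]_4}) b1 b2 : in_sub b1 -> in_sub b2 ->
  (forall v : 'cV_4, v \in l <-> v iZ 0 = 0 /\ b1 * v iX 0 + b2 * v iY 0 = 0) ->
  [/\ rational_over_subfield_of_order (p ^ r) l,
      (forall v : 'cV[k]_4, v \in l -> v iZ 0 = 0) & delta_mx iW 0 \in l].
Proof.
move=> h1 h2 hl; split.
- exists 2%N, (mx2 (row4 0 0 1 0) (row4 b1 b2 0 0)); split.
    move=> i j; rewrite mxE /row4; have i0 := in_sub0; have i1 := in_sub1.
    by case: (i == 0); case: j => -[|[|[|[|//]]]].
  move=> v; rewrite (hl v) mx2_eq0 /dot /row4 /=; split=> -[].
    by move=> -> e; rewrite !mul0r !mulr0 !addr0 e.
  by rewrite !mul0r !addr0 !add0r mul1r.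
- by move=> v /hl[].
by apply/hl; rewrite !mxE /= !mulr0 addr0.
Qed.

(** A line in Z = 0 through (0 : 0 : 0 : 1) is determined by the ratio X : Y of another of its
    points w. The rows of H have no W coefficient and vanish at w, so any row with a nonzero X or Y
    coefficient cuts out l in that plane, and its entries already lie in the subfield. *)
Lemma rational_lineP (l : {vspace 'cV[k]_4}) : is_line l ->
  rational_over_subfield_of_order (p ^ r) l -> (forall v : 'cV[k]_4, v \in l -> v iZ 0 = 0) ->
  delta_mx iW 0 \in l ->
  exists b1 b2, [/\ in_sub b1, in_sub b2, (b1 != 0) || (b2 != 0) &
    forall v : 'cV_4, v \in l <-> v iZ 0 = 0 /\ b1 * v iX 0 + b2 * v iY 0 = 0].
Proof.
move=> dl [m [H [hs hH]]] lZ lW.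
have HW i : H i iW = 0.
  have := (mulmx_eq0 H _).1 ((hH _).1 lW) i.
  by rewrite /dot !mxE /= !mulr0 !add0r mulr1.
have [w [wl wn]] : exists w : 'cV[k]_4, w \in l /\ (w iX 0 != 0) || (w iY 0 != 0).
  apply: NNPP => nw.
  have sub : (l <= <[delta_mx iW (0 : 'I_1)%R : 'cV[k]_4]>)%VS.
    apply/subvP => w wl; have wZ := lZ w wl.
    have [wX wY] : w iX 0 = 0 /\ w iY 0 = 0.
      split; apply/eqP/negPn/negP => h; apply: nw; exists w.
        by split=> //; rewrite h.
      by split=> //; rewrite h orbT.
    have -> : w = w iW 0 *: delta_mx iW 0.
      apply/colP => j; rewrite !mxE; case: j => -[|[|[|[|//]]]] hj /=; rewrite ?mulr0 ?mulr1.
      - by rewrite -[RHS]wX; congr (w _ _); apply: val_inj.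
      - by rewrite -[RHS]wY; congr (w _ _); apply: val_inj.
      - by rewrite -[RHS]wZ; congr (w _ _); apply: val_inj.
      by congr (w _ _); apply: val_inj.
    by rewrite memvZ // memv_line.
  have := dimvS sub; rewrite dl dim_vline; by case: eqP.
have Hw i : H i iX * w iX 0 + H i iY * w iY 0 = 0.
  have := (mulmx_eq0 H _).1 ((hH _).1 wl) i.
  by rewrite /dot (lZ w wl) HW !mulr0 mul0r !addr0.
have [i hi] : exists i, (H i iX != 0) || (H i iY != 0).
  apply: NNPP => nH; have H0 i : H i iX = 0 /\ H i iY = 0.
    by split; apply/eqP/negPn/negP => h; apply: nH; exists i; rewrite h ?orbT.
  have lH : defined_by (row iZ 1%:M : 'M[k]_(1, 4)) l.
    move=> v; rewrite mulmx_eq0; split=> [/lZ vZ j|h].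
      by rewrite /dot !mxE /= vZ !mul0r mulr0 !addr0.
    apply/hH/mulmx_eq0 => i; have := h 0; rewrite /dot !mxE /= !mul0r mul1r !add0r addr0 => ->.
    by have [-> ->] := H0 i; rewrite HW !mul0r mulr0 !addr0.
  by have := dim_kernel lH; rewrite dl.
exists (H i iX), (H i iY); split => // v; split=> [vl|[vZ e]].
  split; first exact: lZ.
  have := (mulmx_eq0 H _).1 ((hH _).1 vl) i.
  by rewrite /dot (lZ v vl) HW mulr0 mul0r !addr0.
have cross : v iX 0 * w iY 0 = v iY 0 * w iX 0.
  case/orP: hi => h; apply: (mulfI h); apply/eqP; rewrite -subr_eq0; apply/eqP.
    transitivity ((H i iX * v iX 0 + H i iY * v iY 0) * w iY 0
      - v iY 0 * (H i iX * w iX 0 + H i iY * w iY 0)); first ring.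
    by rewrite e Hw mul0r mulr0 subrr.
  transitivity (v iX 0 * (H i iX * w iX 0 + H i iY * w iY 0)
    - (H i iX * v iX 0 + H i iY * v iY 0) * w iX 0); first ring.
  by rewrite e Hw mul0r mulr0 subrr.
apply/hH/mulmx_eq0 => j; rewrite /dot vZ HW mulr0 mul0r !addr0.
case/orP: wn => h; apply: (mulIf h); rewrite mul0r.
  transitivity (v iX 0 * (H j iX * w iX 0 + H j iY * w iY 0)
    - H j iY * (v iX 0 * w iY 0 - v iY 0 * w iX 0)); first ring.
  by rewrite Hw cross subrr !mulr0 subrr.
transitivity (v iY 0 * (H j iX * w iX 0 + H j iY * w iY 0)
  + H j iX * (v iX 0 * w iY 0 - v iY 0 * w iX 0)); first ring.
by rewrite Hw cross subrr !mulr0 addr0.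
Qed.

End Lines.

(** * From lines to pencils and back *)

Section GaloisLine.
Variables (k : closedFieldType) (K : fieldType) (iota : {rmorphism k -> K}).
Variables (p m : nat) (alpha : 'I_m.+1 -> k) (lam : 'I_(p ^ m) -> k).
Hypothesis hA : additive_setup alpha lam.
Local Notation L := (additive_poly p alpha).
Local Notation scalar := (scalar p alpha).
Variables (c : k) (x y : K).
Hypotheses (c0 : c != 0) (hC : is_curve iota L c x y).
Variable l : {vspace 'cV[k]_4}.

Lemma galois_lineI f g t :
  (forall v : 'cV_4, v \in l <-> dot f v = 0 /\ dot g v = 0) ->
  bilinear iota x y (g iZ) (g iX) (g iY) (g iW) != 0 ->
  bilinear iota x y (f iZ) (f iX) (f iY) (f iW) = t * bilinear iota x y (g iZ) (g iX) (g iY) (g iW) ->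
  galois_extension (in_kt iota t) (fun _ : K => True) ->
  galois_line iota (phi_xy x y) l.
Proof.
move=> hl g0 e hG; exists (mx2 f g); split; first by move=> v; rewrite hl mx2_eq0.
have e0 : (map_mx iota (mx2 f g) *m phi_xy x y) 0 0 = bilinear iota x y (f iZ) (f iX) (f iY) (f iW).
  by rewrite mulmx_phi !mxE.
have e1 : (map_mx iota (mx2 f g) *m phi_xy x y) 1 0 = bilinear iota x y (g iZ) (g iX) (g iY) (g iW).
  by rewrite mulmx_phi !mxE.
apply: galois_extension_eq hG => z; last by split=> // _; apply: image_phi_xy hC.
have -> : t = (map_mx iota (mx2 f g) *m phi_xy x y) 0 0 / (map_mx iota (mx2 f g) *m phi_xy x y) 1 0.
  by rewrite e0 e1 e mulfK.
by apply: iff_sym; apply: image_pencil; rewrite e1.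
Qed.

(** The given forms H are replaced by G = P H with no W term in the first row; P and its inverse Q
    give the two inclusions between the fields generated by the ratios. *)
Lemma galois_lineE : is_line l -> galois_line iota (phi_xy x y) l ->
  exists A B C A' B' C' D' N (sig sig' : 'I_N -> {rmorphism K -> K}),
  [/\ independent A B C A' B' C' D',
      is_galois_group iota (bilinear iota x y A' B' C' D' / bilinear iota x y A B C 0) sig sig' &
      forall v : 'cV_4, v \in l <-> A * v iZ 0 + B * v iX 0 + C * v iY 0 = 0 /\
        A' * v iZ 0 + B' * v iX 0 + C' * v iY 0 + D' * v iW 0 = 0].
Proof.
move=> dl [H [hH hG]]; have [P [Q [QP GW]]] := echelon H.
pose G := P *m H.
have HG : H = Q *m G by rewrite /G mulmxA QP mul1mx.
have lG : defined_by G l.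
  move=> v; rewrite hH; split=> e; first by rewrite -mulmxA e mulmx0.
  by rewrite HG -mulmxA e mulmx0.
pose vH := map_mx iota H *m phi_xy x y; pose vG := map_mx iota G *m phi_xy x y.
have vGE i : vG i 0 = iota (P i 0) * vH 0 0 + iota (P i 1) * vH 1 0.
  have -> : vG = map_mx iota P *m vH by rewrite /vH mulmxA -map_mxM.
  rewrite mxE !big_ord_recl big_ord0 addr0 ![map_mx iota P _ _]mxE.
  by congr (_ + iota (P i _) * vH _ _); apply: val_inj.
have vHE i : vH i 0 = iota (Q i 0) * vG 0 0 + iota (Q i 1) * vG 1 0.
  have -> : vH = map_mx iota Q *m vG by rewrite /vG mulmxA -map_mxM -HG.
  rewrite mxE !big_ord_recl big_ord0 addr0 ![map_mx iota Q _ _]mxE.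
  by congr (_ + iota (Q i _) * vG _ _); apply: val_inj.
have indep : independent (G 0 iZ) (G 0 iX) (G 0 iY) (G 1 iZ) (G 1 iX) (G 1 iY) (G 1 iW).
  move=> u v eZ eX eY eW; apply: (rows_independent lG dl) => j.
  have h : u * G 0 iW + v * G 1 iW = 0 by rewrite GW mulr0 add0r.
  by case: j => -[|[|[|[|//]]]] hj; [rewrite -[RHS]eX|rewrite -[RHS]eY|rewrite -[RHS]eZ|rewrite -[RHS]h];
    congr (_ * G _ _ + _ * G _ _); apply: val_inj.
have vG0 : vG 0 0 = bilinear iota x y (G 0 iZ) (G 0 iX) (G 0 iY) 0 by rewrite mulmx_phi GW.
have vG1 : vG 1 0 = bilinear iota x y (G 1 iZ) (G 1 iX) (G 1 iY) (G 1 iW) by rewrite mulmx_phi.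
have vG00 : vG 0 0 != 0 by rewrite vG0; apply: (pencil_h0_neq0 hA hC indep).
have vH10 : vH 1 0 != 0.
  apply/eqP; rewrite mulmx_phi => /(bilinear_eq0 hA hC)[Z0 X0 Y0 W0].
  have [|_ /eqP] := rows_independent (u := 0) (v := 1) hH dl; last by rewrite oner_eq0.
  move=> j; rewrite mul0r add0r mul1r.
  by case: j => -[|[|[|[|//]]]] hj; [rewrite -[RHS]X0|rewrite -[RHS]Y0|rewrite -[RHS]Z0|rewrite -[RHS]W0];
    congr (H _ _); apply: val_inj.
have hG' : galois_extension (in_kt iota (vG 1 0 / vG 0 0)) (fun _ : K => True).
  apply: galois_extension_eq hG => z; last by split=> // _; apply: image_phi_xy hC.
  rewrite (image_pencil _ _ vH10); split=> h; apply: in_kt_trans h.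
    by apply: (mobius_in_kt (a00 := Q 1 0) (a01 := Q 1 1) (a10 := Q 0 0) (a11 := Q 0 1)).
  by apply: (mobius_in_kt (a00 := P 0 1) (a01 := P 0 0) (a10 := P 1 1) (a11 := P 1 0)) => //;
    rewrite vGE addrC.
have [N [sig [sig' hg]]] := galois_group_of_extension hG'.
exists (G 0 iZ), (G 0 iX), (G 0 iY), (G 1 iZ), (G 1 iX), (G 1 iY), (G 1 iW), N, sig, sig'.
split => //; first by rewrite -vG0 -vG1.
move=> v; rewrite (lG v) mulmx_eq0 /dot; split=> [h|[h0 h1] i].
  by split; [rewrite -[RHS](h 0) GW|rewrite -[RHS](h 1)]; ring.
have [->|->] : i = 0 \/ i = 1.
  by case: i => -[|[|//]] ?; [left|right]; apply: val_inj.
  by rewrite GW -[RHS]h0; ring.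
by rewrite -[RHS]h1; ring.
Qed.

End GaloisLine.

Theorem theorem6 (k : closedFieldType) (p : nat) (hp : p \in [pchar k])
    (e : nat) (he : (1 <= e)%N) (hpe : (2 < p ^ e)%N)
    (c : k) (hc : c != 0)
    (alpha1 alpha2 : 'I_e.+1 -> k)
    (h1 : alpha1 ord_max * alpha1 ord0 != 0)
    (h2 : alpha2 ord_max * alpha2 ord0 != 0)
    (K : fieldType) (iota : {rmorphism k -> K}) (x y : K)
    (hK : is_plane_curve_function_field iota
            (curve_poly (additive_poly p alpha1) (additive_poly p alpha2) c) x y)
    (r : nat) (hr1 : (1 <= r)%N)
    (hr : forall z : k,
       in_subfield_of_order (p ^ r) z <->
       (forall i : 'I_e.+1, (0 < i)%N -> alpha1 i != 0 ->
          in_subfield_of_order (p ^ i) z) /\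
       (forall j : 'I_e.+1, (0 < j)%N -> alpha2 j != 0 ->
          in_subfield_of_order (p ^ j) z))
    (hL : additive_poly p alpha1 = additive_poly p alpha2)
    (hre : (r < e)%N)
    (l : {vspace 'cV[k]_4}) (hl : is_line l) :
  galois_line iota (phi_xy x y) l <->
  ([/\ rational_over_subfield_of_order (p ^ r) l,
       (forall v : 'cV[k]_4, v \in l -> v iZ 0 = 0)
     & delta_mx iW 0 \in l]
   \/
   (exists a : k,
      (forall v : 'cV[k]_4,
         v \in l <-> v iW 0 - a * v iX 0 = 0 /\ v iY 0 - a * v iZ 0 = 0) \/
      (forall v : 'cV[k]_4,
         v \in l <-> v iW 0 - a * v iY 0 = 0 /\ v iX 0 - a * v iZ 0 = 0))).
Proof.
have [am a0] : alpha1 ord_max != 0 /\ alpha1 ord0 != 0 by apply/andP; rewrite -negb_or -mulf_eq0.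
have [lam [li lE]] := additive_roots hp a0 am.
have hA : additive_setup alpha1 lam := AdditiveSetup hp hpe a0 am li lE.
have alphaE i : alpha2 i = alpha1 i by rewrite -!(coef_additive_pexp _ hp) hL.
have hC : is_curve iota (additive_poly p alpha1) c x y.
  by rewrite -hL in hK; apply: is_curve_function_field.
have scP a : scalar p alpha1 a <-> in_subfield_of_order (p ^ r) a.
  rewrite hr; split=> [sa|[sa _] i ai].
    by split=> i i0; rewrite ?alphaE => ai; apply/in_subfield_of_orderP => //; apply: sa.
  (* Index 0 does not occur in the intersection defining r, and it imposes no condition on a scalar
     since a^(p^0) = a. *)
  have [i0|i0] := posnP i; first by rewrite i0 expn0 expr1.
  by apply/in_subfield_of_orderP => //; apply: sa.
have fixr a : a != 0 -> scalar p alpha1 a -> a ^+ (p ^ r) = a.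
  by move=> _ /scP/(in_subfield_of_orderP _ hp hr1).
have hC' := is_curve_swap hC.
have gx := galois_x hA hC; have gy := galois_x hA hC'.
split=> [hg|[[rat lZ lW]|[a [hl'|hl']]]].
- have [A [B [C [A' [B' [C' [D' [N [sig [sig' [hi hgg lv]]]]]]]]]]] := galois_lineE hA hC hl hg.
  have nz u v : u * A + v * A' = 0 -> u * B + v * B' = 0 -> u * C + v * C' = 0 -> v * D' = 0 ->
      (u != 0) || (v != 0) -> False.
    by move=> e1 e2 e3 e4; have [-> ->] := hi u v e1 e2 e3 e4; rewrite eqxx.
  have [[D0 dep h]|[a [B0 C0 eA eA' eC']]|[a [C0 B0 eA eA' eB']]] :=
    pencil_classification hA hr1 hre fixr hc hC hi hgg.
  + left.
    (* The forms are A Z + s (b1 X + b2 Y) and A' Z + s' (b1 X + b2 Y); a zero determinant would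
       make them dependent. *)
    have nd s s' b1 b2 : B = s * b1 -> C = s * b2 -> B' = s' * b1 -> C' = s' * b2 ->
       A * s' != A' * s.
      move=> eB eC eB' eC'; apply/eqP => ed.
      have ss : (s' != 0) || (- s != 0) -> False.
        apply: nz; rewrite ?D0 ?mulr0 // ?eB ?eC ?eB' ?eC'; try ring.
        by rewrite mulNr mulrC ed [s * _]mulrC subrr.
      have [s0|/negP s0] := boolP (s == 0); last by apply: ss; rewrite oppr_eq0 orbC; apply/orP; left; apply/negP.
      have [s0'|/negP s0'] := boolP (s' == 0); last by apply: ss; apply/orP; left; apply/negP.
      have AA : (A' != 0) || (- A != 0) -> False.
        by apply: nz; rewrite ?D0 ?mulr0 // ?eB ?eC ?eB' ?eC' ?(eqP s0) ?(eqP s0'); ring.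
      have [A0|/negP A0] := boolP (A == 0); last by apply: AA; rewrite oppr_eq0 orbC; apply/orP; left; apply/negP.
      have [A0'|/negP A0'] := boolP (A' == 0); last by apply: AA; apply/orP; left; apply/negP.
      apply: (nz 1 0); rewrite ?mul0r ?oner_eq0 //.
      * by rewrite (eqP A0) mulr0 addr0.
      * by rewrite eB (eqP s0) mul0r mulr0 addr0.
      by rewrite eC (eqP s0) mul0r mulr0 addr0.
    have fin s s' b1 b2 : in_subfield_of_order (p ^ r) b1 -> in_subfield_of_order (p ^ r) b2 ->
        B = s * b1 -> C = s * b2 -> B' = s' * b1 -> C' = s' * b2 ->
        [/\ rational_over_subfield_of_order (p ^ r) l,
         (forall v : 'cV[k]_4, v \in l -> v iZ 0 = 0) & delta_mx iW 0 \in l].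
      move=> i1 i2 eB eC eB' eC'; apply: (rational_line hp hr1 i1 i2).
      apply: (line_of_forms (nd _ _ _ _ eB eC eB' eC')) => v; rewrite lv D0 eB eC eB' eC'.
      by rewrite mul0r addr0 !mulrDr !mulrA !addrA.
    have i0 := in_sub0 hp hr1; have i1 := in_sub1 hp hr1.
    have [[B0 B'0]|[C0 C'0]|[gamma [g0 sg eC eC']]] := h.
    * by apply: (fin C C' 0 1); rewrite ?mulr0 ?mulr1.
    * by apply: (fin B B' 1 0); rewrite ?mulr0 ?mulr1.
    by apply: (fin B B' 1 gamma); rewrite ?mulr1 // 1?mulrC //; apply/scP.
  + right; exists a; right.
    (* With D' = 0 both forms would be multiples of X - a Z. *)
    have D0 : D' != 0.
      apply/eqP => D0; apply: (nz B' (- B)); rewrite ?oppr_eq0 ?B0 ?orbT // ?eA ?eA' ?eC' ?C0 ?D0; ring.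
    move=> v; rewrite lv eA eA' eC' C0; split=> [[e0 e1]|[e1 e0]].
      have e0' : v iX 0 - a * v iZ 0 = 0 by apply: (mulfI B0); rewrite mulr0 -[RHS]e0; ring.
      split=> //; apply: (mulfI D0); rewrite mulr0.
      transitivity (- a * B' * v iZ 0 + B' * v iX 0 + - a * D' * v iY 0 + D' * v iW 0 - B' * (v iX 0 - a * v iZ 0)).
        by ring.
      by rewrite e1 e0' mulr0 subrr.
    split.
      by transitivity (B * (v iX 0 - a * v iZ 0)); [ring|rewrite e0 mulr0].
    transitivity (B' * (v iX 0 - a * v iZ 0) + D' * (v iW 0 - a * v iY 0)); first ring.
    by rewrite e0 e1 !mulr0 addr0.
  right; exists a; left.
  have D0 : D' != 0.
    apply/eqP => D0; apply: (nz C' (- C)); rewrite ?oppr_eq0 ?C0 ?orbT // ?eA ?eA' ?eB' ?B0 ?D0; ring.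
  move=> v; rewrite lv eA eA' eB' B0; split=> [[e0 e1]|[e1 e0]].
    have e0' : v iY 0 - a * v iZ 0 = 0 by apply: (mulfI C0); rewrite mulr0 -[RHS]e0; ring.
    split=> //; apply: (mulfI D0); rewrite mulr0.
    transitivity (- a * C' * v iZ 0 + - a * D' * v iX 0 + C' * v iY 0 + D' * v iW 0 - C' * (v iY 0 - a * v iZ 0)).
      by ring.
    by rewrite e1 e0' mulr0 subrr.
  split.
    by transitivity (C * (v iY 0 - a * v iZ 0)); [ring|rewrite e0 mulr0].
  transitivity (C' * (v iY 0 - a * v iZ 0) + D' * (v iW 0 - a * v iX 0)); first ring.
  by rewrite e0 e1 !mulr0 addr0.
- have [b1 [b2 [s1 s2 bn lv]]] := rational_lineP hl rat lZ lW.
  have one : bilinear iota x y 1 0 0 0 != 0 by rewrite /bilinear rmorph1 !rmorph0 !mul0r !addr0 oner_eq0.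
  have [b10|b10] := eqVneq b1 0.
    have b20 : b2 != 0 by move: bn; rewrite b10 eqxx.
    apply: (galois_lineI hC (f := row4 0 1 0 0) (g := row4 0 0 1 0) _ one _ gy).
      move=> v; rewrite lv b10 /dot /row4 /= !mul0r !addr0 !add0r !mul1r.
      split=> -[e0 e1]; split=> //; first by apply: (mulfI b20); rewrite mulr0.
      by rewrite e0 mulr0.
    by rewrite /bilinear /row4 /= !rmorph0 rmorph1; ring.
  have [b20|b20] := eqVneq b2 0.
    apply: (galois_lineI hC (f := row4 1 0 0 0) (g := row4 0 0 1 0) _ one _ gx).
      move=> v; rewrite lv b20 /dot /row4 /= !mul0r !addr0 !add0r !mul1r.
      split=> -[e0 e1]; split=> //; first by apply: (mulfI b10); rewrite mulr0.
      by rewrite e0 mulr0.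
    by rewrite /bilinear /row4 /= !rmorph0 rmorph1; ring.
  have g0 : b2 / b1 != 0 by rewrite mulf_neq0 ?invr_eq0.
  have sg : scalar p alpha1 (b2 / b1).
    move: s1 s2 => /scP s1 /scP s2 i ai.
    by rewrite expr_div_n s1 // s2.
  apply: (galois_lineI hC (f := row4 1 (b2 / b1) 0 0) (g := row4 0 0 1 0) _ one _ (galois_sum hA hC g0 sg)).
    move=> v; rewrite lv /dot /row4 /= !mul0r !addr0 !add0r !mul1r.
    split=> -[e0 e1]; split=> //.
      apply: (mulfI b10); rewrite mulr0 -[RHS]e1; by field.
    transitivity (b1 * (v iX 0 + b2 / b1 * v iY 0)); first by field.
    by rewrite e0 mulr0.
  by rewrite /bilinear /row4 /= !rmorph0 rmorph1; ring.
(* On the curve the two forms become x (y - a) and y - a, with ratio x. *)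
- have gn : bilinear iota x y (- a) 0 1 0 != 0.
    by apply: (bil_neq0 hA hC); rewrite oner_eq0 orbT.
  apply: (galois_lineI hC (f := row4 (- a) 0 0 1) (g := row4 0 1 (- a) 0) _ gn _ gx).
    move=> v; rewrite hl' /dot /row4 /= !mul0r !addr0 !add0r !mul1r !mulNr.
    by rewrite [- _ + _]addrC.
  by rewrite /bilinear /row4 /= !rmorph0 rmorph1 rmorphN; ring.
have gn : bilinear iota x y (- a) 1 0 0 != 0.
  by apply: (bil_neq0 hA hC); rewrite oner_eq0 orbT.
apply: (galois_lineI hC (f := row4 0 (- a) 0 1) (g := row4 1 0 (- a) 0) _ gn _ gy).
  move=> v; rewrite hl' /dot /row4 /= !mul0r !addr0 !add0r !mul1r !mulNr.
  by rewrite [- _ + _]addrC.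
by rewrite /bilinear /row4 /= !rmorph0 rmorph1 rmorphN; ring.
Qed.
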